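(* There is a Banach space $X$ with the following properties: (i) The space $X^*$ is a separable $L$-embedded space with the Schur property. In particular, $X^*$ has the direct quantitative Dunford-Pettis property and $X$ has the dual quantitative Dunford-Pettis property. (ii) There is a sequence $(A_n)$ of subsets of $B_{X^*}$ such that $\omega(A_n)=\chi(A_n)\ge\frac14$ for each $n\in\mathbb N$ and $\operatorname{wk}_{X^*}(A_n)\to0$. (iii) There is a sequence $(T_n)$ of bounded linear operators $T_n:X\to c_0$ such that $\|T_n\|\le2$ and $\operatorname{cc}(T_n)\ge1$ for each $n\in\mathbb N$, and $\omega(T_n)=\operatorname{wk}_{c_0}(T_n)\to0$. (iv) The space $X$ does not have the direct quantitative Dunford-Pettis property and $X^*$ does not have the dual quantitative Dunford-Pettis property. (v) The space $X\oplus X^*$ has the Dunford-Pettis property but does not have any of the two variants (direct, dual) of the quantitative Dunford-Pettis property.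
   Context: Banach spaces are real or complex; $B_X$ is the closed unit ball; operator means bounded linear operator. A Banach space has the Schur property if every weakly convergent sequence is norm convergent. A Banach space $Z$ is $L$-embedded if there is a linear projection $P$ of $Z^{**}$ onto $Z$ with $\|z^{**}\|=\|Pz^{**}\|+\|z^{**}-Pz^{**}\|$ for all $z^{**}\in Z^{**}$. $X$ has the Dunford-Pettis property if for every Banach space $Y$ every weakly compact operator $T:X\to Y$ is completely continuous (maps weakly convergent sequences to norm convergent ones). For a bounded sequence $(z_k)$ in a Banach space, $\operatorname{ca}(z_k)=\inf_{n}\sup_{k,l\ge n}\|z_k-z_l\|$. For an operator $S:Z\to W$, $\operatorname{cc}(S)=\sup\{\operatorname{ca}(Sz_k):(z_k)\text{ is a weakly Cauchy sequence in }B_Z\}$. With $\widehat{\operatorname{d}}(A,B)=\sup_{a\in A}\inf_{b\in B}\|a-b\|$, for a bounded subset $A$ of a Banach space $Z$: $\chi(A)=\inf\{\widehat{\operatorname{d}}(A,F):\emptyset\ne F\subset Z\text{ finite}\}$; $\omega(A)=\inf\{\widehat{\operatorname{d}}(A,K):\emptyset\ne K\subset Z\text{ weakly compact}\}$; $\operatorname{wk}_Z(A)=\widehat{\operatorname{d}}(\overline{A}^{w^*},Z)$, with $\overline{A}^{w^*}$ the weak$^*$ closure of $A$ in $Z^{**}$ ($Z$ canonically embedded in $Z^{**}$). For an operator $S:Z\to W$ these quantities applied to $S$ mean their value at $S(B_Z)\subset W$. $X$ has the direct quantitative Dunford-Pettis property if there is $C>0$ such that $\operatorname{cc}(T)\le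 C\operatorname{wk}_{X^*}(T^* )$ for every Banach space $Y$ and every operator $T:X\to Y$ (equivalently, there is $C>0$ with $\operatorname{cc}(T)\le C\operatorname{wk}_Y(T)$ for all such $T$). $X$ has the dual quantitative Dunford-Pettis property if there is $C>0$ such that $\operatorname{cc}(T^* )\le C\operatorname{wk}_X(T)$ for every Banach space $Y$ and every operator $T:Y\to X$. *)

(* Defs.v *)
From HB Require Import structures.
From mathcomp Require Import all_boot all_order all_algebra.
From mathcomp Require Import all_classical all_reals all_analysis.
From mathcomp Require Import complex.

Set Implicit Arguments.
Unset Strict Implicit.
Unset Printing Implicit Defensive.

Import Order.TTheory GRing.Theory Num.Theory.
Import numFieldNormedType.Exports.

Local Open Scope classical_set_scope.
Local Open Scope ring_scope.

(* MathComp-Analysis over an arbitrary realType R. Banach spaces are taken over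
   the scalar field scalar_field R s, which is R or R[i] depending on s. Norms
   of a normedModType K are K-valued; rnorm is the same norm read in R. *)
Variant scalars := RealScalars | ComplexScalars.

Definition scalar_field (R : realType) (s : scalars) : numFieldType :=
  match s with RealScalars => R | ComplexScalars => R[i] end.

Section scalar_field.
Context {R : realType} {s : scalars}.
Local Notation K := (scalar_field R s).

Definition of_real : R -> K :=
  match s return R -> scalar_field R s with
  | RealScalars => fun r : R => r
  | ComplexScalars => fun r : R => Complex r 0
  end.

Definition real_part : K -> R :=
  match s return scalar_field R s -> R with
  | RealScalars => fun x : R => x
  | ComplexScalars => fun z : R[i] => complex.Re z
  end.

Lemma of_realK r : real_part (of_real r) = r.
Proof. by rewrite /real_part /of_real; case: s. Qed.

Lemma real_partK (x : K) : 0 <= x -> of_real (real_part x) = x.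
Proof.
rewrite /real_part /of_real; case: s x => //= -[a b].
by rewrite lecE /= => /andP[/eqP -> _].
Qed.

Lemma le_of_real a b : (of_real a <= of_real b) = (a <= b).
Proof.
by rewrite /of_real; case: s => //=; rewrite lecE /= eqxx.
Qed.

Lemma of_real0 : of_real 0 = 0.
Proof. by rewrite /of_real; case: s. Qed.

Lemma of_realD a b : of_real (a + b) = of_real a + of_real b.
Proof.
rewrite /of_real; case: s => //=.
by apply/eqP; rewrite eq_complex /= addr0 !eqxx.
Qed.

Lemma of_realM a b : of_real (a * b) = of_real a * of_real b.
Proof.
rewrite /of_real; case: s => //=.
by apply/eqP; rewrite eq_complex /= !(mulr0,mul0r,subr0,addr0) !eqxx.
Qed.

End scalar_field.

Section bounded_operators.
Context {R : realType} {s : scalars}.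
Local Notation K := (scalar_field R s).

Definition rnorm (V : normedModType K) (x : V) : R := real_part `|x|.

Lemma rnormE (V : normedModType K) (x : V) : of_real (rnorm x) = `|x|.
Proof. exact: real_partK. Qed.

Lemma rnorm_ge0 (V : normedModType K) (x : V) : 0 <= rnorm x.
Proof. by rewrite -(@le_of_real _ s) rnormE of_real0. Qed.

Definition unit_ball (V : normedModType K) : set V := [set x | `|x| <= 1].
Arguments unit_ball V : clear implicits.

Variables X Y : normedModType K.

(* The space of bounded linear operators X -> Y, with the operator norm. *)
Definition bounded_linear : {pred X -> Y} :=
  fun f => `[< linear f /\ exists M : K, forall x, `|f x| <= M * `|x| >].

Record operator := Operator {
  operator_fun :> X -> Y;
  _ : operator_fun \in bounded_linear }.

HB.instance Definition _ := [isSub for operator_fun].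
HB.instance Definition _ := [Choice of operator by <:].

Lemma bounded_linear_submod : GRing.submod_closed bounded_linear.
Proof.
split.
  apply/asboolP; split=> [a u v|]; first by rewrite /= scaler0 addr0.
  by exists 0 => x; rewrite normr0 mul0r.
move=> a f g /asboolP[lf [M Mf]] /asboolP[lg [N Ng]]; apply/asboolP; split.
  move=> b u v.
  rewrite -[LHS]/(a *: f (b *: u + v) + g (b *: u + v)).
  rewrite -[RHS]/(b *: (a *: f u + g u) + (a *: f v + g v)).
  by rewrite lf lg !scalerDr !scalerA (mulrC b a) addrACA.
exists (`|a| * M + N) => x.
rewrite -[leLHS]/(`|a *: f x + g x|) (le_trans (ler_normD _ _)) //.
by rewrite mulrDl lerD // normrZ -mulrA ler_wpM2l.
Qed.

HB.instance Definition _ :=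
  GRing.isSubmodClosed.Build K (X -> Y) bounded_linear bounded_linear_submod.
HB.instance Definition _ := [SubChoice_isSubLmodule of operator by <:].

Implicit Types f g : operator.

Lemma operator_linear f : linear f.
Proof. by have /asboolP[] := valP f. Qed.

HB.instance Definition _ f :=
  GRing.isLinear.Build K X Y *:%R (operator_fun f) (operator_linear f).

Lemma operatorD f g x : (f + g) x = f x + g x.
Proof. by []. Qed.

Lemma operatorZ (a : K) f x : (a *: f) x = a *: f x.
Proof. by []. Qed.

Definition operator_norm f : K :=
  of_real (sup [set rnorm (f x) | x in unit_ball X]).

Lemma unit_ball0 : unit_ball X 0.
Proof. by rewrite /unit_ball /= normr0. Qed.

Lemma operator_has_sup f : has_sup [set rnorm (f x) | x in unit_ball X].
Proof.
split; first by exists (rnorm (f 0)), 0; first exact: unit_ball0.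
have /asboolP[_ [M Mf]] := valP f.
exists (real_part `|M|) => _ [x x1 <-]; rewrite -(@le_of_real _ s) rnormE real_partK //.
rewrite (le_trans (Mf x)) //.
rewrite -(ger0_norm (le_trans (normr_ge0 _) (Mf x))) normrM normr_id.
by rewrite ler_piMr.
Qed.

Lemma operator_norm_ge0 f : 0 <= operator_norm f.
Proof.
rewrite -(@of_real0 _ s) /operator_norm le_of_real; apply: le_trans (ub_le_sup _ _).
- exact: (rnorm_ge0 (f 0)).
- by have [] := operator_has_sup f.
- by exists 0 => //; exact: unit_ball0.
Qed.

Lemma ler_operator_norm f x : `|f x| <= operator_norm f * `|x|.
Proof.
have [->|x0] := eqVneq x 0; first by rewrite linear0 !normr0 mulr0.
have nx0 : 0 < `|x| by rewrite normr_gt0.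
rewrite -ler_pdivrMr // mulrC -[X in X * _]ger0_norm ?invr_ge0 //.
rewrite -normrZ -linearZ -[leLHS]rnormE /operator_norm le_of_real; apply: ub_le_sup.
  by have [] := operator_has_sup f.
exists (`|x|^-1 *: x) => //.
by rewrite /unit_ball /= normrZ normfV normr_id mulVf // gt_eqF.
Qed.

Lemma operator_norm_le f (M : K) :
  (forall x, unit_ball X x -> `|f x| <= M) -> operator_norm f <= M.
Proof.
move=> fM; have M0 : 0 <= M.
  by apply: le_trans (fM _ unit_ball0); exact: normr_ge0.
rewrite -(real_partK M0) /operator_norm le_of_real; apply: ge_sup.
  by have [] := operator_has_sup f.
move=> _ [x /fM fxM <-].
by rewrite -(@le_of_real _ s) rnormE real_partK.
Qed.

Lemma operator_normD f g :
  operator_norm (f + g) <= operator_norm f + operator_norm g.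
Proof.
apply: operator_norm_le => x x1; rewrite operatorD (le_trans (ler_normD _ _)) //.
by apply: lerD; rewrite (le_trans (ler_operator_norm _ _)) //
  ler_piMr ?operator_norm_ge0.
Qed.

Lemma operator_normZ (a : K) f :
  operator_norm (a *: f) = `|a| * operator_norm f.
Proof.
have le_normZ (b : K) (h : operator) :
    operator_norm (b *: h) <= `|b| * operator_norm h.
  apply: operator_norm_le => x x1; rewrite operatorZ normrZ ler_wpM2l //.
  by rewrite (le_trans (ler_operator_norm _ _)) // ler_piMr ?operator_norm_ge0.
apply/eqP; rewrite eq_le le_normZ /=.
have [->|a0] := eqVneq a 0; first by rewrite normr0 mul0r operator_norm_ge0.
have na0 : 0 < `|a| by rewrite normr_gt0.
rewrite -ler_pdivlMl // -normfV (le_trans _ (le_normZ _ _)) //.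
by rewrite scalerA mulVf // scale1r.
Qed.

Lemma operator_norm_eq0 f : operator_norm f = 0 -> f = 0.
Proof.
move=> f0; apply: val_inj; apply/funext => x /=; apply/eqP.
by rewrite -normr_le0 (le_trans (ler_operator_norm _ _)) // f0 mul0r.
Qed.

HB.instance Definition _ := Lmodule_isNormed.Build K operator
  operator_normD operator_normZ operator_norm_eq0.

Lemma ler_norm_operator f x : `|f x| <= `|f| * `|x|.
Proof. exact: ler_operator_norm. Qed.

End bounded_operators.
Arguments unit_ball {R s} V.

Section c0.
Context {R : realType} {s : scalars}.
Local Notation K := (scalar_field R s).

(* Scalar sequences tending to 0, with the supremum norm. *)
Definition null_sequence : {pred (nat -> K^o)} :=
  fun u => `[< u @ \oo --> (0 : K^o) >].

Record c0 := NullSequence {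
  c0_fun :> nat -> K^o;
  _ : c0_fun \in null_sequence }.

HB.instance Definition _ := [isSub for c0_fun].
HB.instance Definition _ := [Choice of c0 by <:].

Lemma null_sequence_submod : GRing.submod_closed null_sequence.
Proof.
split; first by apply/asboolP; exact: cvg_cst.
move=> a u v /asboolP u0 /asboolP v0; apply/asboolP.
by rewrite -[0 : K^o](addr0 (0 : K^o)) -{1}(scaler0 _ a);
  apply: cvgD => //; apply: cvgZr.
Qed.

HB.instance Definition _ :=
  GRing.isSubmodClosed.Build K (nat -> K^o) null_sequence null_sequence_submod.
HB.instance Definition _ := [SubChoice_isSubLmodule of c0 by <:].

Implicit Types u v : c0.

Definition c0_norm u : K := of_real (sup (range (fun n => rnorm (u n)))).

Lemma c0_has_sup u : has_sup (range (fun n => rnorm (u n))).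
Proof.
split; first by exists (rnorm (u 0%N)), 0%N.
have /asboolP/cvgP/cvg_seq_bounded/pinfty_ex_gt0[M M0 uM] := valP u.
exists (real_part `|M|) => _ [n _ <-].
rewrite -(@le_of_real _ s) rnormE real_partK //.
have unM : `|u n : K^o| <= M by exact: uM.
by rewrite (le_trans unM) // ger0_norm // ltW.
Qed.

Lemma c0_norm_ge u n : `|u n : K^o| <= c0_norm u.
Proof.
rewrite -rnormE /c0_norm le_of_real; apply: ub_le_sup.
  by have [] := c0_has_sup u.
by exists n.
Qed.

Lemma c0_norm_le u (M : K) : (forall n, `|u n : K^o| <= M) -> c0_norm u <= M.
Proof.
move=> uM; have M0 : 0 <= M by apply: le_trans (uM 0%N).
rewrite -(real_partK M0) /c0_norm le_of_real; apply: ge_sup.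
  by have [] := c0_has_sup u.
by move=> _ [n _ <-]; rewrite -(@le_of_real _ s) rnormE real_partK.
Qed.

Lemma c0_norm_ge0 u : 0 <= c0_norm u.
Proof. exact: le_trans (c0_norm_ge u 0%N). Qed.

Lemma c0_normD u v : c0_norm (u + v) <= c0_norm u + c0_norm v.
Proof.
apply: c0_norm_le => n; rewrite (le_trans (ler_normD (u n) (v n))) //.
by rewrite lerD ?c0_norm_ge.
Qed.

Lemma c0_normZ (a : K) u : c0_norm (a *: u) = `|a| * c0_norm u.
Proof.
have le_normZ (b : K) (w : c0) : c0_norm (b *: w) <= `|b| * c0_norm w.
  apply: c0_norm_le => n; rewrite -[leLHS]/(`|b *: (w n : K^o)|) normrZ.
  by rewrite ler_wpM2l ?c0_norm_ge.
apply/eqP; rewrite eq_le le_normZ /=.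
have [->|a0] := eqVneq a 0; first by rewrite normr0 mul0r c0_norm_ge0.
have na0 : 0 < `|a| by rewrite normr_gt0.
rewrite -ler_pdivlMl // -normfV (le_trans _ (le_normZ _ _)) //.
by rewrite scalerA mulVf // scale1r.
Qed.

Lemma c0_norm_eq0 u : c0_norm u = 0 -> u = 0.
Proof.
move=> u0; apply: val_inj; apply/funext => n /=; apply/eqP.
by rewrite -normr_le0 -u0; exact: c0_norm_ge.
Qed.

HB.instance Definition _ := Lmodule_isNormed.Build K c0
  c0_normD c0_normZ c0_norm_eq0.

End c0.
Arguments c0 : clear implicits.

Section dual.
Context {R : realType} {s : scalars}.
Local Notation K := (scalar_field R s).
Implicit Types X Y Z : normedModType K.

Definition dual X : normedModType K := operator X K^o.

Lemma evaluation_bounded_linear X (x : X) :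
  (fun f : dual X => f x : K^o) \in @bounded_linear _ _ (dual X) K^o.
Proof.
apply/asboolP; split=> [a f g //|].
by exists `|x| => f; rewrite mulrC; exact: (@ler_norm_operator _ _ X K^o f x).
Qed.

Definition canonical_embedding X (x : X) : dual (dual X) :=
  Operator (evaluation_bounded_linear x).

Lemma adjoint_fun_bounded_linear X Y (T : operator X Y) (g : dual Y) :
  (fun x => g (T x)) \in @bounded_linear _ _ X K^o.
Proof.
apply/asboolP; split=> [a u v|]; first by rewrite !linearP.
exists (`|g| * `|T|) => x; rewrite (le_trans (ler_norm_operator _ _)) //.
by rewrite -mulrA; apply: ler_wpM2l; [|exact: ler_norm_operator].
Qed.

Definition adjoint_fun X Y (T : operator X Y) (g : dual Y) : dual X :=
  Operator (adjoint_fun_bounded_linear T g).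

Lemma adjoint_bounded_linear X Y (T : operator X Y) :
  adjoint_fun T \in @bounded_linear _ _ (dual Y) (dual X).
Proof.
apply/asboolP; split=> [a f g|]; first exact/val_inj.
exists `|T| => g; apply: operator_norm_le => x x1 /=.
rewrite (le_trans (ler_norm_operator _ _)) // mulrC ler_wpM2r //.
by rewrite (le_trans (ler_norm_operator _ _)) // ler_piMr.
Qed.

Definition adjoint X Y (T : operator X Y) : operator (dual Y) (dual X) :=
  Operator (adjoint_bounded_linear T).

(* weak X is X with its weak topology, the initial one for the functionals. *)
Definition weak X : Type :=
  initial_topology (fun (x : X) => (fun f => f x) : {ptws dual X -> K^o}).

HB.instance Definition _ X := Topological.on (weak X).

(* weak_star X is the dual of X with its weak-star topology. *)
Definition weak_star X : Type :=
  initial_topology (fun (f : dual X) => (fun x => f x) : {ptws X -> K^o}).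

HB.instance Definition _ X := Topological.on (weak_star X).

Definition weakly_convergent X (u : nat -> X) :=
  exists x : X, (u : nat -> weak X) @ \oo --> (x : weak X).

Definition weakly_cauchy X (u : nat -> X) :=
  forall f : dual X, cauchy ((fun k => f (u k) : K^o) @ \oo).

Definition weakly_compact X (A : set X) := compact (A : set (weak X)).

Definition schur X :=
  forall u : nat -> X, weakly_convergent u -> cvgn u.

Definition separable X := exists A : set X, countable A /\ dense A.

(* X is identified with its canonical image in the bidual: P is an idempotent
   of the bidual whose range is that image. *)
Definition L_embedded X :=
  exists P : {linear dual (dual X) -> dual (dual X)},
    [/\ forall z, P (P z) = P z,
        range P = range (@canonical_embedding X) &
        forall z, `|z| = `|P z| + `|z - P z| ].

Definition weakly_compact_operator X Y (T : operator X Y) :=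
  weakly_compact (closure (T @` unit_ball X : set (weak Y))).

Definition completely_continuous X Y (T : operator X Y) :=
  forall u : nat -> X, weakly_convergent u -> cvgn (T \o u).

Definition dunford_pettis X :=
  forall (Y : completeNormedModType K) (T : operator X Y),
    weakly_compact_operator T -> completely_continuous T.

(* The moduli below take values in \bar R; for S an operator, chi(S), omega(S)
   and wk(S) are written chi, omega and wk of S @` unit_ball. *)
Definition ca X (z : nat -> X) : \bar R :=
  ereal_inf (range (fun n : nat =>
    ereal_sup [set (rnorm (z k - z l))%:E
              | k in [set k | (n <= k)%N] & l in [set l | (n <= l)%N]])).

Definition cc X Y (T : operator X Y) : \bar R :=
  ereal_sup [set ca (T \o z) | z in
    [set z | weakly_cauchy z /\ forall k, unit_ball X (z k)]].

Definition dhat X (A B : set X) : \bar R :=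
  ereal_sup [set ereal_inf [set (rnorm (a - b))%:E | b in B] | a in A].

Definition chi X (A : set X) : \bar R :=
  ereal_inf [set dhat A F | F in [set F | F !=set0 /\ finite_set F]].

Definition omega X (A : set X) : \bar R :=
  ereal_inf [set dhat A C | C in [set C | C !=set0 /\ weakly_compact C]].

Definition wk X (A : set X) : \bar R :=
  dhat (closure (@canonical_embedding X @` A : set (weak_star (dual X))))
       (range (@canonical_embedding X)).

Definition direct_qDP X :=
  exists C : R, 0 < C /\
    forall (Y : completeNormedModType K) (T : operator X Y),
      (cc T <= C%:E * wk (adjoint T @` unit_ball (dual Y)))%E.

Definition dual_qDP X :=
  exists C : R, 0 < C /\
    forall (Y : completeNormedModType K) (T : operator Y X),
      (cc (adjoint T) <= C%:E * wk (T @` unit_ball Y))%E.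

End dual.

(* Main.v *)
Require Import Defs.
From HB Require Import structures.
From mathcomp Require Import all_boot all_order all_algebra.
From mathcomp Require Import all_classical all_reals all_analysis.
From mathcomp Require Import complex.
From mathcomp Require Import ring lra.

Set Implicit Arguments.
Unset Strict Implicit.
Unset Printing Implicit Defensive.

Import Order.TTheory GRing.Theory Num.Theory.
Import numFieldNormedType.Exports.

Local Open Scope classical_set_scope.
Local Open Scope ring_scope.

(** Let eps n = 1/(n+1) and let X_n be c_0 with the unit ball
    { x | sum_k (|x_k| - eps n)^+ <= 1 }, the sum of the ball of l_1 and of eps n
    times the ball of c_0. The space X is the c_0-sum of the X_n, so that its dual
    is the l_1-sum of the spaces l_1 normed by sup_k |f_k| + eps n * sum_k |f_k|.
    In the coordinates (n, k), x has norm at most r if and only if the sum of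
    |x n k| over k in F is at most r * (1 + eps n * |F|) for all n and all finite
    sets F (bounded_by), which is also meaningful for the bidual of X.

    The projection of X onto its n-th block maps the unit ball onto that of X_n,
    which is within eps n of the ball of l_1, a weakly compact subset of c_0, yet
    contains the unit vectors; these are the images of a weakly null sequence of
    the unit ball of X but stay far from each other. This gives cc >= 1 and
    wk = omega = eps n (wk_omega_block), and wk <= eps n for the adjoint
    (wk_block_adjoint), hence the failure of the direct property for X and of the
    dual property for its dual; the retraction lemmas transfer both failures to
    the sum. The halves of the coordinate functionals of a block lie in the image
    of the unit ball under the adjoint and provide the sets in the dual.

    The good properties of the dual rest on one gluing fact (bounded_by_glue): a
    vector of the unit ball supported in finitely many coordinates may be
    augmented by a tail that, in the blocks met by these coordinates, stays below
    the thresholds eps n. Applied to nearly norming vectors it shows that the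
    tails of a functional tend to 0 in norm (shrinking), so that the bidual
    consists of families of coordinates; applied recursively it is the gliding
    hump that yields the Schur property (dual_predual_schur); and since the
    coordinates of a bidual vector of norm at most 1 are in each block eventually
    almost below the threshold, it also allows to glue a vector of X and a tail of
    a bidual vector, whence L-embeddedness (dual_predual_L_embedded).

    In a dual with the Schur property cc vanishes on all operators, which gives
    the positive quantitative properties, and weakly compact sets are norm
    compact, which gives omega = chi (omega_chi_dual). A weakly compact operator
    on X is completely continuous because functionals pulled back by it have
    norm Cauchy subsequences (predual_completely_continuous); this step needs the
    Hahn-Banach theorem over both scalar fields and uniform boundedness. *)

(** * Real-valued norms over either scalar field *)
Section real_valued_norm.
Context {R : realType} {s : scalars}.
Local Notation K := (scalar_field R s).
Implicit Types (V W : normedModType K) (r e : R).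

Lemma of_real_inj : injective (@of_real R s).
Proof. by apply: can_inj; exact: of_realK. Qed.

Lemma lt_of_real r e : (of_real r < of_real e :> K) = (r < e).
Proof. by rewrite !lt_neqAle le_of_real (inj_eq of_real_inj). Qed.

Lemma of_real1 : of_real 1 = 1 :> K.
Proof. by rewrite /of_real; case: s. Qed.

Lemma of_realN r : of_real (- r) = - of_real r :> K.
Proof.
by apply/eqP; rewrite -addr_eq0 -of_realD addNr of_real0.
Qed.

Lemma of_realB r e : of_real (r - e) = of_real r - of_real e :> K.
Proof. by rewrite of_realD of_realN. Qed.

Lemma pos_of_real (a : K) : 0 < a -> exists2 r, 0 < r & a = of_real r.
Proof.
move=> a0; exists (real_part a); last by rewrite real_partK// ltW.
by rewrite -lt_of_real of_real0 real_partK// ltW.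
Qed.

Lemma rnorm_le V (x : V) r : (rnorm x <= r) = (`|x| <= of_real r).
Proof. by rewrite -rnormE le_of_real. Qed.

Lemma rnorm_lt V (x : V) r : (rnorm x < r) = (`|x| < of_real r).
Proof. by rewrite -rnormE lt_of_real. Qed.

Lemma eq_rnorm V W (x : V) (y : W) : `|x| = `|y| -> rnorm x = rnorm y.
Proof. by move=> xy; apply: of_real_inj; rewrite !rnormE. Qed.

Lemma rnorm0 V : rnorm (0 : V) = 0.
Proof. by apply: of_real_inj; rewrite rnormE normr0 of_real0. Qed.

Lemma rnormN V (x : V) : rnorm (- x) = rnorm x.
Proof. by apply: eq_rnorm; rewrite normrN. Qed.

Lemma rnormBC V (x y : V) : rnorm (x - y) = rnorm (y - x).
Proof. by rewrite -rnormN opprB. Qed.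

Lemma rnormD V (x y : V) : rnorm (x + y) <= rnorm x + rnorm y.
Proof. by rewrite rnorm_le of_realD !rnormE ler_normD. Qed.

Lemma rnormB V (x y : V) : rnorm (x - y) <= rnorm x + rnorm y.
Proof. by rewrite (le_trans (rnormD _ _))// rnormN. Qed.

Lemma rnorm_sub V (x y : V) : rnorm x <= rnorm (x - y) + rnorm y.
Proof. by rewrite -{1}(subrK y x) rnormD. Qed.

Lemma rnormZ V (a : K) (x : V) : rnorm (a *: x) = rnorm (a : K^o) * rnorm x.
Proof. by apply: of_real_inj; rewrite of_realM !rnormE normrZ. Qed.

Lemma rnormM (a b : K) : rnorm (a * b : K^o) = rnorm (a : K^o) * rnorm (b : K^o).
Proof. exact: (@rnormZ K^o). Qed.

Lemma rnorm1 : rnorm (1 : K^o) = 1.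
Proof. by apply: of_real_inj; rewrite rnormE normr1 of_real1. Qed.

Lemma rnorm_of_real r : rnorm (of_real r : K^o) = `|r|.
Proof.
wlog r0 : r / 0 <= r.
  move=> h; have [|/ltW r0] := leP 0 r; first exact: h.
  by rewrite -normrN -h ?oppr_ge0// of_realN rnormN.
apply: of_real_inj; rewrite rnormE !ger0_norm//.
by rewrite -of_real0 le_of_real.
Qed.

Lemma rnorm_real r : 0 <= r -> rnorm (of_real r : K^o) = r.
Proof. by move=> r0; rewrite rnorm_of_real ger0_norm. Qed.

Lemma rnorm_eq0 V (x : V) : rnorm x = 0 -> x = 0.
Proof. by move=> x0; apply/eqP; rewrite -normr_eq0 -rnormE x0 of_real0. Qed.

Lemma rnorm_small_eq0 V (x : V) : (forall e : R, 0 < e -> rnorm x <= e) -> x = 0.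
Proof.
move=> xe; apply: rnorm_eq0; apply/eqP; rewrite eq_le rnorm_ge0 andbT.
by apply/ler_addgt0Pl => e /xe; rewrite addr0.
Qed.

Lemma ler_rnorm_sum V (I : Type) (t : seq I) (P : pred I) (F : I -> V) :
  rnorm (\sum_(i <- t | P i) F i) <= \sum_(i <- t | P i) rnorm (F i).
Proof.
elim/big_rec2: _ => [|i a y _ h]; first by rewrite rnorm0.
by rewrite (le_trans (rnormD _ _))// lerD2l.
Qed.

Lemma unit_ballE V (x : V) : unit_ball V x <-> rnorm x <= 1.
Proof. by rewrite rnorm_le of_real1. Qed.

Lemma phase (a : K) : exists2 t : K, rnorm (t : K^o) = 1 & t * a = of_real (rnorm (a : K^o)).
Proof.
have [->|a0] := eqVneq a 0.
  by exists 1; rewrite ?rnorm1// mulr0 (@rnorm0 K^o) of_real0.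
exists (`|a| / a); last by rewrite divfK// (@rnormE _ _ K^o).
apply: of_real_inj; rewrite rnormE normrM normr_id normfV mulfV ?of_real1//.
by rewrite normr_eq0.
Qed.

Lemma cvg_rnormP V (T : Type) (F : set_system T) (FF : Filter F) (u : T -> V) (l : V) :
  (u x @[x --> F] --> l) <->
  (forall e : R, 0 < e -> \forall x \near F, rnorm (u x - l) < e).
Proof.
split=> [/cvgrPdist_lt h e e0|h].
  have := h (of_real e); rewrite -{1}of_real0 lt_of_real => /(_ e0).
  by apply: filterS => x; rewrite rnorm_lt distrC.
apply/cvgrPdist_lt => _ /pos_of_real[e e0 ->]; near=> x.
rewrite distrC -rnorm_lt; near: x; exact: h.
Unshelve. all: by end_near. Qed.

Lemma cvg_seqP V (u : nat -> V) (l : V) :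
  (u @ \oo --> l) <->
  (forall e : R, 0 < e -> exists n, forall k, (n <= k)%N -> rnorm (u k - l) < e).
Proof.
rewrite cvg_rnormP; split=> h e /h.
  by move=> [n _ hn]; exists n => k /hn.
by move=> [n hn]; exists n => // k /= /hn.
Qed.

End real_valued_norm.

(** * Bounded operators *)
Section operators.
Context {R : realType} {s : scalars}.
Local Notation K := (scalar_field R s).
Implicit Types (V W : normedModType K).

Lemma rnorm_op V W (f : operator V W) x : rnorm (f x) <= rnorm f * rnorm x.
Proof. by rewrite rnorm_le of_realM !rnormE ler_norm_operator. Qed.

Lemma rnorm_op_le V W (f : operator V W) (M : R) :
  0 <= M -> (forall x, rnorm (f x) <= M * rnorm x) -> rnorm f <= M.
Proof.
move=> M0 fM; rewrite rnorm_le; apply: operator_norm_le => x /unit_ballE x1.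
by rewrite -rnorm_le (le_trans (fM x))// ler_piMr.
Qed.

Lemma rnorm_op_le_ball V W (f : operator V W) (M : R) :
  (forall x, rnorm x <= 1 -> rnorm (f x) <= M) -> rnorm f <= M.
Proof.
move=> fM; rewrite rnorm_le; apply: operator_norm_le => x /unit_ballE x1.
by rewrite -rnorm_le; exact: fM.
Qed.

Lemma rnorm_op_ball V W (f : operator V W) x :
  rnorm x <= 1 -> rnorm (f x) <= rnorm f.
Proof. by move=> x1; rewrite (le_trans (rnorm_op f x))// ler_piMr// rnorm_ge0. Qed.

Lemma rnorm_op_gt V W (f : operator V W) (M : R) :
  M < rnorm f -> exists2 x, rnorm x <= 1 & M < rnorm (f x).
Proof.
rewrite -[rnorm f]/(real_part (of_real _)) of_realK => Mf.
have [_ [x /unit_ballE x1 <-] Mx] := sup_gt (proj1 (operator_has_sup f)) Mf.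
by exists x.
Qed.

(** Rotating the vector makes the value of the functional real. *)
Lemma rnorm_dual_gt V (f : dual V) (M : R) : M < rnorm f ->
  exists2 x, rnorm x <= 1 & exists2 r, M < r & f x = of_real r :> K.
Proof.
move=> /rnorm_op_gt[x x1 Mx]; have [t t1 tE] := phase (f x : K).
exists (t *: x); first by rewrite rnormZ t1 mul1r.
by exists (rnorm (f x)) => //; rewrite linearZ.
Qed.

Lemma operator_ext V W (f g : operator V W) : (forall x, f x = g x) -> f = g.
Proof. by move=> fg; apply: val_inj; apply/funext => x; exact: fg. Qed.

Lemma build_operator V W (f : V -> W) (M : R) :
  linear f -> (forall x, rnorm (f x) <= M * rnorm x) ->
  exists2 g : operator V W, g =1 f & (0 <= M -> rnorm g <= M).
Proof.
move=> lf fM.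
have fB : f \in @bounded_linear _ _ V W.
  apply/asboolP; split=> //; exists (of_real M) => x.
  by rewrite -!rnormE -of_realM le_of_real.
by exists (Operator fB) => // M0; exact: rnorm_op_le.
Qed.

Lemma build_dual V (f : V -> K^o) (M : R) :
  linear f -> (forall x, rnorm (f x) <= M * rnorm x) ->
  exists2 g : dual V, (forall x, g x = f x) & (0 <= M -> rnorm g <= M).
Proof. exact: (@build_operator V K^o). Qed.

Lemma compose_operator V W (U : normedModType K) (g : operator W U) (f : operator V W) :
  (fun x => g (f x)) \in @bounded_linear _ _ V U.
Proof.
apply/asboolP; split=> [a x y|]; first by rewrite !linearP.
exists (`|g| * `|f|) => x.
by rewrite (le_trans (ler_norm_operator _ _))// -mulrA ler_wpM2l// ler_norm_operator.
Qed.

Definition comp_op V W (U : normedModType K) (g : operator W U) (f : operator V W)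
  : operator V U := Operator (compose_operator g f).

Lemma rnorm_comp_op V W (U : normedModType K) (g : operator W U) (f : operator V W) :
  rnorm (comp_op g f) <= rnorm g * rnorm f.
Proof.
apply: rnorm_op_le => [|x]; first by rewrite mulr_ge0 ?rnorm_ge0.
by rewrite (le_trans (rnorm_op g (f x)))// -mulrA ler_wpM2l ?rnorm_ge0 ?rnorm_op.
Qed.

Lemma rnorm_adjoint V W (T : operator V W) : rnorm (adjoint T) <= rnorm T.
Proof.
apply: rnorm_op_le => [|g]; first exact: rnorm_ge0.
by rewrite mulrC (rnorm_comp_op g T).
Qed.

Local Notation J := (@canonical_embedding _ _ _).

Lemma rnorm_canonical_embedding V (x : V) : rnorm (J x) <= rnorm x.
Proof.
apply: rnorm_op_le => [|f]; first exact: rnorm_ge0.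
by rewrite mulrC (@rnorm_op V K^o f x).
Qed.

Lemma canonical_embedding_linear V : linear (@canonical_embedding R s V).
Proof. by move=> a x y; apply: operator_ext => f /=; rewrite linearP. Qed.

Lemma canonical_embedding_bounded_linear V :
  @canonical_embedding R s V \in @bounded_linear _ _ V (dual (dual V)).
Proof.
apply/asboolP; split; first exact: canonical_embedding_linear.
by exists 1 => x; rewrite mul1r -!rnormE le_of_real rnorm_canonical_embedding.
Qed.

Definition embed_op V : operator V (dual (dual V)) :=
  Operator (@canonical_embedding_bounded_linear V).

(** The scalar field is complete, so the limit may be taken at each functional. *)
Lemma weak_star_limit V (x : nat -> V) (M : R) : 0 <= M ->
    (forall k, rnorm (x k) <= M) ->
    (forall g : dual V, cvgn (fun k => g (x k) : K^o)) ->
  exists2 z : dual (dual V), rnorm z <= M &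
    forall g : dual V, (fun k => g (x k) : K^o) @ \oo --> (z g : K^o).
Proof.
move=> M0 xM xc; pose z (g : dual V) : K^o := limn (fun k => g (x k) : K^o).
have zP (g : dual V) : (fun k => g (x k) : K^o) @ \oo --> z g by exact: xc.
have zl : linear z.
  move=> a f g; apply: (@cvg_lim K^o) => //=.
  by apply: cvgD; [apply: cvgZr; exact: zP|exact: zP].
have zM (g : dual V) : rnorm (z g) <= M * rnorm g.
  apply/ler_addgt0Pr => e e0.
  have /cvg_seqP/(_ _ e0)[n /(_ n (leqnn n)) h] := zP g.
  rewrite (le_trans (rnorm_sub _ (g (x n) : K^o)))// rnormBC addrC lerD ?(ltW h)//.
  by rewrite mulrC (le_trans (rnorm_op g (x n)))// ler_wpM2l ?rnorm_ge0.
have [h hz hM] := build_dual zl zM.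
by exists h; [exact: hM|move=> g; rewrite hz; exact: zP].
Qed.

End operators.
Notation J := (@canonical_embedding _ _ _).

(** * Convergence of filters in the scalar field and completeness of duals *)
Section scalars_complete.
Context {R : realType} {s : scalars}.
Local Notation K := (scalar_field R s).

(** Real and imaginary part with the recombination c; over real scalars q is
    constant and c ignores its second argument, so that the same three estimates
    hold. *)
Lemma scalar_components : exists (p q : K -> R) (c : R -> R -> K),
  [/\ forall x y : K, `|p x - p y| <= rnorm (x - y : K^o),
      forall x y : K, `|q x - q y| <= rnorm (x - y : K^o) &
      forall (x : K) (a b : R), rnorm (x - c a b : K^o) <= `|p x - a| + `|q x - b| ].
Proof.
rewrite /rnorm; case: s => /=.
  exists id, (fun=> 0), (fun a _ => a); split => //= [x y|x a b].
    by rewrite subrr normr0.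
  by rewrite lerDl.
exists (@complex.Re R), (@complex.Im R), (fun a b => Complex a b); split.
- move=> [a b] [c d] /=.
  rewrite -sqrtr_sqr ler_wsqrtr// lerDl sqr_ge0 //.
- move=> [a b] [c d] /=.
  rewrite -sqrtr_sqr ler_wsqrtr// lerDr sqr_ge0 //.
- move=> [x y] a b /=.
  rewrite -(@ler_pXn2r _ 2)// ?nnegrE ?sqrtr_ge0 ?addr_ge0//.
  rewrite sqr_sqrtr ?addr_ge0 ?sqr_ge0// [leRHS]sqrrD !real_normK ?num_real//.
  by rewrite lerD2r lerDl mulrn_wge0// mulr_ge0.
Qed.

Lemma scalar_complete (T : Type) (F : set_system T) (FF : ProperFilter F) (u : T -> K^o) :
  (forall e : R, 0 < e -> exists a : K^o, \forall t \near F, rnorm (u t - a) < e) ->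
  exists l : K^o, forall e : R, 0 < e -> \forall t \near F, rnorm (u t - l) < e.
Proof.
move=> cu; have [p [q [c [hp hq hc]]]] := scalar_components.
have real_complete (v : T -> R) :
    (forall e : R, 0 < e -> exists a, \forall t \near F, `|v t - a| < e) ->
    exists l, forall e : R, 0 < e -> \forall t \near F, `|v t - l| < e.
  move=> cv; have /cvg_ex[l vl] : cvg (v @ F).
    apply: cauchy_cvg; apply: cauchy_exP => e e0.
    have [a ha] := cv e e0; exists a.
    by apply: filterS ha => t; rewrite -ball_normE /= distrC.
  exists l => e e0; move/cvgrPdist_lt : vl => /(_ e e0).
  by apply: filterS => t; rewrite distrC.
have [l hl] : exists l, forall e : R, 0 < e -> \forall t \near F, `|p (u t) - l| < e.
  apply: real_complete => e /cu[a ha]; exists (p a).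
  by apply: filterS ha => t; apply: le_lt_trans; exact: hp.
have [m hm] : exists l, forall e : R, 0 < e -> \forall t \near F, `|q (u t) - l| < e.
  apply: real_complete => e /cu[a ha]; exists (q a).
  by apply: filterS ha => t; apply: le_lt_trans; exact: hq.
exists (c l m) => e e0; near=> t.
rewrite (le_lt_trans (hc _ _ _))// (splitr e) ltrD//; near: t; [apply: hl|apply: hm];
  by rewrite divr_gt0.
Unshelve. all: by end_near. Qed.

(** The limit of a real component is the supremum of the values that it
    eventually exceeds, as an ultrafilter contains each set or its complement. *)
Lemma scalar_ultra (T : Type) (F : set_system T) (UF : UltraFilter F) (u : T -> K^o) (M : R) :
  (\forall t \near F, rnorm (u t) <= M) ->
  exists l : K^o, forall e : R, 0 < e -> \forall t \near F, rnorm (u t - l) < e.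
Proof.
move=> uM; have FF : ProperFilter F by exact: ultra_proper.
have [p [q [c [hp hq hc]]]] := scalar_components.
have real_ultra (v : T -> R) (N : R) : (\forall t \near F, `|v t| <= N) ->
    exists l, forall e : R, 0 < e -> \forall t \near F, `|v t - l| < e.
  move=> vN; pose A := [set r | \forall t \near F, r <= v t].
  have hA : has_sup A.
    split; first by exists (- N); apply: filterS vN => t; rewrite ler_norml => /andP[].
    exists N => r rA; have [t [rt]] := filter_ex (filterI rA vN).
    by rewrite ler_norml => /andP[_]; exact: le_trans.
  exists (sup A) => e e0.
  have [r rA re] := sup_adherent e0 hA.
  have h : \forall t \near F, v t < sup A + e.
    have [/(ub_le_sup hA.2)|] := @in_ultra_setVsetC _ F [set t | sup A + e <= v t] _.
      by rewrite gerDl leNgt e0.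
    by apply: filterS => t /negP; rewrite -ltNge.
  near=> t; rewrite ltr_norml; apply/andP; split; last first.
    by rewrite ltrBlDl; near: t.
  rewrite ltrBrDl (lt_le_trans re)//; near: t; exact: rA.
have bd (w : K -> R) : (forall x y : K, `|w x - w y| <= rnorm (x - y : K^o)) ->
    \forall t \near F, `|w (u t)| <= M + `|w 0|.
  move=> hw; near=> t; rewrite -(subrK (w 0) (w (u t))) (le_trans (ler_normD _ _))// lerD//.
  by rewrite (le_trans (hw _ _))// subr0; near: t.
have [l hl] := real_ultra _ _ (bd _ hp).
have [m hm] := real_ultra _ _ (bd _ hq).
exists (c l m) => e e0; near=> t.
rewrite (le_lt_trans (hc _ _ _))// (splitr e) ltrD//; near: t; [apply: hl|apply: hm];
  by rewrite divr_gt0.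
Unshelve. all: by end_near. Qed.

Lemma normed_complete (V : normedModType K) :
  (forall F : set_system V, ProperFilter F ->
    (forall e : R, 0 < e -> exists a, \forall x \near F, rnorm (x - a) < e) ->
    exists l, forall e : R, 0 < e -> \forall x \near F, rnorm (x - l) < e) ->
  forall F : set_system V, ProperFilter F -> cauchy F -> cvg F.
Proof.
move=> h F FF cF; have [|l hl] := h F FF.
  move=> e e0.
  have e0' : 0 < of_real e :> K by rewrite -of_real0 lt_of_real.
  have [a /= ha] := (cauchyP F).1 cF _ e0'.
  exists a; apply: filterS ha => x.
  by rewrite -ball_normE /= distrC -rnorm_lt.
by apply/cvg_ex; exists l; apply/(@cvg_rnormP _ _ V V F _ id).
Qed.

Lemma rnorm_le_near (T : Type) (F : set_system T) (FF : ProperFilter F)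
    (V : normedModType K) (u : T -> V) (l : V) (M : R) :
  (forall e : R, 0 < e -> \forall t \near F, rnorm (u t - l) < e) ->
  (\forall t \near F, rnorm (u t) <= M) -> rnorm l <= M.
Proof.
move=> ul uM; apply/ler_addgt0Pr => e e0.
have [t [/= h1 h2]] := filter_ex (filterI (ul e e0) uM).
by rewrite (le_trans (rnorm_sub _ (u t)))// rnormBC addrC lerD// ltW.
Qed.

Lemma dual_complete (V : normedModType K) (F : set_system (dual V)) (FF : ProperFilter F) :
  (forall e : R, 0 < e -> exists a, \forall x \near F, rnorm (x - a) < e) ->
  exists l, forall e : R, 0 < e -> \forall x \near F, rnorm (x - l) < e.
Proof.
move=> cF.
have /choice[l hl] (x : V) : exists l : K^o, forall e : R, 0 < e ->
    \forall f \near F, rnorm ((f : dual V) x - l) < e.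
  apply: scalar_complete => e e0.
  have x0 : 0 < rnorm x + 1 by rewrite ltr_wpDl ?rnorm_ge0.
  have [f0 hf0] := cF _ (divr_gt0 e0 x0); exists (f0 x).
  apply: filterS hf0 => f hf; rewrite (le_lt_trans (@rnorm_op _ _ V K^o (f - f0) x))//.
  rewrite (@le_lt_trans _ _ (e / (rnorm x + 1) * rnorm x))//.
    by rewrite ler_wpM2r ?rnorm_ge0// ltW.
  by rewrite mulrAC ltr_pdivrMr// ltr_pM2l// ltrDl.
have cl x : (fun f : dual V => f x : K^o) @ F --> l x.
  by apply/cvg_rnormP; exact: hl.
have ll : linear l.
  move=> a x y; apply: (cvg_unique _ (cl _)) => //=.
  have -> : (fun f : dual V => f (a *: x + y) : K^o) =
      (fun f : dual V => a *: (f x : K^o) + f y).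
    by apply/funext => f; rewrite linearP.
  by apply: cvgD; [apply: cvgZr; exact: cl|exact: cl].
have dl (f0 : dual V) e : (\forall f \near F, rnorm (f - f0) < e) ->
    forall x, rnorm (l x - f0 x) <= e * rnorm x.
  move=> hf0 x.
  apply: (@rnorm_le_near _ F _ K^o (fun f : dual V => (f x : K^o) - f0 x)).
    move=> d d0; apply: filterS (hl x d d0) => f.
    by rewrite opprB addrA subrK.
  apply: filterS hf0 => f hf; rewrite (le_trans (@rnorm_op _ _ V K^o (f - f0) x))//.
  by rewrite ler_wpM2r ?rnorm_ge0// ltW.
have [f1 hf1] := cF _ ltr01.
have lM x : rnorm (l x : K^o) <= (1 + rnorm f1) * rnorm x.
  by rewrite (le_trans (rnorm_sub _ (f1 x)))// mulrDl lerD ?dl ?rnorm_op.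
have [g gl _] := build_dual ll lM.
exists g => e e0; have e20 : 0 < e / 2 by rewrite divr_gt0.
have [f0 hf0] := cF _ e20.
have gf : rnorm (g - f0) <= e / 2.
  apply: rnorm_op_le => [|x]; first exact: ltW.
  by rewrite operatorD gl; exact: dl.
apply: filterS hf0 => f hf.
have -> : f - g = (f - f0) + (f0 - g) by rewrite addrA subrK.
apply: le_lt_trans (rnormD _ _) _; rewrite (splitr e); apply: ltr_leD; first exact: hf.
rewrite rnormBC; exact: gf.
Qed.

End scalars_complete.

(** * Weak and weak-star convergence *)
Lemma cvg_initialP (S : choiceType) (T : topologicalType) (f : S -> T)
    (F : set_system S) (FF : Filter F) (x : S) :
  F --> (x : initial_topology f) <-> f @ F --> f x.
Proof.
split=> [Fx|fFx].
  by apply: cvg_trans (@initial_continuous _ _ f x); exact: cvg_fmap2.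
move=> A /=; rewrite nbhsE => -[_ [[B oB <-] Bx] sBA].
have : nbhs (f x) B by apply: open_nbhs_nbhs.
by move=> /fFx; exact: (@filterS _ F).
Qed.

Section weak_topologies.
Context {R : realType} {s : scalars}.
Local Notation K := (scalar_field R s).
Implicit Types (V W : normedModType K).

Lemma weak_cvgP V (T : Type) (F : set_system T) (FF : Filter F) (u : T -> V) (x : V) :
  ((u : T -> weak V) t @[t --> F] --> (x : weak V)) <->
  forall f : dual V, (fun t => f (u t) : K^o) @ F --> (f x : K^o).
Proof.
by split=> [/cvg_initialP/pointwise_cvgP|h]; last exact/cvg_initialP/pointwise_cvgP.
Qed.

Lemma weak_star_cvgP V (T : Type) (F : set_system T) (FF : Filter F)
    (u : T -> dual V) (x : dual V) :
  ((u : T -> weak_star V) t @[t --> F] --> (x : weak_star V)) <->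
  forall v : V, (fun t => u t v : K^o) @ F --> (x v : K^o).
Proof.
by split=> [/cvg_initialP/pointwise_cvgP|h]; last exact/cvg_initialP/pointwise_cvgP.
Qed.

Lemma weak_star_closureP V (A : set (dual V)) (z : dual V) :
  closure (A : set (weak_star V)) z ->
  exists2 F : set_system (dual V), ProperFilter F &
    F A /\ forall v, (fun f : dual V => f v : K^o) @ F --> (z v : K^o).
Proof.
rewrite closureEcvg => -[F FF [Fz sF]]; exists F => //; split.
  exact: (sF A).
by apply/weak_star_cvgP; exact: Fz.
Qed.

Lemma weak_star_closureW V (A : set (dual V)) (z : dual V) (T : Type)
    (F : set_system T) (FF : ProperFilter F) (u : T -> dual V) :
  (\forall t \near F, A (u t)) ->
  (forall v, (fun t => u t v : K^o) @ F --> (z v : K^o)) ->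
  closure (A : set (weak_star V)) z.
Proof.
move=> FA /weak_star_cvgP uz; rewrite closureEcvg; exists (u @ F) => //.
  exact: fmap_proper_filter.
by split=> // B AB; apply: filterS FA => t /AB.
Qed.

Lemma weak_nbhs V (x : V) (f : dual V) (e : R) : 0 < e ->
  nbhs (x : weak V) [set y | rnorm (f y - f x : K^o) < e].
Proof.
move=> e0; have /weak_cvgP/(_ f)/cvg_rnormP/(_ e e0) // :
  (id : V -> weak V) t @[t --> nbhs (x : weak V)] --> (x : weak V).
exact: cvg_id.
Qed.

Lemma weakly_convergentP V (u : nat -> V) : weakly_convergent u <->
  exists x, forall f : dual V, (fun k => f (u k) : K^o) @ \oo --> (f x : K^o).
Proof. by split=> -[x /weak_cvgP ux]; exists x => //; apply/weak_cvgP. Qed.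

Lemma scalar_cauchyP (u : nat -> K^o) : cauchy (u @ \oo) <->
  forall e : R, 0 < e ->
    exists n, forall k l, (n <= k)%N -> (n <= l)%N -> rnorm (u k - u l) < e.
Proof.
rewrite cauchyP; split=> h e e0.
  have e0' : 0 < of_real (e / 2) :> K by rewrite -of_real0 lt_of_real divr_gt0.
  have [a [n _ /= hn]] := h _ e0'; exists n => k l kn ln.
  have hb i : (n <= i)%N -> rnorm (u i - a) < e / 2.
    by move=> /hn; rewrite -ball_normE /= distrC -rnorm_lt.
  rewrite -(subrK a (u k)) -addrA (le_lt_trans (rnormD _ _))// (splitr e) ltrD//.
    exact: hb.
  by rewrite rnormBC; exact: hb.
have [r r0 er] := pos_of_real e0.
have [n hn] := h _ r0; exists (u n), n => // k /= nk.
by rewrite -ball_normE /= er -rnorm_lt; exact: hn.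
Qed.

Lemma cvg_weakly_cauchy V (u : nat -> V) :
  (forall f : dual V, cvgn (fun k => f (u k) : K^o)) -> weakly_cauchy u.
Proof. by move=> uc f; exact/cvg_cauchy/uc. Qed.

Lemma scalar_cauchy_cvg (u : nat -> K^o) : cauchy (u @ \oo) -> cvgn u.
Proof.
move=> /scalar_cauchyP cu; have [|l hl] := @scalar_complete R s _ \oo _ u.
  by move=> e /cu[n hn]; exists (u n), n => // k /= nk; exact: hn.
by apply/cvg_ex; exists l; apply/cvg_rnormP.
Qed.

End weak_topologies.

(** * Elementary properties of the moduli *)
Section moduli.
Context {R : realType} {s : scalars}.
Local Notation K := (scalar_field R s).
Implicit Types (V W : normedModType K).

Lemma ereal_le_real (x y : \bar R) :
  (forall M : R, (y < M%:E)%E -> (x <= M%:E)%E) -> (x <= y)%E.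
Proof.
move: x y => [x| |] [y| |] h; rewrite ?leey ?leNye//.
- rewrite lee_fin; apply/ler_addgt0Pr => e e0; rewrite -lee_fin.
  by apply: h; rewrite lte_fin ltrDl.
- by have := h (x - 1) (ltNyr _); rewrite lee_fin leNgt gtrBl ltr01.
- by have := h (y + 1); rewrite lte_fin ltrDl ltr01 => /(_ erefl).
- by have := h 0 (ltNyr _).
Qed.

Lemma dhat_le V (A B : set V) (M : R) :
  (forall a e, A a -> 0 < e -> exists2 b, B b & rnorm (a - b) <= M + e) ->
  (dhat A B <= M%:E)%E.
Proof.
move=> h; apply: ge_ereal_sup => _ [a Aa <-].
apply/lee_addgt0Pr => e e0; have [b Bb abM] := h a e Aa e0.
apply: le_trans (ereal_inf_lbound _) _; first by exists b.
by rewrite -EFinD lee_fin.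
Qed.

Lemma dhat_lt V (A B : set V) (M : R) (a : V) :
  (dhat A B < M%:E)%E -> A a -> exists2 b, B b & rnorm (a - b) < M.
Proof.
move=> AB Aa.
have : (ereal_inf [set (rnorm (a - b))%:E | b in B] < M%:E)%E.
  by apply: le_lt_trans AB; apply: ereal_sup_ubound; exists a.
by move=> /ereal_inf_lt[_ [b Bb <-]]; rewrite lte_fin; exists b.
Qed.

Lemma dhat_ge V (A B : set V) (M : R) (a : V) :
  A a -> (forall b, B b -> M <= rnorm (a - b)) -> (M%:E <= dhat A B)%E.
Proof.
move=> Aa h; apply: le_trans (ereal_sup_ubound _); last by exists a.
by apply: le_ereal_inf_tmp => _ [b Bb <-]; rewrite lee_fin h.
Qed.

Lemma dhat_ge0 V (A B : set V) : A !=set0 -> (0 <= dhat A B)%E.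
Proof. by move=> [a Aa]; apply: (dhat_ge Aa) => b _; exact: rnorm_ge0. Qed.

Lemma closure_canonical_embedding V (A : set V) a : A a ->
  closure (J @` A : set (weak_star (dual V))) (J a).
Proof. by move=> Aa; apply: subset_closure; exists a. Qed.

Lemma wk_ge0 V (A : set V) : A !=set0 -> (0 <= wk A)%E.
Proof. by move=> [a Aa]; apply: dhat_ge0; exists (J a); exact: closure_canonical_embedding. Qed.

Lemma wk_mono V (A B : set V) : A `<=` B -> (wk A <= wk B)%E.
Proof.
move=> AB; apply: ge_ereal_sup => _ [z Az <-].
apply: ereal_sup_ubound; exists z => //.
by apply: closure_subset Az; exact: image_subset.
Qed.

(** On the range of S the composite of S and L is the identity, hence so is its
    second adjoint on the weak-star closure of that range. *)
Lemma wk_retract V W (S : operator V W) (L : operator W V) (A : set V) :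
  rnorm S <= 1 -> (forall x, L (S x) = x) -> (wk (S @` A) <= wk A)%E.
Proof.
move=> S1 LS; apply: ereal_le_real => M AM; apply: dhat_le => z e.
move=> /weak_star_closureP[F FF [FA Fz]] e0.
pose L2 := adjoint (adjoint L); pose S2 := adjoint (adjoint S).
have zS : S2 (L2 z) = z.
  apply: operator_ext => g /=; apply: (cvg_unique _ (Fz _)) => //=.
  apply: cvg_trans (Fz g); apply: near_eq_cvg.
  by apply: filterS FA => _ [_ [a Aa <-] <-] /=; rewrite LS.
have cl : closure (J @` A : set (weak_star (dual V))) (L2 z).
  apply: (@weak_star_closureW _ _ _ _ _ _ F _ L2).
    by apply: filterS FA => _ [_ [a Aa <-] <-]; exists a => //; apply: operator_ext => g /=; rewrite LS.
  by move=> g; exact: Fz.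
have [_ [v _ <-] vM] := dhat_lt AM cl.
exists (J (S v)); first by exists (S v).
have -> : z - J (S v) = S2 (L2 z - J v).
  by rewrite linearB /= -{1}zS; congr (_ - _); exact: operator_ext.
have S21 : rnorm S2 <= 1 by rewrite (le_trans (rnorm_adjoint _))// (le_trans (rnorm_adjoint _)).
rewrite (le_trans (rnorm_op S2 _))// (le_trans (ler_piMl _ S21)) ?rnorm_ge0//.
by rewrite (le_trans (ltW vM))// lerDl ltW.
Qed.

(** If a net in A converges weak-star, the nearby points of C have a weak
    cluster point, and it stays as close to the weak-star limit. *)
Lemma wk_le_dhat V (A C : set V) : weakly_compact C -> (wk A <= dhat A C)%E.
Proof.
move=> cC; apply: ereal_le_real => M AM; apply: dhat_le => z e.
move=> /weak_star_closureP[F FF [FA Fz]] e0.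
have /choice[b hb] (t : dual (dual V)) : exists b, (J @` A) t ->
    C b /\ exists2 a, t = J a & rnorm (a - b) < M.
  have [[a Aa <-]|nA] := pselect ((J @` A) t); last by exists 0.
  by have [b Cb abM] := dhat_lt AM Aa; exists b => _; split => //; exists a.
have FC : (b @ F) C by apply: (@filterS _ F _ _ _ _ FA) => t /hb[].
have [p [Cp clp]] := cC _ (fmap_proper_filter b FF) FC.
exists (J p); first by exists p.
have M0 : 0 <= M.
  have [t1 /hb[_ [a1 _ /ltW]]] := filter_ex FA.
  by apply: le_trans; exact: rnorm_ge0.
apply: rnorm_op_le => [|g]; first by rewrite addr_ge0// ltW.
rewrite (@le_trans _ _ (M * rnorm g))//; last first.
  by rewrite ler_wpM2r ?rnorm_ge0// lerDl ltW.
apply/ler_addgt0Pr => d d0; have d20 : 0 < d / 2 by rewrite divr_gt0.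
have /cvg_rnormP/(_ _ d20) Fzg := Fz g.
have FB : (b @ F) [set y | exists t, [/\ b t = y, (J @` A) t & rnorm (t g - z g : K^o) < d / 2]].
  by apply: filterS (filterI FA Fzg) => t [At tz]; exists t.
have [_ [[t [<- At tz]] bp]] := clp _ _ FB (weak_nbhs p g d20).
have [_ [a ta abM]] := hb t At.
have -> : (z - J p) g = (z g - t g) + (g (a - b t) + (g (b t) - g p)).
  by rewrite operatorD ta /= linearB /= !addrA !subrK.
have h1 : rnorm (g (a - b t) : K^o) <= M * rnorm g.
  by rewrite mulrC (le_trans (rnorm_op g _))// ler_wpM2l ?rnorm_ge0// ltW.
have h2 := rnormD (z g - t g : K^o) (g (a - b t) + (g (b t) - g p)).
have h3 := rnormD (g (a - b t) : K^o) (g (b t) - g p).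
move: tz bp; rewrite rnormBC /= => tz bp; lra.
Qed.

Lemma wk_le_omega V (A : set V) : (wk A <= omega A)%E.
Proof. by apply: le_ereal_inf_tmp => _ [C [_ cC] <-]; exact: wk_le_dhat. Qed.

Lemma omega_le_dhat V (A C : set V) : C !=set0 -> weakly_compact C ->
  (omega A <= dhat A C)%E.
Proof. by move=> C0 cC; apply: ereal_inf_lbound; exists C. Qed.

Lemma ca_ge1 V (z : nat -> V) : (forall k, 1 <= rnorm (z k - z k.+1)) -> (1 <= ca z)%E.
Proof.
move=> h; apply: le_ereal_inf_tmp => _ [n _ <-].
apply: le_trans (ereal_sup_ubound _); last by exists n => //=; exists n.+1 => //=.
by rewrite lee_fin.
Qed.

Lemma cc_ge V W (T : operator V W) (z : nat -> V) (M : \bar R) :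
  weakly_cauchy z -> (forall k, rnorm (z k) <= 1) -> (M <= ca (T \o z))%E -> (M <= cc T)%E.
Proof.
move=> cz z1 Mz; apply: le_trans Mz _; apply: ereal_sup_ubound; exists z => //.
by split=> // k; apply/unit_ballE.
Qed.

End moduli.

(** * The quantitative Dunford-Pettis properties and the Schur property *)
Section quantitative_dunford_pettis.
Context {R : realType} {s : scalars}.
Local Notation K := (scalar_field R s).
Implicit Types (V W X Y Z : normedModType K).

(** The Schur property for weakly null sequences, with the norm limit prescribed
    to be 0; no functionals separating points are needed to identify it. *)
Definition schur_null Z := forall v : nat -> Z,
  (forall f : dual Z, (fun k => f (v k) : K^o) @ \oo --> (0 : K^o)) ->
  forall e : R, 0 < e -> exists n, forall k, (n <= k)%N -> rnorm (v k) < e.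

Lemma cvg_diff0 (u : nat -> K^o) (l : K^o) :
  u @ \oo --> l -> (fun k => u k - l) @ \oo --> (0 : K^o).
Proof. by move=> ul; rewrite -(subrr l); apply: cvgB => //; exact: cvg_cst. Qed.

Lemma schur_null_schur Z : schur_null Z -> schur Z.
Proof.
move=> hZ u /weakly_convergentP[x ux]; apply/cvg_ex; exists x.
apply/cvg_seqP; apply: hZ => f; under eq_fun do rewrite linearB.
exact: (cvg_diff0 (ux f)).
Qed.

(** The differences of terms of a weakly Cauchy sequence are weakly null. *)
Lemma schur_null_cauchy Z (u : nat -> Z) : schur_null Z -> weakly_cauchy u ->
  forall e : R, 0 < e ->
    exists n, forall k l, (n <= k)%N -> (n <= l)%N -> rnorm (u k - u l) < e.
Proof.
move=> hZ cu e e0; apply: contrapT => hn.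
have /choice[p hp] (n : nat) : exists kl : nat * nat,
    [/\ (n <= kl.1)%N, (n <= kl.2)%N & e <= rnorm (u kl.1 - u kl.2)].
  apply: contrapT => np; apply: hn; exists n => k l nk nl; rewrite ltNge.
  by apply/negP => ekl; apply: np; exists (k, l).
have [|n /(_ n (leqnn n))] := hZ (fun n => u (p n).1 - u (p n).2) _ e e0.
  move=> f; apply/cvg_seqP => d d0; have /scalar_cauchyP/(_ d d0)[n hnd] := cu f.
  exists n => k nk; rewrite subr0 linearB; have [k1 k2 _] := hp k.
  by apply: hnd; [exact: leq_trans k1|exact: leq_trans k2].
by have [_ _ /le_lt_trans h] := hp n; move=> /h; rewrite ltxx.
Qed.

Lemma cc_schur_le0 Z W (T : operator Z W) : schur_null Z -> (cc T <= 0)%E.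
Proof.
move=> hZ; apply: ge_ereal_sup => _ [z [cz _] <-].
apply/lee_addgt0Pr => e e0; rewrite add0e.
have T1 : 0 < rnorm T + 1 by rewrite ltr_wpDl ?rnorm_ge0.
have [n hn] := schur_null_cauchy hZ cz (divr_gt0 e0 T1).
apply: le_trans (ereal_inf_lbound _) _; first by exists n.
apply: ge_ereal_sup => _ [k kn [l ln <-]]; rewrite lee_fin -linearB.
rewrite (le_trans (rnorm_op T _))//.
apply: (@le_trans _ _ (rnorm T * (e / (rnorm T + 1)))).
  by rewrite ler_wpM2l ?rnorm_ge0// ltW// hn.
by rewrite mulrA ler_pdivrMr// mulrC ler_pM2l// lerDl.
Qed.

Lemma schur_direct_qDP Z : schur_null Z -> direct_qDP Z.
Proof.
move=> hZ; exists 1; split=> // Y T.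
apply: le_trans (cc_schur_le0 T hZ) _; rewrite mul1e; apply: wk_ge0.
by exists (adjoint T 0), 0 => //; exact: unit_ball0.
Qed.

Lemma schur_dual_qDP X : schur_null (dual X) -> dual_qDP X.
Proof.
move=> hX; exists 1; split=> // Y T.
apply: le_trans (cc_schur_le0 _ hX) _; rewrite mul1e; apply: wk_ge0.
by exists (T 0), 0 => //; exact: unit_ball0.
Qed.

Lemma weakly_cauchy_op V W (T : operator V W) (z : nat -> V) :
  weakly_cauchy z -> weakly_cauchy (T \o z).
Proof. by move=> cz f; exact: (cz (adjoint T f)). Qed.

Lemma image_unit_ball_op V W Z (S : operator V W) (T : operator W Z) :
  comp_op T S @` unit_ball V = T @` (S @` unit_ball V).
Proof. by rewrite image_comp. Qed.

Lemma ca_eq V W (y : nat -> V) (z : nat -> W) :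
  (forall k l, rnorm (y k - y l) = rnorm (z k - z l)) -> ca y = ca z.
Proof.
move=> yz; rewrite /ca; congr ereal_inf; apply: eq_imagel => n _; congr ereal_sup.
by apply/seteqP; split=> _ [k kn [l ln <-]]; exists k => //; exists l => //; rewrite yz.
Qed.

Lemma cc_le_comp V W Z (S : operator V W) (T : operator W Z) (U : operator V Z) :
  rnorm S <= 1 -> (forall x, T (S x) = U x) -> (cc U <= cc T)%E.
Proof.
move=> S1 TS; apply: ge_ereal_sup => _ [z [cz z1] <-].
apply: (@cc_ge _ _ _ _ _ (S \o z)); first exact: weakly_cauchy_op.
  move=> k /=; rewrite (le_trans (rnorm_op_ball _ _))//; exact/unit_ballE.
by rewrite le_eqVlt (@ca_eq _ _ (U \o z) (T \o (S \o z))) ?eqxx// => k l /=; rewrite !TS.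
Qed.

(** Composing an operator on V with L, or an operator into V with S, does not
    decrease cc and, by wk_retract, does not increase wk. *)
Lemma direct_qDP_retract V Z (S : operator V Z) (L : operator Z V) :
  rnorm S <= 1 -> rnorm L <= 1 -> (forall x, L (S x) = x) ->
  direct_qDP Z -> direct_qDP V.
Proof.
move=> S1 L1 LS [C [C0 hC]]; exists C; split=> // Y T.
apply: le_trans (cc_le_comp S1 (T := comp_op T L) _) _.
  by move=> x /=; rewrite LS.
apply: le_trans (hC _ _) _; apply: lee_wpmul2l; first by rewrite lee_fin ltW.
have -> : adjoint (comp_op T L) @` unit_ball (dual Y) =
    adjoint L @` (adjoint T @` unit_ball (dual Y)).
  by rewrite image_comp; apply: eq_imagel => g _; exact: operator_ext.
apply: (@wk_retract _ _ _ _ (adjoint L) (adjoint S)).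
  exact: le_trans (rnorm_adjoint _) _.
by move=> g; apply: operator_ext => x /=; rewrite LS.
Qed.

Lemma dual_qDP_retract V Z (S : operator V Z) (L : operator Z V) :
  rnorm S <= 1 -> rnorm L <= 1 -> (forall x, L (S x) = x) ->
  dual_qDP Z -> dual_qDP V.
Proof.
move=> S1 L1 LS [C [C0 hC]]; exists C; split=> // Y T.
apply: le_trans (cc_le_comp (S := adjoint L) (T := adjoint (comp_op S T)) _ _) _.
- exact: le_trans (rnorm_adjoint _) _.
- by move=> g; apply: operator_ext => x /=; rewrite LS.
apply: le_trans (hC _ _) _; apply: lee_wpmul2l; first by rewrite lee_fin ltW.
rewrite image_unit_ball_op; exact: (@wk_retract _ _ _ _ S L).
Qed.

End quantitative_dunford_pettis.

(** * The Hahn-Banach theorem *)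
Section hahn_banach.
Context {R : realType} {s : scalars}.
Local Notation K := (scalar_field R s).
Variable (V : normedModType K).

Section real_extension.
Variables (p : V -> R) (y0 : V).
Hypothesis pD : forall x y, p (x + y) <= p x + p y.
Hypothesis pZ : forall (a : K) x, p (a *: x) = rnorm (a : K^o) * p x.

Let p0 : p 0 = 0.
Proof. by rewrite -(scale0r 0) pZ rnorm0 mul0r. Qed.

Let p_ge0 x : 0 <= p x.
Proof.
have := pD x (- x); rewrite subrr p0 -scaleN1r pZ rnormN rnorm1 mul1r; lra.
Qed.

(** Partial functionals are handled through their graphs, which are the
    real-linear subsets of V * R that p dominates. *)
Let graph (G : set (V * R)) :=
  [/\ forall x r y t (a : R), G (x, r) -> G (y, t) ->
        G (of_real a *: x + y, a * r + t),
      forall x r, G (x, r) -> r <= p x &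
      forall g, G g -> G (y0, p y0)].

Let graph0 G g : graph G -> G g -> G (0, 0).
Proof.
move=> [Gl _ _]; case: g => x r Gx; have := Gl _ _ _ _ (-1) Gx Gx.
by rewrite of_realN of_real1 scaleN1r mulN1r !addNr.
Qed.

Let graphZ G x r (a : R) : graph G -> G (x, r) -> G (of_real a *: x, a * r).
Proof.
move=> gG Gx; have := graph0 gG Gx; case: gG => Gl _ _.
by move=> /(Gl _ _ _ _ a Gx); rewrite !addr0.
Qed.

Let graph_fun G x r t : graph G -> G (x, r) -> G (x, t) -> r = t.
Proof.
move=> gG Gr Gt; have [Gl Gp _] := gG.
have /Gp := Gl _ _ _ _ (-1) Gr Gt; have /Gp := Gl _ _ _ _ (-1) Gt Gr.
rewrite of_realN of_real1 scaleN1r addNr p0; lra.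
Qed.

(** A value c at x is admissible when it separates the numbers r - p (y - x)
    from the numbers p (y + x) - r, where (y, r) runs through the graph. *)
Let graph_extend G x : graph G -> G !=set0 -> (forall r, ~ G (x, r)) ->
  exists2 G', graph G' & G `<` G'.
Proof.
move=> gG [g Gg] Gx; have [Gl Gp Gy] := gG.
pose A := [set r' | exists y r, G (y, r) /\ r' = r - p (y - x)].
have AB y r : G (y, r) -> ubound A (p (y + x) - r).
  move=> Gr _ [y' [r' [Gr' ->]]].
  have /Gp := Gl _ _ _ _ 1 Gr Gr'; rewrite of_real1 scale1r mul1r.
  have := pD (y + x) (y' - x); rewrite addrACA subrr addr0; lra.
have hA : has_sup A.
  split; last by case: g Gg => y r Gr; exists (p (y + x) - r); exact: AB.
  by exists (0 - p (0 - x)), 0, 0; split=> //; exact: graph0 Gg.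
pose c := sup A.
have cl y r : G (y, r) -> r - p (y - x) <= c.
  by move=> Gr; apply: (ub_le_sup hA.2); exists y, r.
have cu y r : G (y, r) -> c <= p (y + x) - r.
  by move=> Gr; apply: (ge_sup hA.1); exact: AB.
have pR (a : R) z : 0 <= a -> p (of_real a *: z) = a * p z.
  by move=> a0; rewrite pZ rnorm_real.
exists [set h | exists y r (a : R), G (y, r) /\ h = (y + of_real a *: x, r + a * c)].
  split.
  - move=> _ _ _ _ b [y [r [a [Gr [-> ->]]]]] [y' [r' [a' [Gr' [-> ->]]]]].
    exists (of_real b *: y + y'), (b * r + r'), (b * a + a'); split; first exact: Gl.
    rewrite scalerDr scalerA -of_realM addrACA -scalerDl -of_realD.
    by congr (_, _); ring.
  - move=> _ _ [y [r [a [Gr [-> ->]]]]].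
    have [a0|a0|->] := ltrgtP a 0; last first.
    + by rewrite of_real0 scale0r mul0r !addr0; exact: Gp.
    + have /cu := graphZ a^-1 gG Gr.
      have -> : y + of_real a *: x = of_real a *: (of_real a^-1 *: y + x).
        by rewrite scalerDr scalerA -of_realM mulfV ?gt_eqF// of_real1 scale1r.
      rewrite (pR a) ?(ltW a0)// -(ler_pM2l a0) mulrBr mulrA mulfV ?gt_eqF//; lra.
    + have b0 : 0 < - a by rewrite oppr_gt0.
      have /cl := graphZ (- a)^-1 gG Gr.
      have -> : y + of_real a *: x = of_real (- a) *: (of_real (- a)^-1 *: y - x).
        rewrite scalerBr scalerA -of_realM mulfV ?gt_eqF// of_real1 scale1r.
        by rewrite of_realN scaleNr opprK.
      rewrite (pR (- a)) ?(ltW b0)// -(ler_pM2l b0) mulrBr mulrA mulfV ?gt_eqF//; lra.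
  - move=> _ _; exists y0, (p y0), 0; split; first exact: Gy Gg.
    by rewrite of_real0 scale0r mul0r !addr0.
split.
  by move=> [y r] Gr; exists y, r, 0; rewrite of_real0 scale0r mul0r !addr0.
move=> /(_ (x, c)) h; apply: (Gx c); apply: h.
exists 0, 0, 1; split; first exact: graph0 Gg.
by rewrite of_real1 scale1r mul1r !add0r.
Qed.

Lemma real_hahn_banach : exists u : V -> R,
  [/\ forall (a : R) x y, u (of_real a *: x + y) = a * u x + u y,
      forall x, u x <= p x & u y0 = p y0].
Proof.
have [G [gG Gmax]] : exists G, graph G /\ forall B, G `<` B -> ~ graph B.
  apply: Zorn_bigcup => F Fg Ft; split.
  - move=> x r y t a [G1 F1 Gx] [G2 F2 Gy].
    have [G12|G21] := Ft _ _ F1 F2.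
      by exists G2 => //; have [Gl _ _] := Fg _ F2; apply: Gl => //; exact: G12.
    by exists G1 => //; have [Gl _ _] := Fg _ F1; apply: Gl => //; exact: G21.
  - by move=> x r [G /Fg[_ Gp _]]; exact: Gp.
  - by move=> g [G FG Gg]; exists G => //; have [_ _] := Fg _ FG; apply; exact: Gg.
have [G0|/set0P G0] := eqVneq G set0.
  exfalso; apply: (Gmax [set h | exists a : R, h = (of_real a *: y0, a * p y0)]).
    rewrite G0; split=> // /(_ (y0, p y0)) h; apply: h.
    by exists 1; rewrite of_real1 scale1r mul1r.
  split.
  - move=> _ _ _ _ b [a [-> ->]] [a' [-> ->]]; exists (b * a + a').
    by rewrite scalerA -of_realM -scalerDl -of_realD; congr (_, _); ring.
  - move=> _ _ [a [-> ->]]; rewrite pZ rnorm_of_real.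
    by rewrite (ler_wpM2r (p_ge0 y0))// ler_norm.
  - by move=> _ _; exists 1; rewrite of_real1 scale1r mul1r.
have /choice[u Gu] x : exists r, G (x, r).
  apply: contrapT => nx; have [|G' gG' GG'] := @graph_extend G x gG G0.
    by move=> r Gr; apply: nx; exists r.
  exact: Gmax GG' gG'.
have [Gl Gp Gy] := gG; exists u; split.
- by move=> a x y; apply: (graph_fun gG (Gu _)); exact: Gl.
- by move=> x; exact: Gp.
- by apply: (graph_fun gG (Gu _)); exact: Gy (Gu 0).
Qed.

End real_extension.
End hahn_banach.

(** The functional with real part u is x |-> u x - i u (i x). *)
Lemma complexify (R : realType) (s : scalars) (V : normedModType (scalar_field R s))
    (u : V -> R) :
  (forall (a : R) x y, u (of_real a *: x + y) = a * u x + u y) ->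
  exists2 f : V -> (scalar_field R s)^o, linear f & forall x, real_part (f x) = u x.
Proof.
case: s V u => V u ul /=; first by exists u.
have u0 : u 0 = 0 by have := ul 1 0 0; rewrite scaler0 addr0 mul1r; lra.
have uD x y : u (x + y) = u x + u y.
  by have := ul 1 x y; rewrite [of_real 1]of_real1 scale1r mul1r.
have uZ (a : R) x : u (Complex a 0 *: x) = a * u x.
  by have := ul a x 0; rewrite !addr0 u0 addr0.
exists (fun x => Complex (u x) (- u (Complex 0 1 *: x))) => // -[a b] x y.
have Ex : Complex a b *: x = Complex a 0 *: x + Complex b 0 *: (Complex 0 1 *: x).
  rewrite scalerA -scalerDl; congr (_ *: _); apply/eqP.
  by rewrite eq_complex /=; apply/andP; split; apply/eqP; ring.
have Ei : Complex 0 1 *: (Complex a b *: x) =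
    Complex a 0 *: (Complex 0 1 *: x) + Complex (- b) 0 *: x.
  rewrite !scalerA -scalerDl; congr (_ *: _); apply/eqP.
  by rewrite eq_complex /=; apply/andP; split; apply/eqP; ring.
rewrite scalerDr Ei Ex !uD !uZ; apply/eqP; rewrite eq_complex /=.
by apply/andP; split; apply/eqP; ring.
Qed.

Section hahn_banach_consequences.
Context {R : realType} {s : scalars}.
Local Notation K := (scalar_field R s).
Implicit Types (V : normedModType K).

Lemma real_part_eq (a : K) : rnorm (a : K^o) <= real_part a -> a = of_real (real_part a).
Proof.
rewrite /rnorm /real_part /of_real; case: s a => //= -[a b] /= h.
have a0 : 0 <= a by rewrite (le_trans _ h)// sqrtr_ge0.
move: h; rewrite -(@ler_pXn2r _ 2)// ?nnegrE ?sqrtr_ge0// sqr_sqrtr ?addr_ge0 ?sqr_ge0//.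
rewrite gerDl => b0; congr Complex; apply/eqP.
by rewrite -sqrf_eq0 eq_le b0 sqr_ge0.
Qed.

(** The modulus of f x is the real part of f at a rotation of x, where p has the
    same value; at y0 the real part already attains the bound, so f y0 is real. *)
Theorem hahn_banach V (p : V -> R) (y0 : V) :
  (forall x y, p (x + y) <= p x + p y) ->
  (forall (a : K) x, p (a *: x) = rnorm (a : K^o) * p x) ->
  exists f : V -> K^o, [/\ linear f, forall x, rnorm (f x) <= p x & f y0 = of_real (p y0)].
Proof.
move=> pD pZ; have [u [ul up uy0]] := real_hahn_banach y0 pD pZ.
have [f lf fu] := complexify ul.
have fp x : rnorm (f x) <= p x.
  have [t t1 tE] := phase (f x : K).
  have fZ : f (t *: x) = of_real (rnorm (f x)).
    rewrite -tE; have := lf t x 0; have := lf 1 0 0.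
    rewrite scaler0 addr0 scale1r => /(congr1 (fun z => z - f 0)).
    by rewrite addrK subrr => <-; rewrite !addr0.
  by rewrite -(@of_realK R s (rnorm (f x))) -fZ fu (le_trans (up _))// pZ t1 mul1r.
exists f; split=> //; rewrite -uy0 -fu; apply: real_part_eq.
by rewrite fu uy0.
Qed.

Lemma norming_functional V (y : V) :
  exists2 f : dual V, rnorm f <= 1 & f y = of_real (rnorm y) :> K.
Proof.
have [f [lf fp fy]] := hahn_banach y (@rnormD _ _ V) (@rnormZ _ _ V).
have [g gf g1] := @build_dual _ _ V f 1 lf (fun x => ltac:(rewrite mul1r; exact: fp)).
by exists g; [exact: g1|rewrite gf].
Qed.

(** The Hahn-Banach theorem for the seminorm p given by the distance to M yields
    a functional that vanishes on M and whose value at y is that distance. *)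
Lemma mazur_subspace V (M : set V) (y : V) :
  (forall (a : K) u v, M u -> M v -> M (a *: u + v)) -> M 0 ->
  (forall f : dual V, (forall u, M u -> f u = 0) -> f y = 0) ->
  forall e : R, 0 < e -> exists2 u, M u & rnorm (y - u) < e.
Proof.
move=> Ml M0 My e e0.
pose p (x : V) := inf [set rnorm (x - u) | u in M].
have hinf x : has_inf [set rnorm (x - u) | u in M].
  by split; [exists (rnorm (x - 0)), 0|exists 0 => _ [u _ <-]; exact: rnorm_ge0].
have p_le x u : M u -> p x <= rnorm (x - u).
  by move=> Mu; apply: (ge_inf (hinf x).2); exists u.
have p_ge x r : (forall u, M u -> r <= rnorm (x - u)) -> r <= p x.
  by move=> h; apply: (lb_le_inf (hinf x).1) => _ [u Mu <-]; exact: h.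
have p_adh x d : 0 < d -> exists2 u, M u & rnorm (x - u) < p x + d.
  by move=> d0; have [_ [u Mu <-] h] := inf_adherent d0 (hinf x); exists u.
have pD x z : p (x + z) <= p x + p z.
  apply/ler_addgt0Pr => d d0; have d20 : 0 < d / 2 by rewrite divr_gt0.
  have [u Mu hu] := p_adh x _ d20; have [v Mv hv] := p_adh z _ d20.
  have Muv : M (u + v) by rewrite -[u]scale1r; exact: Ml.
  have := p_le (x + z) _ Muv.
  have := rnormD (x - u) (z - v); rewrite addrACA -opprD; lra.
have MZ (a : K) u : M u -> M (a *: u) by move=> Mu; rewrite -[_ *: _]addr0; exact: Ml.
have pZ_le (a : K) x : p (a *: x) <= rnorm (a : K^o) * p x.
  apply/ler_addgt0Pr => d d0; have a1 : 0 < rnorm (a : K^o) + 1.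
    by rewrite ltr_wpDl ?rnorm_ge0.
  have [u Mu hu] := p_adh x _ (divr_gt0 d0 a1).
  rewrite (le_trans (p_le _ _ (MZ a _ Mu)))// -scalerBr rnormZ.
  rewrite (le_trans (ler_wpM2l _ (ltW hu))) ?rnorm_ge0// mulrDr lerD2l mulrCA ger_pMr//.
  by rewrite ler_pdivrMr// mul1r lerDl.
have pZ (a : K) x : p (a *: x) = rnorm (a : K^o) * p x.
  have [->|a0] := eqVneq a 0.
    apply/eqP; rewrite eq_le pZ_le scale0r rnorm0 mul0r /=.
    by apply: p_ge => u _; exact: rnorm_ge0.
  apply/eqP; rewrite eq_le pZ_le /=.
  have ra : 0 < rnorm (a : K^o).
    rewrite lt_neqAle rnorm_ge0 andbT eq_sym; apply/eqP => /(@rnorm_eq0 _ _ K^o) a00.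
    by move: a0; rewrite a00 eqxx.
  rewrite -ler_pdivlMl// -{1}(scale1r x) -(mulVf a0) -scalerA (le_trans (pZ_le _ _))//.
  rewrite ler_wpM2r//.
    by apply: p_ge => u _; exact: rnorm_ge0.
  rewrite -(ler_pM2l ra) -rnormM mulfV// rnorm1 mulfV ?gt_eqF//.
have [f [lf fp fy]] := hahn_banach y pD pZ.
have p_norm x : p x <= 1 * rnorm x by have := p_le x 0 M0; rewrite subr0 mul1r.
have [g gf _] := @build_dual _ _ V f 1 lf (fun x => le_trans (fp x) (p_norm x)).
have py0 : p y = 0.
  apply: (@of_real_inj R s); rewrite -fy -gf of_real0; apply: My => u Mu.
  apply: (@rnorm_eq0 _ _ K^o); apply/eqP; rewrite eq_le rnorm_ge0 andbT gf.
  by rewrite (le_trans (fp u))// (le_trans (p_le u u Mu))// subrr rnorm0.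
by have := p_adh y e e0; rewrite py0 add0r.
Qed.

End hahn_banach_consequences.

(** * The space *)
Section predual.
Context {R : realType} {s : scalars}.
Local Notation K := (scalar_field R s).
Implicit Types (x y : nat -> nat -> K^o) (r t e : R).

Definition eps (n : nat) : R := n.+1%:R^-1.

Lemma eps_gt0 n : 0 < eps n.
Proof. by rewrite invr_gt0. Qed.

Lemma eps_le1 n : eps n <= 1.
Proof. by rewrite invf_le1// ler1n. Qed.

Lemma eps_anti n m : (n <= m)%N -> eps m <= eps n.
Proof. by move=> nm; rewrite lef_pV2 ?posrE// ler_nat. Qed.

(** A finite subset of the block n is given by a bound m and a predicate w. *)
Definition mass x n m (w : pred nat) : R := \sum_(0 <= k < m | w k) rnorm (x n k).
Definition capacity n m (w : pred nat) : R := 1 + eps n * \sum_(0 <= k < m | w k) 1.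

(** Membership in r times the unit ball. For r = 1 it says that in each block n
    the sum of the positive parts of |x n k| - eps n is at most 1. *)
Definition bounded_by r x := forall n m w, mass x n m w <= r * capacity n m w.

Lemma capacity_gt0 n m w : 0 < capacity n m w.
Proof. by rewrite ltr_pwDl// mulr_ge0 ?(ltW (eps_gt0 _))// sumr_ge0. Qed.

Lemma bounded_by_ge0 r x : bounded_by r x -> 0 <= r.
Proof.
by move=> /(_ 0%N 0%N xpredT); rewrite /mass /capacity !big_nil mulr0 addr0 mulr1.
Qed.

Lemma bounded_by_solid r x y : (forall n k, rnorm (y n k) <= rnorm (x n k)) ->
  bounded_by r x -> bounded_by r y.
Proof.
by move=> yx rx n m w; apply: le_trans (rx n m w); apply: ler_sum => k _; exact: yx.
Qed.

Lemma bounded_by_le r t x : r <= t -> bounded_by r x -> bounded_by t x.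
Proof.
move=> rt rx n m w; apply: le_trans (rx n m w) _.
by rewrite ler_wpM2r// ltW// capacity_gt0.
Qed.

Lemma bounded_byD r t x y : bounded_by r x -> bounded_by t y ->
  bounded_by (r + t) (fun n k => x n k + y n k).
Proof.
move=> rx ty n m w; rewrite mulrDl; apply: le_trans (lerD (rx n m w) (ty n m w)).
by rewrite -big_split; apply: ler_sum => k _; exact: rnormD.
Qed.

Lemma bounded_byZ r (a : K) x : bounded_by r x ->
  bounded_by (rnorm (a : K^o) * r) (fun n k => a *: x n k).
Proof.
move=> rx n m w; rewrite -mulrA; apply: le_trans (ler_wpM2l (rnorm_ge0 _) (rx n m w)).
by rewrite mulr_sumr; apply: ler_sum => k _; rewrite rnormZ.
Qed.

Lemma bounded_by_coord r x n k : bounded_by r x -> rnorm (x n k) <= r * (1 + eps n).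
Proof.
move=> /(_ n k.+1 (pred1 k)); rewrite /mass /capacity.
have E (F : nat -> R) : \sum_(0 <= i < k.+1 | pred1 k i) F i = F k.
  rewrite big_mkcond big_nat_recr//= eqxx big_nat big1 ?add0r// => i /andP[_ ik].
  by rewrite ltn_eqF.
by rewrite !E mulr1.
Qed.

Lemma bounded_by_coord2 r x n k : bounded_by r x -> rnorm (x n k) <= 2 * r.
Proof.
move=> rx; rewrite (le_trans (bounded_by_coord n k rx))// mulrC ler_wpM2r//.
  exact: bounded_by_ge0 rx.
by have := eps_le1 n; lra.
Qed.

Lemma bounded_by_small r x : 0 <= r -> (forall n k, rnorm (x n k) <= r * eps n) ->
  bounded_by r x.
Proof.
move=> r0 rx n m w; rewrite /capacity mulrDr mulr1 mulrA mulr_sumr.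
by rewrite ler_wpDl// ler_sum// => k _; rewrite mulr1.
Qed.

Definition head m n k := (n < m)%N && (k < m)%N.

(** The unit ball of X is almost that of a c_0-sum: in the blocks that meet the
    head, a tail may be added at no cost as long as its entries stay below the
    threshold eps of the block. *)
Lemma bounded_by_glue t m x y : 1 <= t ->
  bounded_by 1 x -> (forall n k, ~~ head m n k -> x n k = 0) ->
  bounded_by t y -> (forall n k, head m n k -> y n k = 0) ->
  (forall n k, (n < m)%N -> rnorm (y n k) <= t * eps n) ->
  bounded_by t (fun n k => x n k + y n k).
Proof.
move=> t1 bx x0 by_ y0 ysmall n m' w; have [nm|mn] := ltnP n m; last first.
  apply: le_trans (by_ n m' w); apply: ler_sum => k _.
  by rewrite x0 ?add0r// /head ltnNge mn.
rewrite /mass (bigID (fun k => k < m)%N)/= /capacity.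
rewrite [X in eps n * X](bigID (fun k => k < m)%N)/=.
set h1 := \sum_(0 <= k < m' | w k && (k < m)%N) 1.
set h2 := \sum_(0 <= k < m' | w k && ~~ (k < m)%N) 1.
have b1 : \sum_(0 <= k < m' | w k && (k < m)%N) rnorm (x n k + y n k) <= 1 + eps n * h1.
  have := bx n m' (fun k => w k && (k < m)%N); rewrite mul1r; apply: le_trans.
  by apply: ler_sum => k /andP[_ km]; rewrite y0 ?addr0// /head nm.
have b2 : \sum_(0 <= k < m' | w k && ~~ (k < m)%N) rnorm (x n k + y n k) <= t * eps n * h2.
  rewrite mulr_sumr; apply: ler_sum => k /andP[_ km].
  by rewrite x0 ?add0r ?mulr1 ?ysmall// /head nm.
have h10 : 0 <= eps n * h1 by rewrite mulr_ge0 ?(ltW (eps_gt0 _))// sumr_ge0.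
have -> : t * (1 + eps n * (h1 + h2)) = t * (1 + eps n * h1) + t * eps n * h2 by ring.
by apply: (le_trans (lerD b1 b2)); rewrite lerD2r ler_peMl// addr_ge0.
Qed.

Definition restrict (H : nat -> nat -> bool) x n k : K^o := if H n k then x n k else 0.
Definition trunc m x := restrict (head m) x.
Definition tail m x := restrict (fun n k => ~~ head m n k) x.

Lemma rnorm_restrict H x n k : rnorm (restrict H x n k) <= rnorm (x n k).
Proof. by rewrite /restrict; case: ifP => // _; rewrite rnorm0 rnorm_ge0. Qed.

Lemma bounded_by_restrict H r x : bounded_by r x -> bounded_by r (restrict H x).
Proof. by apply: bounded_by_solid => n k; exact: rnorm_restrict. Qed.

Lemma head_le m m' n k : (m <= m')%N -> head m n k -> head m' n k.
Proof. by move=> mm /andP[nm km]; rewrite /head !(leq_trans _ mm). Qed.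

Lemma bounded_by_tail_le m m' r x : (m <= m')%N ->
  bounded_by r (tail m x) -> bounded_by r (tail m' x).
Proof.
move=> mm; apply: bounded_by_solid => n k; rewrite /tail /restrict.
by case: ifP => [/negP h|_]; [case: ifP => // /negbFE /(head_le mm)|rewrite rnorm0 rnorm_ge0].
Qed.

Lemma bounded_by_trunc m x : exists r, bounded_by r (trunc m x).
Proof.
pose M := \sum_(n < m) \sum_(k < m) rnorm (x n k) / eps n.
have M0 : 0 <= M.
  by rewrite sumr_ge0// => i _; rewrite sumr_ge0// => j _; rewrite divr_ge0 ?rnorm_ge0// ltW// eps_gt0.
exists M; apply: bounded_by_small => // n k; rewrite /trunc /restrict.
case: ifP => [/andP[nm km]|_]; last by rewrite rnorm0 mulr_ge0// ltW// eps_gt0.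
rewrite -ler_pdivrMr ?eps_gt0// /M (bigD1 (Ordinal nm))//= (bigD1 (Ordinal km))//= -addrA.
rewrite lerDl addr_ge0// ?sumr_ge0// => i _; last rewrite sumr_ge0// => j _;
  by rewrite divr_ge0 ?rnorm_ge0// ltW// eps_gt0.
Qed.

(** The closure of the finitely supported families. *)
Definition vanishing : {pred (nat -> nat -> K^o)} :=
  fun x => `[< forall e, 0 < e -> exists m, bounded_by e (tail m x) >].

Record predual := Predual {
  predual_fun :> nat -> nat -> K^o;
  _ : predual_fun \in vanishing }.

HB.instance Definition _ := [isSub for predual_fun].
HB.instance Definition _ := [Choice of predual by <:].

Lemma vanishing_submod : GRing.submod_closed vanishing.
Proof.
split.
  apply/asboolP => e e0; exists 0%N; apply: bounded_by_small; first exact: ltW.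
  move=> n k; rewrite (_ : tail _ _ _ _ = 0); last first.
    by rewrite /tail /restrict; case: (~~ _).
  by rewrite rnorm0 mulr_ge0// ltW// eps_gt0.
move=> a x y /asboolP hx /asboolP hy; apply/asboolP => e e0.
have a1 : 0 < rnorm (a : K^o) + 1 by rewrite ltr_wpDl ?rnorm_ge0.
have e20 : 0 < e / 2 by rewrite divr_gt0.
have [m1 h1] := hx _ (divr_gt0 e20 a1); have [m2 h2] := hy _ e20.
exists (maxn m1 m2).
have := bounded_byD (bounded_byZ a (bounded_by_tail_le (leq_maxl m1 m2) h1))
  (bounded_by_tail_le (leq_maxr m1 m2) h2).
move=> /(bounded_by_le (t := e)) h; apply: bounded_by_solid (h _).
  move=> n k; rewrite /tail /restrict; case: ifP => // _.
  by rewrite rnorm0 rnorm_ge0.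
have : rnorm (a : K^o) * (e / 2 / (rnorm (a : K^o) + 1)) <= e / 2.
  by rewrite mulrCA ger_pMr// ler_pdivrMr// mul1r lerDl.
lra.
Qed.

HB.instance Definition _ :=
  GRing.isSubmodClosed.Build K (nat -> nat -> K^o) vanishing vanishing_submod.
HB.instance Definition _ := [SubChoice_isSubLmodule of predual by <:].

Implicit Types u v : predual.

Definition predual_rnorm u : R :=
  sup [set mass u i.1.1 i.1.2 i.2 / capacity i.1.1 i.1.2 i.2
      | i in [set: nat * nat * (nat -> bool)]].

Lemma predual_has_sup u :
  has_sup [set mass u i.1.1 i.1.2 i.2 / capacity i.1.1 i.1.2 i.2
      | i in [set: nat * nat * (nat -> bool)]].
Proof.
split; first by exists (mass u 0%N 0%N xpredT / capacity 0%N 0%N xpredT), (0%N, 0%N, fun=> true).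
have /asboolP/(_ 1 ltr01)[m h1] := valP u; have [r hr] := bounded_by_trunc m u.
exists (r + 1) => _ [[[n m'] w] _ <-] /=; rewrite ler_pdivrMr ?capacity_gt0//.
apply: le_trans (bounded_byD hr h1 n m' w); apply: ler_sum => k _.
by rewrite /trunc /tail /restrict; case: ifP; rewrite ?addr0 ?add0r.
Qed.

Lemma predual_rnorm_le u r : predual_rnorm u <= r <-> bounded_by r u.
Proof.
split=> [ur n m w|h].
  rewrite -ler_pdivrMr ?capacity_gt0// (le_trans _ ur)//.
  by apply: (ub_le_sup (predual_has_sup u).2); exists (n, m, w).
apply: (ge_sup (predual_has_sup u).1) => _ [[[n m'] w] _ <-] /=.
by rewrite ler_pdivrMr ?capacity_gt0//; exact: h.
Qed.

Lemma predual_rnormP u : bounded_by (predual_rnorm u) u.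
Proof. exact/predual_rnorm_le. Qed.

Definition predual_norm u : K := of_real (predual_rnorm u).

Lemma predual_normD u v : predual_norm (u + v) <= predual_norm u + predual_norm v.
Proof.
rewrite /predual_norm -of_realD le_of_real; apply/predual_rnorm_le.
exact: bounded_byD (predual_rnormP u) (predual_rnormP v).
Qed.

Lemma predual_normZ (a : K) u : predual_norm (a *: u) = `|a| * predual_norm u.
Proof.
have le_normZ (b : K) v : predual_rnorm (b *: v) <= rnorm (b : K^o) * predual_rnorm v.
  by apply/predual_rnorm_le; exact: bounded_byZ (predual_rnormP v).
have N0 v : 0 <= predual_rnorm v by exact: bounded_by_ge0 (predual_rnormP v).
rewrite /predual_norm -[`|a|](@rnormE _ _ K^o) -of_realM; congr of_real.
apply/eqP; rewrite eq_le le_normZ /=.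
have [->|a0] := eqVneq a 0; first by rewrite (@rnorm0 _ _ K^o) mul0r.
have ra : rnorm (a : K^o) * rnorm (a^-1 : K^o) = 1 by rewrite -rnormM mulfV// rnorm1.
rewrite -{1}[u]scale1r -(mulVf a0) -scalerA.
apply: le_trans (ler_wpM2l (rnorm_ge0 _) (le_normZ _ _)) _.
by rewrite mulrA ra mul1r.
Qed.

Lemma predual_norm_eq0 u : predual_norm u = 0 -> u = 0.
Proof.
rewrite -(@of_real0 R s) => /of_real_inj u0; apply: val_inj.
apply/funext => n; apply/funext => k; apply: rnorm_eq0; apply/eqP.
rewrite eq_le rnorm_ge0 andbT (le_trans (bounded_by_coord2 n k (predual_rnormP u)))//.
by rewrite u0 mulr0.
Qed.

HB.instance Definition _ := Lmodule_isNormed.Build K predual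
  predual_normD predual_normZ predual_norm_eq0.

Lemma rnorm_predual_le u r : rnorm u <= r <-> bounded_by r u.
Proof. by rewrite -predual_rnorm_le /rnorm of_realK. Qed.

Lemma rnorm_predualP u : bounded_by (rnorm u) u.
Proof. exact/rnorm_predual_le. Qed.

Lemma rnorm_coord_le2 u n k : rnorm (u n k) <= 2 * rnorm u.
Proof. exact/bounded_by_coord2/rnorm_predualP. Qed.

End predual.
Arguments predual : clear implicits.

(** * Finitely supported vectors, completeness and shrinking *)
Section predual_vectors.
Context {R : realType} {s : scalars}.
Local Notation K := (scalar_field R s).
Local Notation X := (predual R s).
Implicit Types (u v y : X) (x : nat -> nat -> K^o) (r t e : R).

(** Each of the inequalities that define bounded_by involves finitely many
    coordinates. *)
Lemma bounded_by_lim (T : Type) (F : set_system T) (FF : ProperFilter F)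
    (z : T -> nat -> nat -> K^o) x r :
  (forall n k e, 0 < e -> \forall t \near F, rnorm (z t n k - x n k) < e) ->
  (\forall t \near F, bounded_by r (z t)) -> bounded_by r x.
Proof.
move=> zx zr n m w; apply/ler_addgt0Pr => e e0.
have m1 : 0 < m.+1%:R :> R by [].
have near_all : \forall t \near F, forall k : 'I_m, rnorm (z t n k - x n k) < e / m.+1%:R.
  by apply: filter_forall => k; apply: zx; rewrite divr_gt0.
have [t [/= tk tr]] := filter_ex (filterI near_all zr).
apply: (@le_trans _ _ (mass (z t) n m w + \sum_(0 <= k < m | w k) e / m.+1%:R)).
  rewrite /mass -big_split /= !big_mkord; apply: ler_sum => k _.
  apply: le_trans (rnorm_sub _ (z t n k)) _; rewrite [leRHS]addrC.
  apply: lerD => //; rewrite rnormBC; exact/ltW/tk.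
apply: lerD; first exact: tr.
rewrite big_mkord (le_trans (y := \sum_(k < m) e / m.+1%:R))//.
  by rewrite [leRHS](bigID (fun k : 'I_m => w k))/= lerDl sumr_ge0// => i _; rewrite divr_ge0 ?ltW.
rewrite sumr_const card_ord -[_ *+ m]mulr_natl mulrCA ger_pMr// ler_pdivrMr// mul1r ler_nat.
exact: leqnSn.
Qed.

Lemma fin_vanishing m x : trunc m x \in @vanishing R s.
Proof.
apply/asboolP => e e0; exists m; apply: bounded_by_small; first exact: ltW.
move=> n k; rewrite /tail /trunc /restrict; case: (head _ _ _) => /=;
  by rewrite rnorm0 mulr_ge0// ltW// eps_gt0.
Qed.

Definition fin m x : X := Predual (fin_vanishing m x).

Lemma rnorm_fin_le m x r : bounded_by r x -> rnorm (fin m x) <= r.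
Proof. by move=> rx; apply/rnorm_predual_le; exact: bounded_by_restrict. Qed.

Lemma cut_vanishing (H : nat -> nat -> bool) u : restrict H u \in @vanishing R s.
Proof.
apply/asboolP => e e0; have /asboolP/(_ e e0)[m hm] := valP u; exists m.
apply: bounded_by_solid hm => n k; rewrite /tail /restrict; case: ifP => // _.
by case: ifP => // _; rewrite rnorm0 rnorm_ge0.
Qed.

Definition cut H u : X := Predual (cut_vanishing H u).

Lemma rnorm_cut_le H u : rnorm (cut H u) <= rnorm u.
Proof. by apply/rnorm_predual_le; apply: bounded_by_restrict; exact: rnorm_predualP. Qed.

Lemma predual_ext u v : (forall n k, u n k = v n k) -> u = v.
Proof. by move=> uv; apply: val_inj; apply/funext => n; apply/funext => k; exact: uv. Qed.

Lemma sub_fin m u : u - fin m u = cut (fun n k => ~~ head m n k) u.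
Proof.
apply: predual_ext => n k; rewrite -[LHS]/(u n k - trunc m u n k) /= /trunc /restrict.
by case: (head _ _ _); rewrite /= ?subrr ?subr0.
Qed.

Lemma fin_cvg u e : 0 < e -> exists m, forall m', (m <= m')%N -> rnorm (u - fin m' u) <= e.
Proof.
move=> e0; have /asboolP/(_ e e0)[m hm] := valP u; exists m => m' mm.
by rewrite sub_fin; apply/rnorm_predual_le; exact: bounded_by_tail_le hm.
Qed.

Lemma coordinate_bounded_linear n k :
  (fun u => u n k) \in @bounded_linear _ _ X K^o.
Proof.
apply/asboolP; split=> //; exists (of_real 2) => u.
by rewrite -!rnormE -of_realM le_of_real rnorm_coord_le2.
Qed.

Definition coordinate n k : dual X := Operator (coordinate_bounded_linear n k).

Lemma rnorm_coordinate n k : rnorm (coordinate n k) <= 2.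
Proof. by apply: rnorm_op_le => // u; exact: rnorm_coord_le2. Qed.

Definition basis n k : X :=
  fin (maxn n k).+1 (fun n' k' => ((n' == n) && (k' == k))%:R).

Lemma basisE n k n' k' : basis n k n' k' = ((n' == n) && (k' == k))%:R.
Proof.
rewrite /= /trunc /restrict; case: ifP => // /negP h; case: eqP => //= nn.
by case: eqP => //= kk; case: h; rewrite nn kk /head !ltnS leq_maxl leq_maxr.
Qed.

Lemma rnorm_bool (b : bool) : rnorm (b%:R : K^o) = b%:R.
Proof. by case: b; [exact: rnorm1|exact: rnorm0]. Qed.

Lemma rnorm_basis n k : rnorm (basis n k) <= 1.
Proof.
apply/rnorm_predual_le => n' m w; rewrite mul1r.
apply: (@le_trans _ _ 1); last by rewrite lerDl mulr_ge0 ?(ltW (eps_gt0 _))// sumr_ge0.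
apply: (@le_trans _ _ (\sum_(0 <= k' < m) (k' == k)%:R)).
  rewrite /mass big_mkcond; apply: ler_sum => k' _; rewrite basisE rnorm_bool.
  by case: ifP => // _; case: (n' == n).
apply: (@le_trans _ _ (k < m)%:R); last by case: (k < m)%N.
elim: m => [|m IH]; first by rewrite big_nil.
rewrite big_nat_recr//= (le_trans (lerD IH (lexx _)))//.
by rewrite ltnS; case: ltngtP; rewrite ?addr0 ?add0r.
Qed.

Lemma sum_delta m (n k : nat) x :
  \sum_(i < m) \sum_(j < m) x i j *: ((n == i) && (k == j))%:R = trunc m x n k.
Proof.
rewrite /trunc /restrict; case: ifP => [/andP[nm km]|/negP h].
  rewrite (bigD1 (Ordinal nm))//= (bigD1 (Ordinal km))//= !eqxx [_ *: _]mulr1.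
  rewrite big1 => [|j]; last first.
    by rewrite -val_eqE /= eq_sym => /negbTE ->; rewrite scaler0.
  rewrite big1 => [|i]; first by rewrite !addr0.
  rewrite -val_eqE /= eq_sym => /negbTE ->; rewrite big1// => j _.
  by rewrite scaler0.
rewrite big1// => i _; rewrite big1// => j _; case: eqP => [ni|_]; last by rewrite scaler0.
case: eqP => [kj|_]; last by rewrite scaler0.
by case: h; rewrite /head ni kj !ltn_ord.
Qed.

Lemma fin_sum m x : fin m x = \sum_(n < m) \sum_(k < m) x n k *: basis n k.
Proof.
apply: predual_ext => n k; rewrite -[RHS]/(coordinate n k _) raddf_sum.
rewrite -[LHS](sum_delta m n k x); apply: eq_bigr => i _; rewrite raddf_sum.
by apply: eq_bigr => j _; rewrite -[RHS]/(x i j *: basis i j n k) basisE.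
Qed.

Lemma functional_fin (g : dual X) m x :
  g (fin m x) = \sum_(n < m) \sum_(k < m) x n k *: (g (basis n k) : K^o).
Proof.
rewrite fin_sum linear_sum; apply: eq_bigr => n _; rewrite linear_sum.
by apply: eq_bigr => k _; rewrite linearZ.
Qed.

Lemma predual_complete (F : set_system X) (FF : ProperFilter F) :
  (forall e, 0 < e -> exists a, \forall u \near F, rnorm (u - a) < e) ->
  exists l, forall e, 0 < e -> \forall u \near F, rnorm (u - l) < e.
Proof.
move=> cF.
have coord_lim (n k : nat) : exists l : K^o, forall e, 0 < e -> \forall u \near F, rnorm ((u : X) n k - l) < e.
  apply: scalar_complete => e e0; have e20 : 0 < e / 2 by rewrite divr_gt0.
  have [a ha] := cF _ e20; exists (a n k); apply: (@filterS _ F _ _ _ _ ha) => u ua.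
  have := rnorm_coord_le2 (u - a) n k; rewrite -[(u - a) n k]/(u n k - a n k); lra.
have /choice[l0 hl] (nk : nat * nat) : exists l : K^o, forall e, 0 < e ->
    \forall u \near F, rnorm ((u : X) nk.1 nk.2 - l) < e by exact: coord_lim.
pose l n k := l0 (n, k).
have al a e : (\forall u \near F, rnorm (u - a) < e) ->
    bounded_by e (fun n k => l n k - a n k).
  move=> ha; apply: (@bounded_by_lim _ F _ (fun (u : X) n k => u n k - a n k)).
    move=> n k d d0; apply: (@filterS _ F _ _ _ _ (hl (n, k) d d0)) => u.
    by rewrite opprB addrA subrK.
  apply: (@filterS _ F _ _ _ _ ha) => u /ltW ua; exact/(rnorm_predual_le (u - a)).
have lX : l \in @vanishing R s.
  apply/asboolP => e e0; have e20 : 0 < e / 2 by rewrite divr_gt0.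
  have [a /al la] := cF _ e20; have /asboolP/(_ _ e20)[m hm] := valP a; exists m.
  rewrite (splitr e); apply: bounded_by_solid (bounded_byD la hm) => n k.
  rewrite /tail /restrict; case: (head _ _ _) => /=; last by rewrite subrK.
  by rewrite rnorm0 rnorm_ge0.
exists (Predual lX) => e e0; have e20 : 0 < e / 2 by rewrite divr_gt0.
have [a ha] := cF _ e20; apply: (@filterS _ F _ _ _ _ ha) => u ua.
have la : rnorm (Predual lX - a) <= e / 2 by apply/rnorm_predual_le; exact: al.
have -> : u - Predual lX = (u - a) - (Predual lX - a) by rewrite opprB addrA subrK.
apply: le_lt_trans (rnormB _ _) _; rewrite (splitr e).
apply: ltr_leD; [exact: ua|exact: la].
Qed.

HB.instance Definition _ :=
  Uniform_isComplete.Build X (@normed_complete _ _ _ predual_complete).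

(** * Shrinking *)

(** The vectors that may be glued behind a vector of the unit ball supported in
    the head of size m. *)
Definition behind m : set X := [set y : X | [/\ rnorm y <= 1,
  forall n k, head m n k -> y n k = 0 &
  forall n k, (n < m)%N -> rnorm (y n k) <= eps n]].

Lemma rnorm_glue m u y : rnorm u <= 1 -> (forall n k, ~~ head m n k -> u n k = 0) ->
  behind m y -> rnorm (u + y) <= 1.
Proof.
move=> u1 u0 [y1 y0 ysmall]; apply/rnorm_predual_le.
apply: (@bounded_by_glue R s 1 m u y (lexx _) _ u0 _ y0).
- exact/rnorm_predual_le.
- exact/rnorm_predual_le.
- by move=> n k nm; rewrite mul1r; exact: ysmall.
Qed.

Lemma behindZ m (a : K) y : rnorm (a : K^o) <= 1 -> behind m y -> behind m (a *: y).
Proof.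
move=> a1 [y1 y0 ysmall]; split=> [|n k h|n k h].
- by rewrite rnormZ (le_trans (ler_piMl (rnorm_ge0 _) a1)).
- by rewrite -[LHS]/(a *: y n k) y0// scaler0.
- rewrite -[(a *: y) n k]/(a *: y n k) rnormZ (le_trans (ler_piMl (rnorm_ge0 _) a1))//.
  exact: ysmall.
Qed.

(** The head of a nearly norming vector of g may be augmented by any rotation of y
    without leaving the unit ball, so that g y is small. *)
Lemma functional_behind (g : dual X) e : 0 < e ->
  exists m, forall y, behind m y -> rnorm (g y : K^o) <= e.
Proof.
move=> e0; have e20 : 0 < e / 2 by rewrite divr_gt0.
have [x x1 [r rg gx]] : exists2 x, rnorm x <= 1 &
    exists2 r, rnorm g - e / 2 < r & g x = of_real r :> K.
  by apply: rnorm_dual_gt; rewrite ltrBlDr ltrDl.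
have g1 : 0 < rnorm g + 1 by rewrite ltr_wpDl ?rnorm_ge0.
have [m hm] := fin_cvg x (divr_gt0 e20 g1); exists m => y ym.
have [t t1 tE] := phase (g y : K).
have glued : rnorm (fin m x + t *: y) <= 1.
  apply: (@rnorm_glue m); last by apply: behindZ => //; rewrite t1.
    by apply: rnorm_fin_le; exact/rnorm_predual_le.
  by move=> n k /negbTE h; rewrite /= /trunc /restrict h.
have b1 := rnorm_op_ball g glued.
have b2 : rnorm (g (x - fin m x) : K^o) <= e / 2.
  rewrite (le_trans (rnorm_op g _))//.
  apply: le_trans (ler_wpM2l (rnorm_ge0 _) (hm m (leqnn m))) _.
  by rewrite mulrCA ger_pMr// ler_pdivrMr// mul1r lerDl.
have b3 : r + rnorm (g y : K^o) <= rnorm (g (x + t *: y) : K^o).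
  by rewrite linearD linearZ /= gx [t *: _]tE -of_realD rnorm_of_real ler_norm.
have b4 : rnorm (g (x + t *: y) : K^o) <= rnorm (g (x - fin m x) : K^o) + rnorm (g (fin m x + t *: y) : K^o).
  by have := rnormD (g (x - fin m x) : K^o) (g (fin m x + t *: y)); rewrite -linearD addrA subrK.
lra.
Qed.

(** The entries in the blocks n < m0 are bounded by 2, so that scaling by
    eps m0 / 2 puts them below the thresholds. *)
Lemma behind_two_step (g : dual X) m0 m1 e :
  (forall y, behind m0 y -> rnorm (g y : K^o) <= e / 2) ->
  (forall y, behind m1 y -> rnorm (g y : K^o) <= e * eps m0 / 4) ->
  forall y, rnorm y <= 1 -> (forall n k, head (maxn m0 m1) n k -> y n k = 0) ->
    rnorm (g y : K^o) <= e.
Proof.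
move=> h0 h1 y y1 y0.
have yE : y = cut (fun n _ => (n < m0)%N) y + cut (fun n _ => (m0 <= n)%N) y.
  apply: predual_ext => n k; rewrite -[RHS]/(cut _ y n k + cut _ y n k) /= /restrict.
  by case: ltnP; rewrite ?addr0 ?add0r.
have b0 : rnorm (g (cut (fun n _ => (m0 <= n)%N) y) : K^o) <= e / 2.
  apply: h0; split=> [|n k /andP[nm _]|n k nm].
  - exact: le_trans (rnorm_cut_le _ _) _.
  - by rewrite /= /restrict leqNgt nm.
  - by rewrite /= /restrict leqNgt nm rnorm0 ltW// eps_gt0.
have a0 : 0 < eps m0 / 2 :> R by rewrite divr_gt0// eps_gt0.
have b1 : rnorm (g (of_real (eps m0 / 2) *: cut (fun n _ => (n < m0)%N) y) : K^o) <= e * eps m0 / 4.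
  have small n k : rnorm ((of_real (eps m0 / 2) *: cut (fun n _ => (n < m0)%N) y) n k) <= eps n.
    rewrite -[X in rnorm X]/(of_real (eps m0 / 2) *: restrict (fun n _ => (n < m0)%N) y n k).
    rewrite /restrict; case: ifP => [nm|_]; last by rewrite scaler0 rnorm0 ltW// eps_gt0.
    rewrite rnormZ rnorm_real ?(ltW a0)//.
    apply: le_trans (eps_anti (ltnW nm)).
    have c2 : rnorm (y n k) <= 2 by have := rnorm_coord_le2 y n k; lra.
    by rewrite -[leRHS](divfK (_ : 2 != 0)) ?pnatr_eq0// ler_wpM2l// ltW.
  apply: h1; split=> [|n k h|n k _]; last exact: small.
  - by apply/rnorm_predual_le; apply: bounded_by_small => // n k; rewrite mul1r.
  - rewrite -[LHS]/(of_real (eps m0 / 2) *: restrict (fun n _ => (n < m0)%N) y n k).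
    by rewrite /restrict y0 ?if_same ?scaler0//; exact: head_le (leq_maxr _ _) h.
rewrite yE linearD (le_trans (rnormD _ _))//.
move: b1; rewrite linearZ rnormZ rnorm_real ?(ltW a0)//.
set c := rnorm (g (cut (fun n _ => (n < m0)%N) y) : K^o) => b1.
have : eps m0 / 2 * c <= eps m0 / 2 * (e / 2) by lra.
rewrite ler_pM2l// => c1; move: (lerD c1 b0); rewrite -splitr; exact.
Qed.

(** The number m0 obtained for the precision e / 2 determines the precision at
    which functional_behind is applied again, to handle the blocks n < m0. *)
Lemma shrinking (g : dual X) e : 0 < e ->
  exists m, forall y, rnorm y <= 1 -> (forall n k, head m n k -> y n k = 0) ->
    rnorm (g y : K^o) <= e.
Proof.
move=> e0; have e20 : 0 < e / 2 by rewrite divr_gt0.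
have [m0 h0] := functional_behind g e20.
have e40 : 0 < e * eps m0 / 4 by rewrite divr_gt0// mulr_gt0// eps_gt0.
have [m1 h1] := functional_behind g e40.
by exists (maxn m0 m1); exact: behind_two_step h0 h1.
Qed.

End predual_vectors.

(** * The bidual *)
Section bidual.
Context {R : realType} {s : scalars}.
Local Notation K := (scalar_field R s).
Local Notation X := (predual R s).
Implicit Types (u v y : X) (x : nat -> nat -> K^o) (r t e : R).

(** If infinitely many entries exceed the threshold E + d, the sum over N of
    them exceeds N * (E + d), hence eventually 1 + N * E. *)
Lemma threshold (a : nat -> R) (E d : R) : 0 < d ->
  (forall m w, \sum_(0 <= k < m | w k) a k <= 1 + E * \sum_(0 <= k < m | w k) 1) ->
  exists k0, forall k, (k0 <= k)%N -> a k <= E + d.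
Proof.
move=> d0 ha; apply: contrapT => nk; pose w k := E + d < a k.
have large j : exists m, j%:R <= \sum_(0 <= k < m | w k) 1 :> R.
  elim: j => [|j [m hm]]; first by exists 0%N; rewrite big_nil.
  have [k mk wk] : exists2 k, (m <= k)%N & w k.
    apply: contrapT => h; apply: nk; exists m => k mk; rewrite leNgt.
    by apply/negP => wk; apply: h; exists k.
  exists k.+1; rewrite big_mkcond big_nat_recr //= wk -big_mkcond -natr1 lerD2r.
  by rewrite (le_trans hm)// [leRHS](big_cat_nat (n := m))//= lerDl sumr_ge0.
have [m hm] := large (Num.Def.archi_bound d^-1).
have := archi_boundP (ltW (_ : 0 < d^-1)); rewrite invr_gt0 => /(_ d0) hb.
have := ha m w; have : (E + d) * \sum_(0 <= k < m | w k) 1 <= \sum_(0 <= k < m | w k) a k.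
  by rewrite mulr_sumr; apply: ler_sum => k /ltW; rewrite mulr1.
have : 1 < d * \sum_(0 <= k < m | w k) 1.
  by rewrite -ltr_pdivrMl// mulr1; exact: lt_le_trans hm.
lra.
Qed.

Lemma bounded_by_threshold x n (d : R) : 0 < d -> bounded_by 1 x ->
  exists k0, forall k, (k0 <= k)%N -> rnorm (x n k) <= eps n + d.
Proof. by move=> d0 bx; apply: threshold => // m w; have := bx n m w; rewrite mul1r. Qed.

Lemma fin_restrict M m x : (m <= M)%N ->
  fin M x - fin m x = fin M (restrict (fun n k => ~~ head m n k) x).
Proof.
move=> mM; apply: predual_ext => n k; rewrite -[LHS]/(trunc M x n k - trunc m x n k).
rewrite /= /trunc /restrict; case: (boolP (head m n k)) => [/(head_le mM) ->|_] /=.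
  by rewrite subrr.
by rewrite subr0.
Qed.

(** By shrinking, a bounded family of scalars acts as the weak-star limit of its
    truncations. *)
Lemma bidual_of_coordinates x r : 0 < r -> bounded_by r x ->
  exists2 z : dual (dual X), rnorm z <= r &
    forall g : dual X, (fun m => g (fin m x) : K^o) @ \oo --> (z g : K^o).
Proof.
move=> r0 bx; apply: weak_star_limit; first exact: ltW.
  by move=> m; exact: rnorm_fin_le.
move=> g; apply: scalar_cauchy_cvg; apply/scalar_cauchyP => e e0.
have e2r : 0 < e / 4 / r by rewrite !divr_gt0.
have [m hm] := shrinking g e2r.
have small M : (m <= M)%N -> rnorm (g (fin M x - fin m x) : K^o) <= e / 4.
  move=> mM; rewrite fin_restrict//.
  set y := fin M _.
  have yr : rnorm y <= r by apply: rnorm_fin_le; exact: bounded_by_restrict.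
  have := hm (of_real r^-1 *: y); rewrite !rnormZ rnorm_real ?invr_ge0 ?(ltW r0)//.
  rewrite linearZ rnormZ rnorm_real ?invr_ge0 ?(ltW r0)// [_ * rnorm (g y : K^o)]mulrC.
  rewrite ler_pdivrMr// divfK ?gt_eqF//; apply.
    by rewrite ler_pdivrMl// mulr1.
  move=> n k h; rewrite -[LHS]/(of_real r^-1 *: y n k) /y /= /trunc /restrict h /=.
  by rewrite if_same scaler0.
exists m => k l mk ml.
have E : (g (fin k x) : K^o) - g (fin l x) = g (fin k x - fin m x) - g (fin l x - fin m x).
  rewrite !linearB /=. by rewrite opprK addrACA addNr addr0.
have := rnormB (g (fin k x - fin m x) : K^o) (g (fin l x - fin m x)).
by rewrite -E; have := small k mk; have := small l ml; lra.
Qed.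

Definition bicoordinate (phi : dual (dual X)) n k : K^o := phi (coordinate n k).

Lemma sum_functional (V : normedModType K) (I : Type) (t : seq I) (P : pred I)
    (F : I -> dual V) (v : V) :
  (\sum_(i <- t | P i) F i) v = \sum_(i <- t | P i) (F i v : K^o).
Proof. by rewrite -[LHS]/(embed_op V v _) linear_sum. Qed.

(** The sum of the moduli over a finite subset of a block is the value of phi at
    a combination of coordinate functionals with unimodular coefficients, whose
    norm is at most the capacity. *)
Lemma bounded_by_bicoordinate phi : bounded_by (rnorm phi) (bicoordinate phi).
Proof.
move=> n m w; have /choice[t ht] k : exists t : K,
    rnorm (t : K^o) = 1 /\ t * bicoordinate phi n k = of_real (rnorm (bicoordinate phi n k)).
  by have [t t1 tE] := phase (bicoordinate phi n k : K); exists t.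
pose h : dual X := \sum_(0 <= k < m | w k) t k *: coordinate n k.
have hE : phi h = of_real (mass (bicoordinate phi) n m w) :> K.
  rewrite linear_sum /mass (big_morph of_real (@of_realD R s) (@of_real0 R s)).
  by apply: eq_bigr => k _; rewrite linearZ /=; exact: (ht k).2.
have m0 : 0 <= mass (bicoordinate phi) n m w by rewrite sumr_ge0// => k _; exact: rnorm_ge0.
rewrite -(@rnorm_real R s _ m0) -hE (le_trans (rnorm_op phi h))// ler_wpM2l ?rnorm_ge0//.
apply: rnorm_op_le => [|u]; first exact/ltW/capacity_gt0.
rewrite sum_functional (le_trans (ler_rnorm_sum _ _ _))// mulrC.
apply: le_trans (rnorm_predualP u n m w); apply: ler_sum => k _.
by rewrite -[X in rnorm X]/(t k *: u n k) rnormZ (ht k).1 mul1r.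
Qed.

Definition truncated_functional (g : dual X) m : dual X :=
  \sum_(n < m) \sum_(k < m) (g (basis n k) : K) *: coordinate n k.

Lemma truncated_functionalE g m u : truncated_functional g m u = g (fin m u).
Proof.
rewrite functional_fin sum_functional; apply: eq_bigr => n _; rewrite sum_functional.
by apply: eq_bigr => k _; rewrite -[LHS]/(g (basis n k) * u n k) mulrC.
Qed.

Lemma truncated_functional_cvg g e : 0 < e ->
  exists m0, forall m, (m0 <= m)%N -> rnorm (g - truncated_functional g m) <= e.
Proof.
move=> e0; have [m0 hm0] := shrinking g e0; exists m0 => m mm.
apply: rnorm_op_le_ball => u u1.
rewrite -[X in rnorm X]/(g u - truncated_functional g m u) truncated_functionalE -linearB.
rewrite sub_fin; apply: hm0; first exact: le_trans (rnorm_cut_le _ _) _.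
by move=> n k /(head_le mm) h; rewrite /= /restrict h.
Qed.

(** The truncations of g are combinations of coordinate functionals and tend to
    g in norm. *)
Lemma bicoordinate_cvg (phi : dual (dual X)) (g : dual X) e : 0 < e ->
  exists m0, forall m, (m0 <= m)%N ->
    rnorm (phi g - g (fin m (bicoordinate phi)) : K^o) <= e.
Proof.
move=> e0; have p1 : 0 < rnorm phi + 1 by rewrite ltr_wpDl ?rnorm_ge0.
have [m0 hm0] := truncated_functional_cvg g (divr_gt0 e0 p1); exists m0 => m /hm0 h.
have -> : g (fin m (bicoordinate phi)) = phi (truncated_functional g m).
  rewrite functional_fin linear_sum; apply: eq_bigr => n _; rewrite linear_sum.
  by apply: eq_bigr => k _; rewrite linearZ -[LHS]/(phi (coordinate n k) * _) mulrC.
rewrite -linearB (le_trans (rnorm_op phi _))// (le_trans (ler_wpM2l (rnorm_ge0 _) h))//.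
by rewrite mulrCA ger_pMr// ler_pdivrMr// mul1r lerDl.
Qed.

End bidual.

(** * The dual has the Schur property *)
Section dual_schur.
Context {R : realType} {s : scalars}.
Local Notation K := (scalar_field R s).
Local Notation X := (predual R s).
Implicit Types (u y : X) (r t e d : R).

Lemma behind_fin m p y : behind m y -> behind m (fin p y).
Proof.
move=> [y1 y0 ysmall]; split=> [|n k h|n k nm].
- by apply: rnorm_fin_le; exact/rnorm_predual_le.
- by rewrite /= /trunc /restrict y0// if_same.
- by rewrite (le_trans (rnorm_restrict _ _ _ _))// ysmall.
Qed.

(** The gliding hump. A vector supported in the head of size m is extended by
    one behind m on which some later functional is at least d; the vectors so
    obtained have a coordinatewise limit in the unit ball of the bidual, against
    which the sequence of functionals does not tend to 0. *)
Section hump.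
Variables (v : nat -> dual X) (d : R).
Hypothesis d0 : 0 < d.
Hypothesis v0 : forall phi : dual (dual X), (fun k => phi (v k) : K^o) @ \oo --> (0 : K^o).
Hypothesis humps : forall m k0, exists k, (k0 <= k)%N /\
  exists2 y, behind m y & d < rnorm (v k y : K^o).

Let valid (a : nat * nat * X) :=
  rnorm a.2 <= 1 /\ forall n k, ~~ head a.1.1 n k -> a.2 n k = 0.

Let step (a b : nat * nat * X) := [/\ valid b,
  (a.1.1 < b.1.1)%N /\ (a.1.2 < b.1.2)%N,
  forall n k, head a.1.1 n k -> b.2 n k = a.2 n k,
  d / 2 <= rnorm (v b.1.2.-1 b.2 : K^o) &
  forall y, rnorm y <= 1 -> (forall n k, head b.1.1 n k -> y n k = 0) ->
    rnorm (v b.1.2.-1 y : K^o) <= d / 8].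

Let stepP a : exists b, valid a -> step a b.
Proof.
case: (pselect (valid a)) => [|na]; last by exists a.
case: a => [[m K0] x] [/= x1 x0].
have d40 : 0 < d / 4 by rewrite divr_gt0.
have d80 : 0 < d / 8 by rewrite divr_gt0.
have /cvg_seqP/(_ _ d40)[K1 hK1] := v0 (J x).
have [k [kK [y ym vy]]] := humps m (maxn K0 K1).
have vk1 : 0 < rnorm (v k) + 1 by rewrite ltr_wpDl ?rnorm_ge0.
have [p hp] := fin_cvg y (divr_gt0 d40 vk1).
have [q hq] := shrinking (v k) d80.
pose m' := (maxn m (maxn p q)).+1.
exists (m', k.+1, x + fin p y) => _.
have yp : behind m (fin p y) by exact: behind_fin.
split=> /=.
- split=> /=; first exact: rnorm_glue yp.
  move=> n i h; rewrite -[LHS]/(x n i + trunc p y n i) x0; last first.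
    by apply: contraNN h; apply: head_le; rewrite /m' ltnW// ltnS leq_maxl.
  rewrite add0r /trunc /restrict ifF//; apply: negbTE; apply: contraNN h; apply: head_le.
  by rewrite /m' ltnW// ltnS leq_max leq_maxl orbT.
- by split; rewrite ltnS ?leq_maxl// (leq_trans _ kK)// leq_maxl.
- move=> n i h; rewrite -[LHS]/(x n i + fin p y n i).
  by have [_ -> //] := yp; rewrite addr0.
- have b1 : rnorm (v k (y - fin p y) : K^o) <= d / 4.
    rewrite (le_trans (rnorm_op (v k) _))//.
    apply: le_trans (ler_wpM2l (rnorm_ge0 _) (hp p (leqnn p))) _.
    by rewrite mulrCA ger_pMr// ler_pdivrMr// mul1r lerDl.
  have b2 : rnorm (v k x : K^o) < d / 4.
    by have := hK1 k (leq_trans (leq_maxr _ _) kK); rewrite subr0.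
  have b3 : v k y = v k (y - fin p y) + (v k (x + fin p y) - v k x) :> K^o.
    by rewrite linearB linearD /= [v k x + _]addrC addrK subrK.
  have b4 := rnormD (v k (y - fin p y) : K^o) (v k (x + fin p y) - v k x).
  have b5 := rnormB (v k (x + fin p y) : K^o) (v k x).
  by move: vy; rewrite b3; lra.
- move=> z z1 z0; apply: hq => // n i h; apply: z0; apply: head_le h.
  by rewrite /m' ltnW// ltnS !leq_max leqnn !orbT.
Qed.

Lemma hump_contradiction : False.
Proof.
have [f hf] := choice stepP.
pose a j := iter j f (0%N, 0%N, 0 : X).
have va j : valid (a j).
  elim: j => [|j IH]; last by have [] := hf _ IH.
  by split=> [/=|//]; rewrite rnorm0.
have sa j : step (a j) (a j.+1) by exact: hf (va j).
have aj j : (j <= (a j).1.1)%N /\ (j <= (a j).1.2)%N.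
  elim: j => [//|j [h1 h2]]; have [_ [l1 l2] _ _ _] := sa j.
  by split; [exact: leq_ltn_trans l1|exact: leq_ltn_trans l2].
have grow i j : (i <= j)%N -> forall n k, head (a i).1.1 n k ->
    head (a j).1.1 n k /\ (a j).2 n k = (a i).2 n k.
  move=> /subnK <-; elim: (j - i)%N => [//|l IH] n k h; rewrite addSn.
  have [h1 h2] := IH n k h; have [_ [l1 _] e1 _ _] := sa (l + i)%N.
  by split; [apply: head_le h1; exact: ltnW|rewrite e1].
pose psi n k : K^o := (a (maxn n k).+1).2 n k.
have hmax n k : head (a (maxn n k).+1).1.1 n k.
  by have [h _] := aj (maxn n k).+1; apply: head_le h _; rewrite /head !ltnS leq_maxl leq_maxr.
have psiE j n k : head (a j).1.1 n k -> psi n k = (a j).2 n k.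
  move=> h; rewrite /psi; have [/grow g|/ltnW/grow g] := leqP (maxn n k).+1 j.
    by have [_ ->] := g _ _ (hmax n k).
  by have [_ ->] := g _ _ h.
have psi1 : bounded_by 1 psi.
  apply: (@bounded_by_lim _ _ _ \oo _ (fun j => (a j).2 : nat -> nat -> K^o)).
    move=> n k e e0; exists (maxn n k).+1 => // j /= /grow/(_ n k (hmax n k))[h _].
    by rewrite (psiE _ _ _ h) subrr rnorm0.
  by exists 0%N => // j _; apply/rnorm_predual_le; have [] := va j.
have [z _ hz] := bidual_of_coordinates ltr01 psi1.
have d80 : 0 < d / 8 by rewrite divr_gt0.
have /cvg_seqP/(_ _ d80)[k0 hk0] := v0 z.
pose b := a k0.+1; pose g := v b.1.2.-1.
have [vb [l1 l2] _ big_b small_b] := sa k0.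
have kb : (k0 <= b.1.2.-1)%N.
  by rewrite -ltnS (ltn_predK (leq_ltn_trans (leq0n _) l2)) (leq_ltn_trans _ l2)//; have [] := aj k0.
have /cvg_seqP/(_ _ d80)[p hp] := hz g.
pose q := maxn p b.1.1.
have bq : (b.1.1 <= q)%N by exact: leq_maxr.
have fE : fin b.1.1 psi = b.2.
  apply: predual_ext => n k; rewrite /= /trunc /restrict; case: (boolP (head _ _ _)) => [h|h].
    exact: psiE.
  by have [_ ->] := vb.
have c1 : rnorm (g (fin q psi - b.2) : K^o) <= d / 8.
  apply: small_b; rewrite -fE fin_restrict//.
    by apply: rnorm_fin_le; exact: bounded_by_restrict.
  by move=> n k h; rewrite /= /trunc /restrict h /= if_same.
have c2 := hp q (leq_maxl _ _); have c3 := hk0 _ kb; rewrite subr0 in c3.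
have c4 := rnorm_sub (g b.2 : K^o) (g (fin q psi)).
have c5 := rnorm_sub (g (fin q psi) : K^o) (z g).
move: c1 big_b; rewrite linearB /= rnormBC -/b -/g => c1 big_b; lra.
Qed.

End hump.

Lemma weakly_null_behind (v : nat -> dual X) d : 0 < d ->
  (forall phi : dual (dual X), (fun k => phi (v k) : K^o) @ \oo --> (0 : K^o)) ->
  exists m k0, forall k, (k0 <= k)%N -> forall y, behind m y -> rnorm (v k y : K^o) <= d.
Proof.
move=> d0 v0; apply: contrapT => h; apply: (@hump_contradiction v d) => // m k0.
apply: contrapT => nk; apply: h; exists m, k0 => k kk y ym; rewrite leNgt.
by apply/negP => dv; apply: nk; exists k; split=> //; exists y.
Qed.

Lemma functional_fin_le (g : dual X) m (x : nat -> nat -> K^o) (M c : R) :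
  (forall n k, rnorm (x n k) <= M) ->
  (forall i j : 'I_m, rnorm (g (basis i j) : K^o) <= c) ->
  rnorm (g (fin m x) : K^o) <= (m * m)%:R * (M * c).
Proof.
move=> xM gc; rewrite functional_fin (le_trans (ler_rnorm_sum _ _ _))//.
have h (i j : 'I_m) : rnorm (x i j *: (g (basis i j) : K^o)) <= M * c.
  by rewrite rnormZ ler_pM ?rnorm_ge0.
apply: (@le_trans _ _ (\sum_(i < m) \sum_(j < m) M * c)).
  by apply: ler_sum => i _; rewrite (le_trans (ler_rnorm_sum _ _ _))// ler_sum.
by rewrite !sumr_const !card_ord -mulrnA -[_ *+ (m * m)]mulr_natl.
Qed.

(** As for shrinking, weakly_null_behind is applied a second time with a precision
    that depends on the number of blocks found the first time; in the remaining
    finitely many coordinates weak nullity suffices. *)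
Theorem dual_predual_schur : schur_null (dual X).
Proof.
move=> v v0 d d0.
have d40 : 0 < d / 2 / 2 by rewrite !divr_gt0.
have [m0 [k0 h0]] := weakly_null_behind d40 v0.
have d50 : 0 < d / 2 * eps m0 / 4 by rewrite divr_gt0// mulr_gt0 ?eps_gt0// divr_gt0.
have [m1 [k1 h1]] := weakly_null_behind d50 v0.
pose m := maxn m0 m1; pose c : R := d / 8 / (m * m).+1%:R.
have c0 : 0 < c by rewrite !divr_gt0.
have [k2 _ hk2] : \forall k \near \oo, forall i j : 'I_m, rnorm (v k (basis i j) : K^o) <= c.
  apply: filter_forall => i; apply: filter_forall => j.
  have /cvg_seqP/(_ _ c0)[p hp] := v0 (J (basis i j)); exists p => // k /= /hp.
  by rewrite subr0 => /ltW.
exists (maxn k0 (maxn k1 k2)) => k; rewrite !geq_max => /and3P[kk0 kk1 kk2].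
apply: (@le_lt_trans _ _ (d / 2 + d / 4)); last by lra.
apply: rnorm_op_le_ball => u u1.
have -> : v k u = v k (u - fin m u) + v k (fin m u) :> K^o by rewrite -linearD subrK.
rewrite (le_trans (rnormD _ _))// lerD//.
  apply: (behind_two_step (h0 k kk0) (h1 k kk1)).
    rewrite sub_fin; exact: le_trans (rnorm_cut_le _ _) _.
  by move=> n i h; rewrite sub_fin /= /restrict h.
have u2 n i : rnorm (u n i) <= 2 by have := rnorm_coord_le2 u n i; lra.
rewrite (le_trans (functional_fin_le u2 (hk2 k kk2)))// /c.
have -> : d / 4 = 2 * (d / 8) by lra.
rewrite mulrCA ler_pM2l// mulrCA ger_pMr ?divr_gt0// ler_pdivrMr// mul1r ler_nat.
exact: leqnSn.
Qed.

(** * The dual is L-embedded and separable *)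
(** The projection restricts a functional on the bidual to X. Let f be the
    restriction of z and mu = z - P z. If x nearly norms f and phi nearly norms
    mu, the bidual vector psi with the head of x and a far tail of phi has norm
    almost at most 1, while z psi is almost f x + mu phi, because mu does not see
    the head of phi and the tail of phi is almost annihilated by f. *)
Theorem dual_predual_L_embedded : L_embedded (dual X).
Proof.
pose P := comp_op (embed_op (dual X)) (adjoint (embed_op X)).
exists P; split.
- move=> z; rewrite -[LHS]/(J (adjoint (embed_op X) (P z))).
  by have -> : adjoint (embed_op X) (P z) = adjoint (embed_op X) z by exact: operator_ext.
- apply/seteqP; split=> [_ [z _ <-]|_ [f _ <-]]; first by exists (adjoint (embed_op X) z).
  exists (J f) => //; rewrite -[LHS]/(J (adjoint (embed_op X) (J f))).
  by have -> : adjoint (embed_op X) (J f) = f by exact: operator_ext.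
move=> z; pose f := adjoint (embed_op X) z; pose mu := z - P z.
rewrite -!rnormE -of_realD; congr of_real; apply/eqP; rewrite eq_le; apply/andP; split.
  by rewrite -{1}(subrK (P z) z) addrC rnormD.
have Pf : rnorm (P z) <= rnorm f by exact: rnorm_canonical_embedding.
apply: (le_trans (lerD Pf (lexx _))).
apply/ler_addgt0Pr => e e0.
have z4 : 0 < rnorm z + 4 by rewrite ltr_wpDl ?rnorm_ge0.
pose d := e / (rnorm z + 4); have d0 : 0 < d by rewrite divr_gt0.
have [x x1 [r rf fx]] : exists2 x, rnorm x <= 1 &
    exists2 r, rnorm f - d < r & f x = of_real r :> K.
  by apply: rnorm_dual_gt; rewrite ltrBlDr ltrDl.
have [phi phi1 [q qmu muphi]] : exists2 phi, rnorm phi <= 1 &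
    exists2 q, rnorm mu - d < q & mu phi = of_real q :> K.
  by apply: rnorm_dual_gt; rewrite ltrBlDr ltrDl.
have f1 : 0 < rnorm f + 1 by rewrite ltr_wpDl ?rnorm_ge0.
have [m hm] := fin_cvg x (divr_gt0 d0 f1).
have fm : rnorm (f (x - fin m x) : K^o) <= d.
  rewrite (le_trans (rnorm_op f _))// (le_trans (ler_wpM2l (rnorm_ge0 _) (hm m (leqnn m))))//.
  by rewrite mulrCA ger_pMr// ler_pdivrMr// mul1r lerDl.
have bphi : bounded_by 1 (bicoordinate phi).
  exact: bounded_by_le phi1 (bounded_by_bicoordinate phi).
have dm : 0 < d * eps m by rewrite mulr_gt0 ?eps_gt0.
have /choice[kt hkt] n := bounded_by_threshold n dm bphi.
have [p hp] := bicoordinate_cvg phi f d0.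
(* Beyond k >= M the entries of phi in all blocks n < m are below the relaxed
   threshold (1 + d) * eps n, as d * eps m <= d * eps n there. *)
pose M := maxn m (maxn p (\max_(n < m) kt n)).
have mM : (m <= M)%N by exact: leq_maxl.
have tail_small n k : (n < m)%N -> (M <= k)%N -> rnorm (bicoordinate phi n k) <= (1 + d) * eps n.
  move=> nm Mk; have ktk : (kt n <= k)%N.
    apply: leq_trans Mk; rewrite /M !leq_max; apply/orP; right; apply/orP; right.
    exact: (leq_bigmax (Ordinal nm)).
  rewrite (le_trans (hkt n k ktk))// mulrDl mul1r lerD2l ler_pM2l//.
  exact/eps_anti/ltnW.
pose psi : dual (dual X) := J (fin m x) + (phi - J (fin M (bicoordinate phi))).
have psi1 : rnorm psi <= 1 + d.
  apply: rnorm_op_le => [|g]; first by rewrite addr_ge0// ltW.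
  apply/ler_addgt0Pr => c c0.
  have [l hl] := bicoordinate_cvg phi g c0.
  pose L := maxn l M; have ML : (M <= L)%N by exact: leq_maxr.
  have hL := hl L (leq_maxl _ _).
  pose w := fin L (restrict (fun n k => ~~ head M n k) (bicoordinate phi)).
  have xw : rnorm (fin m x + w) <= 1 + d.
    apply/rnorm_predual_le; apply: (@bounded_by_glue R s (1 + d) m (fin m x) w).
    - by rewrite lerDl ltW.
    - apply/rnorm_predual_le; apply: rnorm_fin_le; exact/rnorm_predual_le.
    - by move=> n k /negbTE h; rewrite /= /trunc /restrict h.
    - apply: bounded_by_restrict; apply: bounded_by_restrict.
      by apply: bounded_by_le bphi; rewrite lerDl ltW.
    - move=> n k /(head_le mM) h; rewrite /= /trunc /restrict h /=.
      by case: (head _ _ _).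
    - move=> n k nm; rewrite (le_trans (rnorm_restrict _ _ _ _))// /restrict.
      case: ifP => [|_]; last by rewrite rnorm0 mulr_ge0 ?addr_ge0// ltW// eps_gt0.
      by rewrite /head (leq_trans nm mM) /= -leqNgt; exact: tail_small.
  have -> : psi g = g (fin m x + w) + (phi g - g (fin L (bicoordinate phi))) :> K^o.
    have sw1 (a b c' : K) : a - b = c' + (- b + (a - c')) by ring.
    rewrite /w -fin_restrict// linearD linearB.
    rewrite -[LHS]/(g (fin m x) + (phi g - g (fin M (bicoordinate phi)))) -!addrA.
    congr (_ + _); exact: sw1.
  rewrite (le_trans (rnormD _ _))// lerD//.
  by rewrite (le_trans (rnorm_op g _))// mulrC ler_wpM2r ?rnorm_ge0.
have zpsi : of_real (r + q) =
    z psi + f (x - fin m x) - (phi f - f (fin M (bicoordinate phi))) :> K^o.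
  rewrite of_realD -fx -muphi linearB.
  rewrite -[z psi]/(z (J (fin m x) + (phi - J (fin M (bicoordinate phi))))) linearD linearB.
  have sw2 (a b c h l : K) : a + (c - h) = (b + (c - l)) + (a - b) - (h - l) by ring.
  exact: (sw2 (f x) (f (fin m x)) (z phi) (phi f) (f (fin M (bicoordinate phi)))).
have h1 : r + q <= rnorm (of_real (r + q) : K^o) by rewrite rnorm_of_real ler_norm.
move: h1; rewrite zpsi => h1.
have h2 := rnormB (z psi + f (x - fin m x) : K^o) (phi f - f (fin M (bicoordinate phi))).
have h3 := rnormD (z psi : K^o) (f (x - fin m x)).
have h4 : rnorm (z psi : K^o) <= rnorm z + d * rnorm z.
  rewrite (le_trans (rnorm_op z psi))// (le_trans (ler_wpM2l (rnorm_ge0 _) psi1))//.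
  by rewrite mulrDr mulr1 [_ * d]mulrC.
have pM : (p <= M)%N by rewrite /M !leq_max leqnn orbT.
have h5 := hp M pM.
have h6 : d * rnorm z + 4 * d = e by rewrite [4 * d]mulrC -mulrDr /d divfK// gt_eqF.
rewrite -/mu; lra.
Qed.

End dual_schur.

Section dual_separable.
Context {R : realType} {s : scalars}.
Local Notation K := (scalar_field R s).
Local Notation X := (predual R s).

Lemma scalar_dense : exists h : rat * rat -> K,
  forall (a : K) (e : R), 0 < e -> exists pq, rnorm (a - h pq : K^o) < e.
Proof.
have [p [q [c [_ _ hc]]]] := @scalar_components R s.
exists (fun pq => c (ratr pq.1) (ratr pq.2)) => a e e0.
have approx (b : R) : exists r : rat, `|b - ratr r| < e / 2.
  have [r] := @rat_in_itvoo R (b - e / 2) (b + e / 2) (ltac:(lra)).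
  rewrite in_itv /= => /andP[h1 h2]; exists r.
  by rewrite ltr_norml; apply/andP; split; lra.
have [r1 h1] := approx (p a); have [r2 h2] := approx (q a); exists (r1, r2).
by apply: (le_lt_trans (hc _ _ _)); rewrite (splitr e) ltrD.
Qed.

Theorem dual_predual_separable : separable (dual X).
Proof.
have [h hh] := scalar_dense.
pose comb (t : nat * seq (seq (rat * rat))) : dual X :=
  \sum_(n < t.1) \sum_(k < t.1) h (nth (0, 0) (nth [::] t.2 n) k) *: coordinate n k.
exists (range comb); split.
  by apply: card_le_trans (card_image_le _ _) _; exact: countableP.
move=> O [g Og] oO.
have /nbhs_ballP[_ /= /pos_of_real[e e0 ->] gO] : nbhs g O by exact: open_nbhs_nbhs.
have e20 : 0 < e / 2 by rewrite divr_gt0.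
have [m /(_ m (leqnn m)) hm] := truncated_functional_cvg g e20.
pose d : R := e / 8 / (m * m).+1%:R; have d0 : 0 < d by rewrite !divr_gt0.
have /choice[c hc] (nk : nat * nat) := hh (g (basis nk.1 nk.2)) d d0.
pose t := (m, mkseq (fun n => mkseq (fun k => c (n, k)) m) m).
exists (comb t); split; last by exists t.
apply: gO; rewrite -ball_normE /= -rnorm_lt.
have tE (n k : 'I_m) : nth (0, 0) (nth [::] t.2 n) k = c (val n, val k).
  by rewrite !nth_mkseq.
have small : rnorm (truncated_functional g m - comb t) <= e / 4.
  rewrite /truncated_functional /comb -sumrB.
  apply: (le_trans (ler_rnorm_sum _ _ _)).
  apply: (@le_trans _ _ (\sum_(n < m) \sum_(k < m) 2 * d)); last first.
    rewrite !sumr_const !card_ord -mulrnA -[_ *+ (m * m)]mulr_natl /d.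
    have -> : e / 4 = 2 * (e / 8) by lra.
    rewrite mulrCA ler_pM2l// mulrCA ger_pMr ?divr_gt0// ler_pdivrMr// mul1r ler_nat.
    exact: leqnSn.
  apply: ler_sum => n _; rewrite -sumrB; apply: (le_trans (ler_rnorm_sum _ _ _)).
  apply: ler_sum => k _; rewrite -scalerBl rnormZ mulrC tE.
  apply: ler_pM; [exact: rnorm_ge0|exact: rnorm_ge0|exact: rnorm_coordinate|].
  exact/ltW/(hc (val n, val k)).
have -> : g - comb t = (g - truncated_functional g m) + (truncated_functional g m - comb t).
  by rewrite addrA subrK.
apply: (le_lt_trans (rnormD _ _)); apply: (@le_lt_trans _ _ (e / 2 + e / 4)).
  by apply: lerD; [exact: hm|exact: small].
lra.
Qed.

End dual_separable.

(** * The block projections onto c_0 *)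
Section c0_space.
Context {R : realType} {s : scalars}.
Local Notation K := (scalar_field R s).
Local Notation X := (predual R s).
Local Notation C := (c0 R s).
Implicit Types (u v : X) (x y : C) (r e d : R).

Lemma rnorm_c0_le x r : rnorm x <= r <-> forall k, rnorm (x k) <= r.
Proof.
rewrite rnorm_le; split=> [xr k|xr].
  by rewrite rnorm_le (le_trans _ xr)//; exact: c0_norm_ge.
by apply: c0_norm_le => k; rewrite -rnorm_le.
Qed.

Lemma rnorm_c0_coord x k : rnorm (x k) <= rnorm x.
Proof. exact: (proj1 (rnorm_c0_le x (rnorm x))). Qed.

Lemma c0_vanishes x e : 0 < e -> exists m, forall k, (m <= k)%N -> rnorm (x k) < e.
Proof.
move=> e0; have /asboolP/cvg_seqP/(_ e e0)[m hm] := valP x; exists m => k /hm.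
by rewrite subr0.
Qed.

Lemma evaluation_c0_bounded_linear k : (fun x => x k) \in @bounded_linear _ _ C K^o.
Proof.
apply/asboolP; split=> //; exists 1 => x.
by rewrite mul1r -!rnormE le_of_real; exact: rnorm_c0_coord.
Qed.

Definition evaluation_c0 k : dual C := Operator (evaluation_c0_bounded_linear k).

Lemma rnorm_evaluation_c0 k : rnorm (evaluation_c0 k) <= 1.
Proof. by apply: rnorm_op_le => // x; rewrite mul1r; exact: rnorm_c0_coord. Qed.

Lemma block_null n u : u n \in @null_sequence R s.
Proof.
apply/asboolP/cvg_seqP => e e0; have e40 : 0 < e / 4 by rewrite divr_gt0.
have /asboolP/(_ _ e40)[m hm] := valP u; exists m => k mk; rewrite subr0.
have := bounded_by_coord2 n k hm; rewrite /tail /restrict /head [(k < m)%N]ltnNge mk andbF /=.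
lra.
Qed.

Lemma block_bounded_linear n :
  (fun u => NullSequence (block_null n u)) \in @bounded_linear _ _ X C.
Proof.
apply/asboolP; split=> [a u v|]; first exact/val_inj.
exists (of_real 2) => u; rewrite -!rnormE -of_realM le_of_real.
by apply/rnorm_c0_le => k; exact: rnorm_coord_le2.
Qed.

Definition block n : operator X C := Operator (block_bounded_linear n).

Lemma rnorm_block n : rnorm (block n) <= 2.
Proof.
by apply: rnorm_op_le => // u; apply/rnorm_c0_le => k; exact: rnorm_coord_le2.
Qed.

Lemma functional_basis_cvg (g : dual X) n :
  (fun k => g (basis n k) : K^o) @ \oo --> (0 : K^o).
Proof.
apply/cvg_seqP => e e0; have e20 : 0 < e / 2 by rewrite divr_gt0.
have [m hm] := shrinking g e20; exists m => k mk; rewrite subr0.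
apply: (@le_lt_trans _ _ (e / 2)); last by lra.
apply: hm; first exact: rnorm_basis.
move=> n' k' /andP[_ km]; rewrite basisE.
by rewrite [k' == k]ltn_eqF ?andbF// (leq_trans km).
Qed.

Lemma basis_weakly_cauchy n : weakly_cauchy (basis n : nat -> X).
Proof. by apply: cvg_weakly_cauchy => g; apply/cvgP; exact: functional_basis_cvg. Qed.

Lemma coordinate_basis_diff n k :
  (basis n k - basis n k.+1 : X) n k = 1 :> K^o.
Proof.
rewrite -[LHS]/(basis n k n k - basis n k.+1 n k) !basisE !eqxx /=.
by rewrite ltn_eqF// subr0.
Qed.

Lemma cc_block n : (1 <= cc (block n))%E.
Proof.
apply: (cc_ge (@basis_weakly_cauchy n)); first by move=> k; exact: rnorm_basis.
apply: ca_ge1 => k; rewrite -linearB.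
apply: le_trans (rnorm_c0_coord _ k).
by rewrite -[X in rnorm X]/((basis n k - basis n k.+1) n k) coordinate_basis_diff rnorm1.
Qed.

Lemma cc_block_biadjoint n : (1 <= cc (adjoint (adjoint (block n))))%E.
Proof.
apply: (cc_ge (z := embed_op X \o basis n)).
- apply: weakly_cauchy_op; exact: basis_weakly_cauchy.
- move=> k; exact: le_trans (rnorm_canonical_embedding _) (rnorm_basis _ _).
apply: ca_ge1 => k.
pose z := adjoint (adjoint (block n)) (embed_op X (basis n k - basis n k.+1)).
rewrite -[leRHS]/(rnorm (adjoint (adjoint (block n)) (embed_op X (basis n k)) -
  adjoint (adjoint (block n)) (embed_op X (basis n k.+1)))).
rewrite -!linearB -/z.
have := rnorm_op z (evaluation_c0 k).
have -> : z (evaluation_c0 k) = 1.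
  by rewrite -(@coordinate_basis_diff n k).
rewrite rnorm1 => h; apply: (le_trans h).
by rewrite ler_piMr ?rnorm_ge0// rnorm_evaluation_c0.
Qed.

(** Entries of a bidual vector of norm at most 1 are eventually almost below the
    threshold of their block, so that the singular part of a weak-star limit of
    functionals from the unit ball of l_1 has norm at most eps. *)
Lemma wk_block_adjoint n :
  (wk (adjoint (block n) @` unit_ball (dual C)) <= (eps n)%:E)%E.
Proof.
apply: dhat_le => z e /weak_star_closureP[F FF [FA Fz]] e0.
pose f := adjoint (embed_op X) z; exists (J f); first by exists f.
apply: rnorm_op_le_ball => phi phi1.
have d0 : 0 < e / 4 by rewrite divr_gt0.
have bphi : bounded_by 1 (bicoordinate phi).
  exact: bounded_by_le phi1 (bounded_by_bicoordinate phi).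
have [k0 hk0] := bounded_by_threshold n d0 bphi.
have [p hp] := bicoordinate_cvg phi f d0.
pose m := maxn n.+1 (maxn k0 p).
have nm : (n < m)%N by rewrite /m leq_maxl.
have hm := hp m (leq_trans (leq_maxr _ _) (leq_maxr _ _)).
pose w := phi - J (fin m (bicoordinate phi)).
have zw : rnorm (z w : K^o) <= eps n + e / 4.
  apply: (@rnorm_le_near R s _ F _ K^o (fun t : dual (dual (dual X)) => t w)).
    by move=> c c0; have /cvg_rnormP := Fz w; apply.
  apply: (@filterS _ F _ _ _ _ FA) => _ [_ [h /unit_ballE h1 <-] <-].
  apply/ler_addgt0Pr => c c0.
  have [l hl] := bicoordinate_cvg phi (adjoint (block n) h) c0.
  pose L := maxn l m; have mL : (m <= L)%N by exact: leq_maxr.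
  have hL := hl L (leq_maxl _ _).
  pose y := fin L (restrict (fun n k => ~~ head m n k) (bicoordinate phi)).
  have hy : rnorm (h (block n y) : K^o) <= eps n + e / 4.
    apply: (le_trans (rnorm_op h _)); apply: (le_trans (ler_piMl (rnorm_ge0 _) h1)).
    apply/rnorm_c0_le => k; rewrite -[X in rnorm X]/(y n k) /y.
    apply: (le_trans (rnorm_restrict _ _ _ _)); rewrite /restrict /head nm /=.
    case: ltnP => mk /=; first by rewrite rnorm0 addr_ge0 ?ltW ?eps_gt0.
    apply: hk0; apply: leq_trans mk; exact: leq_trans (leq_maxl _ _) (leq_maxr _ _).
  have sw (a b c' : K) : a - b = (a - c') + (c' - b) by ring.
  have -> : J (adjoint (block n) h) w =
      (phi (adjoint (block n) h) - adjoint (block n) h (fin L (bicoordinate phi))) +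
      h (block n y) :> K^o.
    rewrite /y -fin_restrict// !linearB; exact: sw.
  rewrite addrC; apply: (le_trans (rnormD _ _)); apply: lerD; [exact: hy|exact: hL].
have sw (a b c : K) : a - b = (a - c) - (b - c) by ring.
have -> : (z - J f) phi = z w - (phi f - f (fin m (bicoordinate phi))) :> K^o.
  rewrite /w linearB; exact: sw.
apply: (le_trans (rnormB _ _)); lra.
Qed.

End c0_space.

(** * Weak noncompactness of the block projections *)
Section block_noncompactness.
Context {R : realType} {s : scalars}.
Local Notation K := (scalar_field R s).
Local Notation X := (predual R s).
Local Notation C := (c0 R s).
Implicit Types (u v : X) (x y : C) (r e d : R).

Lemma first_block_vanishing x :
  (fun n k : nat => if n == 0%N then x k else 0) \in @vanishing R s.
Proof.
apply/asboolP => e e0; have [m hm] := c0_vanishes x (mulr_gt0 e0 (@eps_gt0 R 0)).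
exists m.+1; apply: bounded_by_small; first exact: ltW.
move=> n k; rewrite /tail /restrict /head.
have small : rnorm (0 : K^o) <= e * eps n by rewrite rnorm0 mulr_ge0// ltW// eps_gt0.
case: ifP => // h; case: eqP => // n0; rewrite n0 in h *; apply/ltW/hm.
by move: h; rewrite -leqNgt; exact: ltnW.
Qed.

(** Since eps 0 = 1, the block 0 contains c_0 with an embedding of norm at most 1
    that block 0 inverts; results about c_0 are obtained from X along it. *)
Definition first_block x : X := Predual (first_block_vanishing x).

Lemma rnorm_first_block x : rnorm (first_block x) <= rnorm x.
Proof.
apply/rnorm_predual_le; apply: bounded_by_small; first exact: rnorm_ge0.
move=> n k /=; case: eqP => [->|_]; last by rewrite rnorm0 mulr_ge0 ?rnorm_ge0// ltW// eps_gt0.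
by rewrite /eps invr1 mulr1; exact: rnorm_c0_coord.
Qed.

Lemma c0_shrinking (g : dual C) e : 0 < e ->
  exists m, forall x, rnorm x <= 1 -> (forall k, (k < m)%N -> x k = 0) ->
    rnorm (g x : K^o) <= e.
Proof.
move=> e0; have [m hm] := shrinking (adjoint (block 0) g) e0; exists m => x x1 x0.
have -> : g x = adjoint (block 0) g (first_block x).
  by congr (g _); exact: val_inj.
apply: hm; first exact: le_trans (rnorm_first_block x) _.
by move=> n k /andP[_ km] /=; rewrite x0//; case: eqP.
Qed.

Definition l1_ball : set C := [set x | forall m, \sum_(0 <= k < m) rnorm (x k) <= 1].

(** The case of threshold 0. *)
Lemma bounded_l1_null (l : nat -> K^o) :
  (forall m, \sum_(0 <= k < m) rnorm (l k) <= 1) -> l \in @null_sequence R s.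
Proof.
move=> l1; apply/asboolP/cvg_seqP => e e0; have e20 : 0 < e / 2 by rewrite divr_gt0.
have [|k0 hk0] := @threshold R (fun k => rnorm (l k)) 0 _ e20.
  move=> m w; rewrite mul0r addr0; apply: le_trans (l1 m).
  rewrite big_mkcond; apply: ler_sum => k _.
  by case: (w k) => //; exact: rnorm_ge0.
exists k0 => k /hk0; rewrite add0r subr0; lra.
Qed.

Lemma c0_cut_null (m : nat) x :
  (fun k => if (k < m)%N then x k else 0) \in @null_sequence R s.
Proof.
apply/asboolP/cvg_seqP => e e0; exists m => k; rewrite leqNgt => /negbTE ->.
by rewrite subr0 rnorm0.
Qed.

Definition c0_cut m x : C := NullSequence (c0_cut_null m x).

(** On bounded sets of c_0 the weak topology is that of coordinatewise
    convergence, for which the unit ball of l_1 is compact. *)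
Lemma weakly_compact_l1_ball : weakly_compact l1_ball.
Proof.
rewrite /weakly_compact compact_ultra => F UF FK.
have FF : ProperFilter F by exact: ultra_proper.
have coord1 (x : C) k : l1_ball x -> rnorm (x k) <= 1.
  move=> x1; apply: le_trans (x1 k.+1); rewrite big_nat_recr//= lerDr.
  by apply: sumr_ge0 => i _; exact: rnorm_ge0.
have /choice[l hl] k : exists l : K^o, forall e, 0 < e ->
    \forall x \near F, rnorm ((x : C) k - l) < e.
  apply: (@scalar_ultra _ _ _ _ _ _ 1).
  by apply: (@filterS _ F _ _ _ _ FK) => x; exact: coord1.
have l1 m : \sum_(0 <= k < m) rnorm (l k) <= 1.
  apply/ler_addgt0Pr => e e0; have em : 0 < e / m.+1%:R by rewrite divr_gt0.
  have near_all : \forall x \near F, forall k : 'I_m, rnorm ((x : C) k - l k) < e / m.+1%:R.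
    by apply: filter_forall => k; exact: hl.
  have [x [hx x1]] := filter_ex (filterI near_all FK).
  apply: (@le_trans _ _ (\sum_(0 <= k < m) rnorm (x k) + \sum_(k < m) e / m.+1%:R)).
    rewrite !big_mkord -big_split /=; apply: ler_sum => k _.
    apply: le_trans (rnorm_sub _ (x k)) _; rewrite [leRHS]addrC.
    by apply: lerD => //; rewrite rnormBC; exact/ltW/hx.
  apply: lerD; first exact: x1.
  rewrite sumr_const card_ord -[_ *+ m]mulr_natl mulrCA ger_pMr// ler_pdivrMr// mul1r ler_nat.
  exact: leqnSn.
pose p : C := NullSequence (bounded_l1_null l1); exists p; split; first exact: l1.
apply/(@weak_cvgP _ _ C _ F _ id) => g; apply/cvg_rnormP => e e0.
have e40 : 0 < e / 4 by rewrite divr_gt0.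
have g1 : 0 < rnorm g + 1 by rewrite ltr_wpDl ?rnorm_ge0.
have [m hm] := c0_shrinking g e40.
have eg : 0 < e / 4 / (rnorm g + 1) by rewrite divr_gt0.
have near_all : \forall x \near F, forall k : 'I_m, rnorm ((x : C) k - l k) < e / 4 / (rnorm g + 1).
  by apply: filter_forall => k; exact: hl.
apply: (@filterS _ F _ _ _ _ (filterI near_all FK)) => x [hx x1].
pose y := (x : C) - p.
have y2 k : rnorm (y k) <= 2.
  have := rnormB ((x : C) k) (l k); have := coord1 x k x1; have := coord1 p k l1.
  by rewrite -[(x : C) k - l k]/(y k) -[p k]/(l k); lra.
have hd : rnorm (g (c0_cut m y) : K^o) <= e / 4.
  have yc : rnorm (c0_cut m y) <= e / 4 / (rnorm g + 1).
    apply/rnorm_c0_le => k /=; case: ltnP => km; first exact: ltW (hx (Ordinal km)).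
    by rewrite rnorm0 ltW.
  apply: (le_trans (rnorm_op g _)); apply: (le_trans (ler_wpM2l (rnorm_ge0 _) yc)).
  by rewrite mulrCA ger_pMr// ler_pdivrMr// mul1r lerDl.
have half : 0 <= 2^-1 :> R by rewrite invr_ge0.
have tl : rnorm (g (of_real 2^-1 *: (y - c0_cut m y)) : K^o) <= e / 4.
  have yE k : (of_real 2^-1 *: (y - c0_cut m y)) k =
      of_real 2^-1 *: (if (k < m)%N then 0 else y k) :> K^o.
    rewrite -[LHS]/(of_real 2^-1 *: (y k - c0_cut m y k)) /=.
    by case: ifP; rewrite ?subrr ?subr0.
  apply: hm => [|k km]; last by rewrite yE km scaler0.
  apply/rnorm_c0_le => k; rewrite yE rnormZ rnorm_real//.
  have := y2 k; case: ifP; rewrite ?rnorm0; lra.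
have E : (g (x : C) : K^o) - g p = g (y - c0_cut m y) + g (c0_cut m y).
  by rewrite -linearD subrK linearB.
rewrite [X in rnorm X]E.
apply: (le_lt_trans (rnormD _ _)).
move: tl; rewrite linearZ rnormZ rnorm_real//; lra.
Qed.

(** The vectors of the unit ball are split by lowering the modulus of each entry
    by the threshold. *)
Lemma dhat_block_l1_ball n : (dhat (block n @` unit_ball X) l1_ball <= (eps n)%:E)%E.
Proof.
apply: dhat_le => _ e [u /unit_ballE u1 <-] e0.
have bu := (proj1 (rnorm_predual_le u 1) u1) n.
pose c k : R := if eps n < rnorm (u n k) then 1 - eps n / rnorm (u n k) else 0.
have c01 k : 0 <= c k /\ c k * rnorm (u n k) = if eps n < rnorm (u n k) then rnorm (u n k) - eps n else 0.
  rewrite /c; case: ifP => [h|_]; last by rewrite mul0r.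
  have u0 : 0 < rnorm (u n k) by exact: lt_trans (eps_gt0 _) h.
  by rewrite subr_ge0 ler_pdivrMr// mul1r ltW// mulrBl divfK ?gt_eqF// mul1r.
have l1 m : \sum_(0 <= k < m) rnorm (of_real (c k) *: u n k) <= 1.
  have := bu m (fun k => eps n < rnorm (u n k)); rewrite /mass /capacity mul1r.
  rewrite mulr_sumr -lerBlDr -sumrB; apply: le_trans.
  rewrite [leRHS]big_mkcond; apply: ler_sum => k _.
  have [c0 ck] := c01 k; rewrite rnormZ rnorm_real// ck mulr1.
  by [].
exists (NullSequence (bounded_l1_null l1)); first exact: l1.
apply/rnorm_c0_le => k.
rewrite -[X in rnorm X]/(u n k - of_real (c k) *: u n k) -{1}[u n k]scale1r -scalerBl.
rewrite -of_real1 -of_realB rnormZ rnorm_of_real.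
have [c0 ck] := c01 k; have n0 := @eps_gt0 R n.
have c1 : 0 <= 1 - c k.
  rewrite /c; case: ifP => h; last by rewrite subr0.
  by rewrite opprB addrC subrK divr_ge0 ?rnorm_ge0// ltW.
rewrite ger0_norm// mulrBl mul1r ck; case: ltP => h; lra.
Qed.

(** The family equal to eps n on the block n is the weak-star limit of its
    truncations, which lie in the unit ball, and has distance eps n from c_0. *)
Lemma wk_block_ge n : ((eps n)%:E <= wk (block n @` unit_ball X))%E.
Proof.
pose psi i (k : nat) : K^o := if i == n then of_real (eps n) else 0.
have psi1 : bounded_by 1 psi.
  apply: bounded_by_small => // i k; rewrite mul1r /psi; case: eqP => [->|_].
    by rewrite rnorm_real// ltW// eps_gt0.
  by rewrite rnorm0 ltW// eps_gt0.
have [z z1 hz] := bidual_of_coordinates ltr01 psi1.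
pose zn := adjoint (adjoint (block n)) z.
have cl : closure (J @` (block n @` unit_ball X) : set (weak_star (dual C))) zn.
  apply: (@weak_star_closureW _ _ _ _ _ _ \oo _ (fun m => J (block n (fin m psi)))).
    exists 0%N => // m _; exists (block n (fin m psi)) => //; exists (fin m psi) => //.
    by apply/unit_ballE; exact: rnorm_fin_le.
  by move=> g; exact: (hz (adjoint (block n) g)).
apply: (dhat_ge cl) => _ [x _ <-]; apply/ler_addgt0Pr => e e0.
have [k0 hk0] := c0_vanishes x e0.
have zk : zn (evaluation_c0 k0) = of_real (eps n) :> K.
  apply: (cvg_unique _ (hz (adjoint (block n) (evaluation_c0 k0)))) => //=.
  apply: cvg_near_cst; exists (maxn n k0).+1 => // m /= mm.
  rewrite /trunc /restrict /head !(leq_trans _ mm) ?ltnS ?leq_maxl ?leq_maxr//=.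
  by rewrite /psi eqxx.
have := rnorm_op (zn - J x) (evaluation_c0 k0).
rewrite -[X in rnorm X <= _]/(zn (evaluation_c0 k0) - x k0) zk.
have := ler_piMr (rnorm_ge0 (zn - J x)) (@rnorm_evaluation_c0 R s k0).
have := rnorm_sub (of_real (eps n) : K^o) (x k0).
have hr : rnorm (of_real (eps n) : K^o) = eps n by rewrite rnorm_real// ltW// eps_gt0.
by rewrite hr; have := hk0 k0 (leqnn k0); lra.
Qed.

Lemma wk_omega_block n : wk (block n @` unit_ball X) = (eps n)%:E /\
  omega (block n @` unit_ball X) = (eps n)%:E.
Proof.
have l0 : l1_ball !=set0.
  by exists 0 => m; rewrite big1// => k _; rewrite -[X in rnorm X]/(0 : K^o) rnorm0.
have h1 := wk_block_ge n; have h2 := wk_le_omega (block n @` unit_ball X).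
have h3 := le_trans (omega_le_dhat _ l0 weakly_compact_l1_ball) (dhat_block_l1_ball n).
by split; apply/eqP; rewrite eq_le; apply/andP; split=> //;
  [exact: le_trans h3|exact: le_trans h2].
Qed.

Lemma eps_cvg0 : (fun n => (eps n)%:E) @ \oo --> (0%E : \bar R).
Proof.
apply: cvg_EFin; first by near=> n.
exact: cvg_harmonic.
Unshelve. all: by end_near. Qed.

End block_noncompactness.

(** * Weakly compact sets in the dual *)
Section weakly_compact_dual.
Context {R : realType} {s : scalars}.
Local Notation K := (scalar_field R s).
Local Notation X := (predual R s).
Local Notation C := (c0 R s).
Implicit Types (r e d : R).

Lemma eps_small e : 0 < e -> exists n, eps n < e :> R.
Proof.
move=> e0; exists (Num.Def.archi_bound e^-1).
rewrite /eps invf_plt ?posrE//.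
apply: lt_trans (archi_boundP _) _; first by rewrite invr_ge0 ltW.
by rewrite ltr_nat.
Qed.

Lemma head_near (T : Type) (F : set_system T) (FF : Filter F)
    (P : nat -> nat -> T -> Prop) j :
  (forall n k, \forall t \near F, P n k t) ->
  \forall t \near F, forall n k, head j n k -> P n k t.
Proof.
move=> hP; have h : \forall t \near F, forall (n k : 'I_j), P n k t.
  by apply: filter_forall => n; apply: filter_forall => k; exact: hP.
apply: (@filterS _ F _ _ _ _ h) => t ht n k /andP[nj kj].
exact: (ht (Ordinal nj) (Ordinal kj)).
Qed.

Lemma functional_ext (f g : dual X) : (forall n k, f (basis n k) = g (basis n k)) -> f = g.
Proof.
move=> fg; apply/subr0_eq; apply: rnorm_small_eq0 => e e0.
have [m /(_ m (leqnn m))] := truncated_functional_cvg (f - g) e0.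
suff -> : truncated_functional (f - g) m = 0 by rewrite subr0.
rewrite /truncated_functional big1// => n _; rewrite big1// => k _.
by rewrite -[X in X *: _]/(f (basis n k) - g (basis n k)) fg subrr scale0r.
Qed.

(** A weakly compact set has cluster points of its sequences; as the evaluations
    at the basis vectors separate points, a subsequence converging at these
    vectors converges weakly, hence in norm. *)
Lemma weakly_compact_subsequence (D : set (dual X)) (c : nat -> dual X) e :
  weakly_compact D -> (forall j, D (c j)) -> 0 < e ->
  exists i j, (i < j)%N /\ rnorm (c i - c j) < e.
Proof.
move=> cD Dc e0.
have [|p [Dp clp]] := cD (c @ \oo) _ _; first by exists 0%N => // j _; exact: Dc.
have /choice[nu hnu] j : exists i, (j <= i)%N /\
    forall n k, head j n k -> rnorm (c i (basis n k) - (p : dual X) (basis n k) : K^o) < eps j.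
  have near_p : nbhs (p : weak (dual X)) [set f | forall n k, head j n k ->
      rnorm ((f : dual X) (basis n k) - (p : dual X) (basis n k) : K^o) < eps j].
    apply: (@head_near _ (nbhs (p : weak (dual X))) _ (fun n k f =>
      rnorm ((f : dual X) (basis n k) - (p : dual X) (basis n k) : K^o) < eps j)) => n k.
    exact: (weak_nbhs (p : dual X) (J (basis n k)) (eps_gt0 _)).
  have cj : (c @ \oo) [set f | exists2 i, (j <= i)%N & f = c i].
    by exists j => // i ji; exists i.
  by have [_ [[i ji ->] hi]] := clp _ _ cj near_p; exists i.
have coord_cvg n k d : 0 < d -> exists N, forall j, (N <= j)%N ->
    rnorm (c (nu j) (basis n k) - (p : dual X) (basis n k) : K^o) < d.
  move=> d0; have [N hN] := eps_small d0; exists (maxn N (maxn n k).+1) => j.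
  rewrite geq_max => /andP[Nj hj]; have [_ h] := hnu j.
  apply: lt_trans (h n k _) (le_lt_trans (eps_anti Nj) hN).
  by rewrite /head !(leq_trans _ hj) ?ltnS ?leq_maxl ?leq_maxr.
have wc (phi : dual (dual X)) :
    (fun j => phi (c (nu j) - (p : dual X)) : K^o) @ \oo --> (0 : K^o).
  apply/cvg_seqP => d d0; apply: contrapT => nN.
  have /choice[mu hmu] N : exists j, (N <= j)%N /\
      d <= rnorm (phi (c (nu j) - (p : dual X)) : K^o).
    apply: contrapT => nj; apply: nN; exists N => j Nj; rewrite subr0 ltNge.
    by apply/negP => dj; apply: nj; exists j.
  have [|q [Dq clq]] := cD ((c \o nu \o mu) @ \oo) _ _.
    by exists 0%N => // j _; exact: Dc.
  have qp : (q : dual X) = p.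
    apply: functional_ext => n k; apply/subr0_eq.
    apply: (@rnorm_small_eq0 _ _ K^o) => a a0; have a20 : 0 < a / 2 by rewrite divr_gt0.
    have [N hN] := coord_cvg n k _ a20.
    have cN : ((c \o nu \o mu) @ \oo) [set f | exists2 i, (N <= i)%N & f = c (nu i)].
      exists N => // i Ni; exists (mu i) => //; have [h _] := hmu i; exact: leq_trans h.
    have [_ [[i Ni ->] hi]] := clq _ _ cN (weak_nbhs (q : dual X) (J (basis n k)) a20).
    have h1 := hN i Ni; move: hi; rewrite /= rnormBC => h2.
    have := rnormD ((q : dual X) (basis n k) - c (nu i) (basis n k) : K^o)
      (c (nu i) (basis n k) - (p : dual X) (basis n k)).
    rewrite addrA subrK; lra.
  have cd : ((c \o nu \o mu) @ \oo) [set f | d <= rnorm (phi ((f : dual X) - (p : dual X)) : K^o)].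
    by exists 0%N => // i _; have [_] := hmu i.
  have [f [/= hf1]] := clq _ _ cd (weak_nbhs (q : dual X) phi d0).
  by rewrite /= -linearB qp => /(le_lt_trans hf1); rewrite ltxx.
have e20 : 0 < e / 2 by rewrite divr_gt0.
have [N hN] := dual_predual_schur wc e20.
have Nn : (N <= (nu N).+1)%N by rewrite ltnW// ltnS; have [] := hnu N.
exists (nu N), (nu (nu N).+1); split; first by have [] := hnu (nu N).+1.
have -> : c (nu N) - c (nu (nu N).+1) = (c (nu N) - p) - (c (nu (nu N).+1) - p).
  by rewrite opprB addrA subrK.
apply: le_lt_trans (rnormB _ _) _; rewrite (splitr e).
by apply: ltrD; [exact: hN (leqnn N)|exact: hN Nn].
Qed.

(** Otherwise the set contains an infinite e-separated sequence. *)
Lemma weakly_compact_totally_bounded (D : set (dual X)) e :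
  weakly_compact D -> D !=set0 -> 0 < e ->
  exists2 F, F !=set0 /\ finite_set F &
    forall f, D f -> exists2 g, F g & rnorm (f - g) < e.
Proof.
move=> cD [f0 Df0] e0; apply: contrapT => nF.
have /choice[pick hp] (t : seq (dual X)) : exists f, D f /\
    (t != [::] -> forall g, g \in t -> e <= rnorm (f - g)).
  have [->|t0] := eqVneq t [::]; first by exists f0.
  apply: contrapT => nf; apply: nF; exists [set` t].
    split; last exact: finite_seq.
    by case: t t0 {nf} => // g t _; exists g; rewrite /= inE eqxx.
  move=> f Df; apply: contrapT => ng; apply: nf; exists f; split=> // _ g gt.
  by rewrite leNgt; apply/negP => fg; apply: ng; exists g.
pose l j := iter j (fun t => pick t :: t) [::].
pose c j := pick (l j).
have mem_l i j : (i < j)%N -> c i \in l j.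
  elim: j => // j IH; rewrite ltnS leq_eqVlt => /orP[/eqP ->|/IH h].
    by rewrite /l /= inE eqxx.
  by rewrite /l /= inE [X in _ || X]h orbT.
have [i [j [ij]]] := weakly_compact_subsequence cD (fun j => (hp (l j)).1 : D (c j)) e0.
rewrite rnormBC ltNge => /negP; apply.
apply: (hp (l j)).2 (mem_l i j ij); by case: (l j) (mem_l i j ij).
Qed.

Lemma finite_weakly_compact (V : normedModType K) (F : set V) :
  finite_set F -> weakly_compact F.
Proof. exact: (@finite_compact (weak V) F). Qed.

Theorem omega_chi_dual (A : set (dual X)) : omega A = chi A.
Proof.
apply/eqP; rewrite eq_le; apply/andP; split.
  apply: le_ereal_inf_tmp => _ [F [F0 fF] <-]; apply: omega_le_dhat => //.
  exact: finite_weakly_compact.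
apply: le_ereal_inf_tmp => _ [D [D0 cD] <-]; apply: ereal_le_real => M AM.
apply/lee_addgt0Pr => e e0.
have [F [F0 fF] hF] := weakly_compact_totally_bounded cD D0 e0.
apply: le_trans (ereal_inf_lbound _) _; first by exists F.
rewrite -EFinD; apply: dhat_le => f d Af d0.
have [g Dg fg] := dhat_lt AM Af; have [h Fh gh] := hF g Dg; exists h => //.
have -> : f - h = (f - g) + (g - h) by rewrite addrA subrK.
apply: le_trans (rnormD _ _) _.
apply: (le_trans (lerD (ltW fg) (ltW gh))); by rewrite lerDl ltW.
Qed.

(** * Sets that are almost weakly relatively compact but far from compact *)
Definition half_coordinates n : set (dual X) :=
  range (fun k => of_real 2^-1 *: coordinate n k).

Let half_ge0 : 0 <= 2^-1 :> R. Proof. by rewrite invr_ge0. Qed.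

Lemma half_coordinates_ball n : half_coordinates n `<=` unit_ball (dual X).
Proof.
move=> _ [k _ <-]; apply/unit_ballE; rewrite rnormZ rnorm_real//.
by rewrite mulrC ler_pdivrMr// mul1r rnorm_coordinate.
Qed.

Lemma wk_half_coordinates n : (wk (half_coordinates n) <= (eps n)%:E)%E.
Proof.
apply: le_trans (wk_block_adjoint n); apply: wk_mono => _ [k _ <-].
exists (of_real 2^-1 *: evaluation_c0 k); last exact: operator_ext.
apply/unit_ballE; rewrite rnormZ rnorm_real//.
apply: (@le_trans _ _ (2^-1 * 1)); last by rewrite mulr1 invf_le1// ler1n.
by apply: ler_wpM2l => //; exact: rnorm_evaluation_c0.
Qed.

(** The k-th coordinates of finitely many functionals are all small for some k. *)
Lemma chi_half_coordinates n : ((4^-1)%:E <= chi (half_coordinates n))%E.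
Proof.
apply: le_ereal_inf_tmp => _ [F [_ fF] <-].
have e0 : 0 < 4^-1 :> R by rewrite invr_gt0.
have [k hk] : exists k, forall g, F g -> rnorm (g (basis n k) : K^o) <= 4^-1.
  have [t ->] := (finite_seqP F).1 fF.
  have [N hN] : exists N, forall k, (N <= k)%N -> forall g, g \in t ->
      rnorm (g (basis n k) : K^o) <= 4^-1.
    elim: t => [|g t [N hN]]; first by exists 0%N.
    have /cvg_seqP/(_ _ e0)[M hM] := functional_basis_cvg g n.
    exists (maxn N M) => k; rewrite geq_max => /andP[Nk Mk] h.
    rewrite inE => /orP[/eqP ->|]; last exact: hN.
    by have := hM k Mk; rewrite subr0 => /ltW.
  by exists N => g; exact: hN (leqnn N) g.
apply: (dhat_ge (a := of_real 2^-1 *: coordinate n k)); first by exists k.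
move=> g Fg; apply: (@le_trans _ _ (rnorm ((of_real 2^-1 *: coordinate n k - g) (basis n k)))).
  rewrite -[X in rnorm X]/(of_real 2^-1 *: basis n k n k - g (basis n k)) basisE !eqxx /=.
  have := rnorm_sub (of_real 2^-1 *: (1 : K^o)) (g (basis n k)).
  rewrite rnormZ rnorm_real// rnorm1; have := hk g Fg; lra.
apply: rnorm_op_ball; exact: rnorm_basis.
Qed.

End weakly_compact_dual.

(** * Uniform boundedness *)
Section uniform_boundedness.
Context {R : realType} {s : scalars}.
Local Notation K := (scalar_field R s).

Lemma pow_third_small (e : R) : 0 < e -> exists j, 3^-1 ^+ j < e.
Proof.
move=> e0; have [n hn] := eps_small e0; exists n; apply: le_lt_trans hn.
rewrite exprVn /eps lef_pV2 ?posrE ?exprn_gt0//.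
elim: n => [|n IH]; first by rewrite expr0.
rewrite exprS -natr1; have : 1 <= 3 ^+ n :> R by rewrite exprn_ege1// ler1n.
lra.
Qed.

(** The steps towards a vector on which the operators are unbounded have lengths
    3^-j, and the j-th one makes the image under the j-th operator T large; the
    later steps only undo a part of that, their total length being 3^-j / 2. *)
Lemma uniform_boundedness (V W : normedModType K) (T : nat -> operator V W) :
  (forall x : nat -> V,
    (forall e : R, 0 < e ->
      exists n, forall k l, (n <= k)%N -> (n <= l)%N -> rnorm (x k - x l) < e) ->
    exists y, forall e : R, 0 < e -> exists n, forall k, (n <= k)%N -> rnorm (x k - y) < e) ->
  (forall x, exists M, forall n, rnorm (T n x) <= M) ->
  exists M, forall n, rnorm (T n) <= M.
Proof.
move=> cV bT; apply: contrapT => nM.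
pose t j : R := 3^-1 ^+ j.
have t0 j : 0 < t j by rewrite exprn_gt0// invr_gt0.
have tS j : t j = 3 * t j.+1 by rewrite /t exprS mulrA mulfV ?mul1r// pnatr_eq0.
have /choice[nu hnu] j : exists n, 6 * j%:R < t j * rnorm (T n).
  apply: contrapT => nn; apply: nM; exists (6 * j%:R / t j) => n; rewrite leNgt.
  by apply/negP; rewrite ltr_pdivrMr// [_ * t j]mulrC => h; apply: nn; exists n.
have /choice[f hf] (jx : nat * V) : exists y, rnorm (y - jx.2) <= t jx.1 /\
    2 / 3 * t jx.1 * rnorm (T (nu jx.1)) <= rnorm (T (nu jx.1) y).
  case: jx => j x /=; set S := T (nu j).
  have S0 : 0 < rnorm S.
    rewrite -(pmulr_rgt0 _ (t0 j)); apply: le_lt_trans (hnu j).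
    by rewrite mulr_ge0.
  have [y y1 hy] : exists2 y, rnorm y <= 1 & 2 / 3 * rnorm S < rnorm (S y).
    by apply: rnorm_op_gt; rewrite gtr_pMl//; lra.
  pose a : K := of_real (t j).
  have ay (z : V) : rnorm (a *: z) = t j * rnorm z by rewrite rnormZ rnorm_real// ltW.
  have big : 2 / 3 * t j * rnorm S <= t j * rnorm (S y).
    by rewrite mulrAC [_ * t j]mulrC ler_pM2l// ltW.
  have sum : 2 * (t j * rnorm (S y)) <= rnorm (S (x + a *: y)) + rnorm (S (x - a *: y)).
    have E : S (x + a *: y) - S (x - a *: y) = (a + a) *: S y.
      by rewrite -linearB opprB addrC addrA subrK scalerDl linearD linearZ.
    have := rnormB (S (x + a *: y)) (S (x - a *: y)).
    rewrite E rnormZ /a -of_realD rnorm_real ?addr_ge0 ?(ltW (t0 j))//; lra.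
  have yt : t j * rnorm y <= t j by rewrite ler_piMr// ltW.
  have [h|h] := leP (2 / 3 * t j * rnorm S) (rnorm (S (x + a *: y))).
    by exists (x + a *: y); split=> //; rewrite addrC addKr ay.
  exists (x - a *: y); split; last by lra.
  by rewrite addrC addKr rnormN ay.
pose x := fix x j := if j is j'.+1 then f (j', x j') else 0.
have hx j : rnorm (x j.+1 - x j) <= t j /\
    2 / 3 * t j * rnorm (T (nu j)) <= rnorm (T (nu j) (x j.+1)) by exact: (hf (j, x j)).
have tail j l : rnorm (x (l + j)%N.+1 - x j.+1) <= 2^-1 * t j * (1 - t l).
  elim: l => [|l IH]; first by rewrite subrr rnorm0 /t expr0 subrr mulr0.
  have -> : x (l.+1 + j)%N.+1 - x j.+1 =
      (x (l.+1 + j)%N.+1 - x (l + j)%N.+1) + (x (l + j)%N.+1 - x j.+1) by rewrite addrA subrK.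
  have [h _] := hx (l + j)%N.+1.
  have tt : t (l + j)%N.+1 = t l.+1 * t j by rewrite /t -addSn exprD.
  apply: (le_trans (rnormD _ _)); apply: (le_trans (lerD h IH)).
  by rewrite tt (tS l); lra.
have tail' j i : (j < i)%N -> rnorm (x i - x j.+1) <= 2^-1 * t j.
  move=> ji; have := tail j (i - j.+1)%N; rewrite -addnS subnK// => h; apply: (le_trans h).
  rewrite ler_piMr ?mulr_ge0 ?invr_ge0// ?(ltW (t0 j))//.
  by have := t0 (i - j.+1)%N; lra.
have [|y hy] := cV x.
  move=> e e0; have [j hj] := pow_third_small e0; exists j.+1 => k l jk jl.
  have -> : x k - x l = (x k - x j.+1) - (x l - x j.+1) by rewrite opprB addrA subrK.
  apply: (le_lt_trans (rnormB _ _)); have := tail' j k jk; have := tail' j l jl.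
  by move: hj; rewrite -/(t j); lra.
have [M hM] := bT y.
have yx j : rnorm (y - x j.+1) <= 2^-1 * t j.
  apply/ler_addgt0Pr => e e0; have [n hn] := hy e e0.
  have := hn (maxn n j.+1) (leq_maxl _ _); have := tail' j (maxn n j.+1) (leq_maxr _ _).
  have := rnormB (x (maxn n j.+1) - x j.+1) (x (maxn n j.+1) - y).
  by rewrite opprB addrC addrA subrK; lra.
pose j := (Num.Def.archi_bound `|M|).
have jM : M < j%:R.
  by apply: le_lt_trans (ler_norm M) _; exact: archi_boundP (normr_ge0 _).
have [_ h1] := hx j; have h2 := hM (nu j); have h3 := hnu j.
have h4 : rnorm (T (nu j) (y - x j.+1)) <= 2^-1 * (t j * rnorm (T (nu j))).
  apply: (le_trans (rnorm_op _ _)); apply: (le_trans (ler_wpM2l (rnorm_ge0 _) (yx j))).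
  by rewrite mulrC mulrA.
have h5 := rnormB (T (nu j) y) (T (nu j) (y - x j.+1)).
have h6 : T (nu j) y - T (nu j) (y - x j.+1) = T (nu j) (x j.+1).
  by rewrite -linearB opprB addrC subrK.
rewrite h6 in h5.
have h7 : 2 / 3 * t j * rnorm (T (nu j)) = 2 / 3 * (t j * rnorm (T (nu j))) by rewrite mulrA.
rewrite h7 in h1; lra.
Qed.

(** The vectors are pointwise bounded as functionals on the dual, which is
    complete, and have the same norm there by the Hahn-Banach theorem. *)
Lemma weakly_null_bounded (V : normedModType K) (v : nat -> V) :
  (forall g : dual V, (fun k => g (v k) : K^o) @ \oo --> (0 : K^o)) ->
  exists M, forall k, rnorm (v k) <= M.
Proof.
move=> v0.
have [|x|M hM] := @uniform_boundedness (dual V) K^o (fun k => J (v k)).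
- move=> x cx; have [|l hl] := @dual_complete R s V (x @ \oo) _.
    by move=> e /cx[n hn]; exists (x n), n => // k /= nk; exact: hn.
  by exists l => e /hl[n _ hn]; exists n => k nk; exact: hn.
- have /cvg_seqP/(_ 1 ltr01)[n hn] := v0 x.
  exists (1 + \sum_(0 <= k < n) rnorm (x (v k) : K^o)) => k.
  have s0 : 0 <= \sum_(0 <= k < n) rnorm (x (v k) : K^o).
    by apply: sumr_ge0 => i _; exact: rnorm_ge0.
  have [nk|kn] := leqP n k.
    by have := hn k nk; rewrite subr0 => h; apply: (le_trans (ltW h)); rewrite lerDl.
  rewrite big_mkord (bigD1 (Ordinal kn))//= addrCA lerDl addr_ge0//.
  by apply: sumr_ge0 => i _; exact: rnorm_ge0.
exists M => k; have [g g1 gv] := norming_functional (v k).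
have : rnorm (g (v k) : K^o) <= M.
  apply: le_trans (hM k); exact: (rnorm_op_ball (J (v k)) g1).
by rewrite gv rnorm_real// rnorm_ge0.
Qed.

End uniform_boundedness.

(** * The Dunford-Pettis property *)
Section dunford_pettis_predual.
Context {R : realType} {s : scalars}.
Local Notation K := (scalar_field R s).
Local Notation X := (predual R s).
Implicit Types (r e d : R).

Section operator_on_predual.
Variables (Y : normedModType K) (T : operator X Y) (D : set Y).
Hypothesis cD : weakly_compact D.
Hypothesis TD : forall x, rnorm x <= 1 -> D (T x).

(** The second adjoint maps the bidual into Y: the truncations of a bidual vector
    are mapped into a weakly compact set. *)
Lemma biadjoint_in_range (phi : dual (dual X)) : rnorm phi <= 1 ->
  exists y, forall h : dual Y, phi (adjoint T h) = h y.
Proof.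
move=> phi1; pose x m := fin m (bicoordinate phi).
have x1 m : rnorm (x m) <= 1.
  apply: rnorm_fin_le; exact: bounded_by_le phi1 (bounded_by_bicoordinate phi).
have [|y [_ cly]] := @cD (T \o x @ \oo) _ _.
  by exists 0%N => // m _; exact: TD.
exists y => h; apply/subr0_eq; apply: (@rnorm_small_eq0 _ _ K^o) => e e0.
have e20 : 0 < e / 2 by rewrite divr_gt0.
have [m hm] := bicoordinate_cvg phi (adjoint T h) e20.
have Fm : (T \o x @ \oo) [set z | exists2 l, (m <= l)%N & z = T (x l)].
  by exists m => // l ml; exists l.
have [_ [[l ml ->] hl]] := cly _ _ Fm (weak_nbhs (y : Y) h e20).
have h1 := hm l ml; have h2 : rnorm (h (T (x l)) - h y : K^o) < e / 2 := hl.
have := rnormD (phi (adjoint T h) - h (T (x l)) : K^o) (h (T (x l)) - h y).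
rewrite addrA subrK => h3; apply: (le_trans h3).
rewrite (splitr e); exact: lerD h1 (ltW h2).
Qed.

(** A functional that vanishes on the range of T is annihilated by the adjoint. *)
Lemma biadjoint_in_closed_range (phi : dual (dual X)) : rnorm phi <= 1 ->
  exists y, (forall h : dual Y, phi (adjoint T h) = h y) /\
    forall e, 0 < e -> exists x, rnorm (y - T x) < e.
Proof.
move=> /biadjoint_in_range[y hy]; exists y; split=> // e e0.
have [||h hT|_ [x _ <-] hx] := @mazur_subspace R s Y (range T) y _ _ _ e e0.
- by move=> a _ _ [u _ <-] [v _ <-]; exists (a *: u + v) => //; rewrite linearP.
- by exists 0 => //; rewrite linear0.
- have h0 : adjoint T h = 0 by apply: operator_ext => x; apply: hT; exists x.
  by rewrite -hy h0 linear0.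
by exists x.
Qed.

(** A bounded sequence of functionals that converges at the basis vectors is
    Cauchy at every point of X, and on functionals of the form adjoint T h a
    bidual vector acts like a limit of points T x. *)
Lemma adjoint_weakly_cauchy (h : nat -> dual Y) : (forall j, rnorm (h j) <= 1) ->
  exists2 nu : nat -> nat, (forall j, (j <= nu j)%N) &
    weakly_cauchy (fun j => adjoint T (h (nu j))).
Proof.
move=> h1; pose f j := adjoint T (h j).
have sw (z1 z2 z3 z4 : K) : z1 - z2 = (z1 - z3) - (z2 - z4) + (z3 - z4) by ring.
have f1 j : rnorm (f j) <= rnorm T.
  apply: (le_trans (rnorm_op _ _)); apply: le_trans (rnorm_adjoint T).
  by rewrite ler_piMr ?rnorm_ge0.
have [U [UU oU]] := ultraFilterLemma (eventually_filter : ProperFilter \oo).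
have FU : ProperFilter U by exact: ultra_proper.
have /choice[l hl] (nk : nat * nat) : exists l : K^o, forall e, 0 < e ->
    \forall j \near U, rnorm (f j (basis nk.1 nk.2) - l : K^o) < e.
  apply: (@scalar_ultra R s nat U UU _ (rnorm T)); apply: oU; exists 0%N => // j _.
  apply: le_trans (f1 j); exact: rnorm_op_ball (rnorm_basis _ _).
have /choice[nu hnu] j : exists i, (j <= i)%N /\
    forall n k, head j n k -> rnorm (f i (basis n k) - l (n, k) : K^o) < eps j.
  have near_l := @head_near nat U (@filter_filter _ _ FU) (fun n k i =>
    rnorm (f i (basis n k) - l (n, k) : K^o) < eps j) j
    (fun n k => hl (n, k) (eps j) (eps_gt0 j)).
  have Uj : U [set i | (j <= i)%N] by apply: oU; exists j.
  by have [i [hi ji]] := @filter_ex _ U _ _ (filterI near_l Uj); exists i.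
exists nu => [j|phi]; first by have [] := hnu j.
have coord_cauchy (x : X) e : 0 < e -> exists N, forall i j, (N <= i)%N -> (N <= j)%N ->
    rnorm (f (nu i) x - f (nu j) x : K^o) < e.
  move=> e0; have T1 : 0 < rnorm T + 1 by rewrite ltr_wpDl ?rnorm_ge0.
  have e80 : 0 < e / 8 / (rnorm T + 1) by rewrite !divr_gt0.
  have [m /(_ m (leqnn m)) hm] := fin_cvg x e80.
  have x1 : 0 < 2 * rnorm x + 1 by rewrite ltr_wpDl// mulr_ge0// rnorm_ge0.
  pose c : R := e / 8 / (m * m).+1%:R / (2 * rnorm x + 1).
  have c0 : 0 < c / 2 by rewrite !divr_gt0.
  have [N0 hN0] := eps_small c0; pose N := maxn N0 m.
  exists N => i j Ni Nj.
  have small a (p : nat) : (N <= p)%N -> a = f (nu p) ->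
      rnorm (a (x - fin m x) : K^o) <= e / 8.
    move=> _ ->; apply: (le_trans (rnorm_op _ _)).
    apply: (@le_trans _ _ (rnorm T * (e / 8 / (rnorm T + 1)))).
      by apply: ler_pM; rewrite ?rnorm_ge0.
    by rewrite mulrCA ger_pMr ?divr_gt0// ler_pdivrMr// mul1r lerDl.
  have close p : (N <= p)%N -> forall n k : 'I_m,
      rnorm (f (nu p) (basis n k) - l (val n, val k) : K^o) < c / 2.
    move=> Np n k; have [_ hp] := hnu p.
    apply: lt_trans (hp n k _) (le_lt_trans (eps_anti (leq_trans (leq_maxl _ _) Np)) hN0).
    by rewrite /head !(leq_trans (ltn_ord _))// (leq_trans _ Np)// leq_maxr.
  have close2 (n k : 'I_m) : rnorm ((f (nu i) - f (nu j)) (basis n k) : K^o) <= c.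
    have := rnormB (f (nu i) (basis n k) - l (val n, val k) : K^o)
      (f (nu j) (basis n k) - l (val n, val k)).
    rewrite opprB addrA subrK => h3; apply: (le_trans h3).
    rewrite (splitr c); exact: lerD (ltW (close i Ni n k)) (ltW (close j Nj n k)).
  have hd : rnorm ((f (nu i) - f (nu j)) (fin m x) : K^o) <= e / 8.
    have := functional_fin_le (fun n k => rnorm_coord_le2 x n k) close2.
    move=> h3; apply: (le_trans h3).
    have -> : (m * m)%:R * (2 * rnorm x * c) =
        e / 8 * ((m * m)%:R / (m * m).+1%:R) * (2 * rnorm x / (2 * rnorm x + 1)).
      by rewrite /c; ring.
    rewrite -mulrA ger_pMr ?divr_gt0// mulr_ile1 ?divr_ge0 ?mulr_ge0 ?rnorm_ge0 ?(ltW x1)//.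
      by rewrite ler_pdivrMr// mul1r ler_nat.
    by rewrite ler_pdivrMr// mul1r lerDl.
  have -> : f (nu i) x - f (nu j) x =
      f (nu i) (x - fin m x) - f (nu j) (x - fin m x) + (f (nu i) - f (nu j)) (fin m x) :> K^o.
    rewrite (linearB (f (nu i))) (linearB (f (nu j))); exact: sw.
  apply: (le_lt_trans (rnormD _ _)).
  have := rnormB (f (nu i) (x - fin m x) : K^o) (f (nu j) (x - fin m x)).
  have := small _ i Ni erefl; have := small _ j Nj erefl; lra.
apply/scalar_cauchyP => e e0.
have p1 : 0 < rnorm phi + 1 by rewrite ltr_wpDl ?rnorm_ge0.
pose a : R := (rnorm phi + 1)^-1; have a0 : 0 < a by rewrite invr_gt0.
have [y [hy yT]] : exists y, (forall h : dual Y, (of_real a *: phi) (adjoint T h) = h y) /\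
    forall e, 0 < e -> exists x, rnorm (y - T x) < e.
  apply: biadjoint_in_closed_range; rewrite rnormZ rnorm_real ?(ltW a0)//.
  by rewrite mulrC ler_pdivrMr// mul1r lerDl.
have ae : 0 < a * e / 4 by rewrite divr_gt0// mulr_gt0.
have [x hx] := yT _ ae; have [N hN] := coord_cauchy x _ ae; exists N => i j Ni Nj.
rewrite -(ltr_pM2l a0) -{1}(@rnorm_real R s a) ?(ltW a0)// -rnormZ.
have -> : of_real a *: (phi (adjoint T (h (nu i))) - phi (adjoint T (h (nu j))) : K^o) =
    h (nu i) (y - T x) - h (nu j) (y - T x) + (f (nu i) x - f (nu j) x).
  rewrite scalerBr -[of_real a *: phi (adjoint T (h (nu i)))]/((of_real a *: phi) (adjoint T (h (nu i)))).
  rewrite -[of_real a *: phi (adjoint T (h (nu j)))]/((of_real a *: phi) (adjoint T (h (nu j)))).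
  rewrite !hy (linearB (h (nu i))) (linearB (h (nu j))); exact: sw.
have b1 p : rnorm (h p (y - T x) : K^o) <= rnorm (y - T x).
  by apply: (le_trans (rnorm_op _ _)); rewrite ler_piMl ?rnorm_ge0.
apply: (le_lt_trans (rnormD _ _)).
have := rnormB (h (nu i) (y - T x) : K^o) (h (nu j) (y - T x)).
have := b1 (nu i); have := b1 (nu j); have := hN i j Ni Nj; lra.
Qed.

(** The functionals that norm the vectors T (v k) pull back to a sequence with a
    norm Cauchy subsequence, hence are uniformly close to a single functional on
    the bounded sequence v. *)
Lemma predual_completely_continuous (v : nat -> X) :
  (forall g : dual X, (fun k => g (v k) : K^o) @ \oo --> (0 : K^o)) ->
  forall e, 0 < e -> exists n, forall k, (n <= k)%N -> rnorm (T (v k)) < e.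
Proof.
move=> v0 e e0; apply: contrapT => nn.
have /choice[p hp] (n : nat) : exists k, (n <= k)%N /\ e <= rnorm (T (v k)).
  apply: contrapT => nk; apply: nn; exists n => k nk'; rewrite ltNge.
  by apply/negP => ek; apply: nk; exists k.
have /choice[h hh] (n : nat) : exists h : dual Y,
    rnorm h <= 1 /\ h (T (v (p n))) = of_real (rnorm (T (v (p n)))) :> K.
  by have [h h1 hv] := norming_functional (T (v (p n))); exists h.
have [nu nu_ge cf] := adjoint_weakly_cauchy (fun j => (hh j).1).
have [M vM] := weakly_null_bounded v0.
have M1 : 0 < M + 1 by have := vM 0%N; have := rnorm_ge0 (v 0%N); lra.
have e2M : 0 < e / 2 / (M + 1) by rewrite !divr_gt0.
have [N hN] := schur_null_cauchy dual_predual_schur cf e2M.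
have e20 : 0 < e / 2 by rewrite divr_gt0.
pose f j := adjoint T (h (nu j)).
have /cvg_seqP/(_ _ e20)[N1 hN1] := v0 (f N).
pose j := maxn N N1; pose w := v (p (nu j)).
have w1 : rnorm (f N w : K^o) < e / 2.
  have := hN1 (p (nu j)); rewrite subr0; apply.
  by apply: leq_trans (hp _).1; apply: leq_trans (nu_ge _); exact: leq_maxr.
have w2 : rnorm ((f j - f N) w : K^o) <= e / 2.
  apply: (le_trans (rnorm_op _ _)).
  apply: (@le_trans _ _ (e / 2 / (M + 1) * M)).
    apply: ler_pM; [exact: rnorm_ge0|exact: rnorm_ge0| |exact: vM].
    by apply: ltW; apply: hN; rewrite ?leq_maxl.
  by rewrite mulrAC ler_pdivrMr// ler_pM2l// lerDl.
have w3 : e <= rnorm (f j w : K^o).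
  rewrite -[X in rnorm X]/(h (nu j) (T w)) (hh _).2 rnorm_real ?rnorm_ge0//.
  exact: (hp (nu j)).2.
have := rnorm_sub (f j w : K^o) (f N w).
rewrite -[X in rnorm X + _]/((f j - f N) w); lra.
Qed.

End operator_on_predual.
End dunford_pettis_predual.

(** * Products and completeness *)
Section products.
Context {R : realType} {s : scalars}.
Local Notation K := (scalar_field R s).
Variables (V W : normedModType K).

Lemma rnorm_prod (x : V * W) : rnorm x = Num.max (rnorm x.1) (rnorm x.2).
Proof.
apply: (@of_real_inj R s); rewrite rnormE prod_normE -!rnormE /Order.max lt_of_real.
by case: ifP.
Qed.

Lemma inl_bounded_linear : (fun x : V => (x, 0 : W)) \in @bounded_linear _ _ V (V * W)%type.
Proof.
apply/asboolP; split=> [a x y|].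
  by rewrite -[RHS]/(a *: x + y, a *: 0 + 0) scaler0 addr0.
exists 1 => x; rewrite mul1r -!rnormE le_of_real rnorm_prod /= rnorm0.
by rewrite ge_max lexx rnorm_ge0.
Qed.

Lemma inr_bounded_linear : (fun y : W => (0 : V, y)) \in @bounded_linear _ _ W (V * W)%type.
Proof.
apply/asboolP; split=> [a x y|].
  by rewrite -[RHS]/(a *: 0 + 0, a *: x + y) scaler0 addr0.
exists 1 => x; rewrite mul1r -!rnormE le_of_real rnorm_prod /= rnorm0.
by rewrite ge_max lexx rnorm_ge0.
Qed.

Lemma fst_bounded_linear : (fun x : V * W => x.1) \in @bounded_linear _ _ (V * W)%type V.
Proof.
apply/asboolP; split=> //; exists 1 => x.
by rewrite mul1r -!rnormE le_of_real rnorm_prod le_max lexx.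
Qed.

Lemma snd_bounded_linear : (fun x : V * W => x.2) \in @bounded_linear _ _ (V * W)%type W.
Proof.
apply/asboolP; split=> //; exists 1 => x.
by rewrite mul1r -!rnormE le_of_real rnorm_prod le_max lexx orbT.
Qed.

Definition inl_op : operator V (V * W)%type := Operator inl_bounded_linear.
Definition inr_op : operator W (V * W)%type := Operator inr_bounded_linear.
Definition fst_op : operator (V * W)%type V := Operator fst_bounded_linear.
Definition snd_op : operator (V * W)%type W := Operator snd_bounded_linear.

Lemma rnorm_inl_op : rnorm inl_op <= 1.
Proof.
by apply: rnorm_op_le => // x; rewrite mul1r rnorm_prod /= rnorm0 ge_max lexx rnorm_ge0.
Qed.

Lemma rnorm_inr_op : rnorm inr_op <= 1.
Proof.
by apply: rnorm_op_le => // x; rewrite mul1r rnorm_prod /= rnorm0 ge_max lexx rnorm_ge0.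
Qed.

Lemma rnorm_fst_op : rnorm fst_op <= 1.
Proof. by apply: rnorm_op_le => // x; rewrite mul1r rnorm_prod le_max lexx. Qed.

Lemma rnorm_snd_op : rnorm snd_op <= 1.
Proof. by apply: rnorm_op_le => // x; rewrite mul1r rnorm_prod le_max lexx orbT. Qed.

End products.

Section main.
Context {R : realType} {s : scalars}.
Local Notation K := (scalar_field R s).
Local Notation X := (predual R s).
Local Notation C := (c0 R s).

Lemma c0_complete (F : set_system C) (FF : ProperFilter F) :
  (forall e : R, 0 < e -> exists a, \forall u \near F, rnorm (u - a) < e) ->
  exists l, forall e : R, 0 < e -> \forall u \near F, rnorm (u - l) < e.
Proof.
move=> cF.
have fb (u v : C) : first_block u - first_block v = first_block (u - v).
  apply: predual_ext => n k; rewrite -[LHS]/(first_block u n k - first_block v n k) /=.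
  by case: eqP; rewrite ?subrr.
have [e /cF[a ha]|l hl] := @predual_complete R s (first_block @ F) _.
  exists (first_block a); apply: (@filterS _ F _ _ _ _ ha) => u ua.
  have h := rnorm_first_block (u - a); rewrite -fb in h; exact: (le_lt_trans h ua).
exists (block 0 l) => e e0; have e20 : 0 < e / 2 by rewrite divr_gt0.
apply: (@filterS _ F _ _ _ _ (hl _ e20)) => u ul.
have -> : u - block 0 l = block 0 (first_block u - l) by rewrite linearB; congr (_ - _); exact: val_inj.
apply: (le_lt_trans (rnorm_op _ _)).
apply: (@le_lt_trans _ _ (2 * rnorm (first_block u - l))).
  by apply: ler_wpM2r; [exact: rnorm_ge0|exact: rnorm_block].
by rewrite mulrC -ltr_pdivlMr.
Qed.

HB.instance Definition _ :=
  Uniform_isComplete.Build C (@normed_complete _ _ _ c0_complete).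

(** * Failure of the quantitative properties *)

Lemma not_direct_qDP_predual : ~ direct_qDP X.
Proof.
move=> [M [M0 hM]]; have Mi : 0 < M^-1 by rewrite invr_gt0.
have [n hn] := eps_small Mi.
have h1 := le_trans (cc_block n) (hM C (block n)).
have h2 : (M%:E * wk (adjoint (block n) @` unit_ball (dual C)) <= M%:E * (eps n)%:E)%E.
  by apply: lee_wpmul2l; [rewrite lee_fin ltW|exact: wk_block_adjoint].
have := le_trans h1 h2; rewrite -EFinM lee_fin leNgt => /negP; apply.
by rewrite -ltr_pdivlMl// mulr1.
Qed.

Lemma not_dual_qDP_dual : ~ dual_qDP (dual X).
Proof.
move=> [M [M0 hM]]; have Mi : 0 < M^-1 by rewrite invr_gt0.
have [n hn] := eps_small Mi.
pose Y : completeNormedModType K := HB.pack_for (completeNormedModType K) (dual C)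
  (Uniform_isComplete.Build (dual C) (@normed_complete _ _ _ (@dual_complete R s C))).
have h1 := le_trans (cc_block_biadjoint n) (hM Y (adjoint (block n))).
have h2 : (M%:E * wk (adjoint (block n) @` unit_ball (dual C)) <= M%:E * (eps n)%:E)%E.
  by apply: lee_wpmul2l; [rewrite lee_fin ltW|exact: wk_block_adjoint].
have := le_trans h1 h2; rewrite -EFinM lee_fin leNgt => /negP; apply.
by rewrite -ltr_pdivlMl// mulr1.
Qed.

(** * The Dunford-Pettis property of the sum *)

(** On the second summand weakly null sequences are norm null. *)
Lemma dunford_pettis_sum : dunford_pettis (X * dual X)%type.
Proof.
move=> Y T cT u /weakly_convergentP[x ux]; apply/cvg_ex; exists (T x).
apply/cvg_seqP => e e0; have e20 : 0 < e / 2 by rewrite divr_gt0.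
pose D := closure (T @` unit_ball (X * dual X)%type : set (weak Y)).
have TD (v : X) : rnorm v <= 1 -> D (comp_op T (inl_op X (dual X)) v).
  move=> v1; apply: subset_closure; exists (inl_op X (dual X) v) => //.
  by apply/unit_ballE; rewrite rnorm_prod /= rnorm0 ge_max v1 ler01.
have null (V : normedModType K) (L : operator (X * dual X)%type V) (g : dual V) :
    (fun k => g (L (u k - x)) : K^o) @ \oo --> (0 : K^o).
  have -> : (fun k => g (L (u k - x)) : K^o) =
      (fun k => comp_op g L (u k) - comp_op g L x).
    by apply/funext => k; rewrite (linearB L) (linearB g).
  exact: (cvg_diff0 (ux (comp_op g L))).
have [n1 h1] := predual_completely_continuous cT TD (null _ (fst_op X (dual X))) e20.
have T1 : 0 < rnorm T + 1 by rewrite ltr_wpDl ?rnorm_ge0.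
have [n2 h2] := dual_predual_schur (null _ (snd_op X (dual X))) (divr_gt0 e20 T1).
exists (maxn n1 n2) => k; rewrite geq_max => /andP[k1 k2].
pose w := u k - x.
have wE : w = inl_op X (dual X) w.1 + inr_op X (dual X) w.2.
  by rewrite -[RHS]/(w.1 + 0, 0 + w.2) addr0 add0r; case: w.
have -> : (T \o u) k - T x = T (inl_op X (dual X) w.1) + T (inr_op X (dual X) w.2).
  by rewrite -linearD -wE linearB.
apply: (le_lt_trans (rnormD _ _)); rewrite (splitr e).
apply: ltrD; first exact: h1.
apply: (le_lt_trans (rnorm_op _ _)).
have w2 : rnorm (inr_op X (dual X) w.2) <= rnorm w.2.
  by apply: (le_trans (rnorm_op _ _)); rewrite ler_piMl ?rnorm_ge0 ?rnorm_inr_op.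
apply: (@le_lt_trans _ _ (rnorm T * rnorm w.2)); first by apply: ler_wpM2l; rewrite ?rnorm_ge0.
have hw := h2 k k2.
apply: (@le_lt_trans _ _ (rnorm w.2 * (rnorm T + 1))).
  by rewrite mulrC ler_wpM2l ?rnorm_ge0// lerDl.
by rewrite -ltr_pdivlMr.
Qed.

Lemma two_of_real : 2 = of_real 2 :> K.
Proof. by rewrite -[2 in RHS]/(1 + 1) of_realD of_real1. Qed.

End main.

Theorem mainTheorem8 (R : realType) (s : scalars) :
  exists X : completeNormedModType (scalar_field R s),
    [/\ [/\ separable (dual X), L_embedded (dual X), schur (dual X),
            direct_qDP (dual X) & dual_qDP X],
        exists A : nat -> set (dual X),
          [/\ forall n, A n `<=` unit_ball (dual X),
              forall n, omega (A n) = chi (A n),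
              forall n, ((4^-1)%:E <= chi (A n))%E &
              (fun n => wk (A n)) @ \oo --> 0%E],
        exists T : nat -> operator X (c0 R s),
          [/\ forall n, `|T n| <= 2,
              forall n, (1 <= cc (T n))%E,
              forall n, omega (T n @` unit_ball X) = wk (T n @` unit_ball X) &
              (fun n => wk (T n @` unit_ball X)) @ \oo --> 0%E],
        ~ direct_qDP X /\ ~ dual_qDP (dual X) &
        [/\ dunford_pettis (X * dual X)%type,
            ~ direct_qDP (X * dual X)%type &
            ~ dual_qDP (X * dual X)%type]].
Proof.
exists (predual R s); split.
- split.
  + exact: dual_predual_separable.
  + exact: dual_predual_L_embedded.
  + exact: schur_null_schur dual_predual_schur.
  + exact: schur_direct_qDP dual_predual_schur.
  + exact: schur_dual_qDP dual_predual_schur.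
- exists half_coordinates; split.
  + exact: half_coordinates_ball.
  + by move=> n; exact: omega_chi_dual.
  + exact: chi_half_coordinates.
  + apply: (squeeze_cvge _ (cvg_cst 0%E) (@eps_cvg0 R)).
    apply: nearW => n; apply/andP; split; last exact: wk_half_coordinates.
    by apply: wk_ge0; exists (of_real 2^-1 *: coordinate n 0), 0%N.
- exists block; split.
  + by move=> n; rewrite two_of_real -rnorm_le; exact: rnorm_block.
  + exact: cc_block.
  + by move=> n; have [-> ->] := @wk_omega_block R s n.
  + under eq_fun do rewrite (wk_omega_block _).1.
    exact: eps_cvg0.
- split; [exact: not_direct_qDP_predual|exact: not_dual_qDP_dual].
- split.
  + exact: dunford_pettis_sum.
  + move=> h; apply: not_direct_qDP_predual.
    apply: (direct_qDP_retract (rnorm_inl_op _ _) (rnorm_fst_op _ _) _ h).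
    by [].
  + move=> h; apply: not_dual_qDP_dual.
    apply: (dual_qDP_retract (rnorm_inr_op _ _) (rnorm_snd_op _ _) _ h).
    by [].
Qed.
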